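(* Let $n\ge 5$ and let $0<\varphi_1\le\varphi_2\le\varphi_3\le\pi/2$ with $\cos(\varphi_1)+\cos(\varphi_2)<1+\cos(\varphi_3)$. Let $\mathfrak{v}=\mathbb{H}^{n-1}$ with canonical basis $\{J_1,J_2,J_3\}$ of its quaternionic structure. Let $\{e_0,e_1,e_2,e_3\}$ be a basis of unit vectors of a four-dimensional totally real subspace of $\mathbb{H}^{n-1}$ such that $\langle e_0,e_i\rangle=0$ for $i=1,2,3$ and $$\langle e_i,e_{i+1}\rangle=\frac{\cos(\varphi_{i+2})-\cos(\varphi_i)\cos(\varphi_{i+1})}{\sin(\varphi_i)\sin(\varphi_{i+1})},\qquad i=1,2,3,$$ with indices taken cyclically in $\{1,2,3\}$ (such vectors exist). Put $\xi_0=e_0$ and $\xi_k=\cos(\varphi_k)J_ke_0+\sin(\varphi_k)J_ke_k$ for $k=1,2,3$, and let $\mathfrak{w}^\perp=\mathrm{span}_{\mathbb{R}}\{\xi_0,\xi_1,\xi_2,\xi_3\}$, a subspace of $\mathfrak{v}$ of constant quaternionic Kähler angle $(\varphi_1,\varphi_2,\varphi_3)$. Let $\mathfrak{w}=\mathfrak{v}\ominus\mathfrak{w}^\perp$. Then: (a) The tubes around the submanifold $S_{\mathfrak{w}}$ of $\mathbb{H}H^n$ are isoparametric hypersurfaces with constant principal curvatures. (b) There is a subgroup of $Sp(n-1)Sp(1)$ that acts transitively on the unit sphere of $\mathfrak{w}^\perp$ (via the standard representation on $\mathfrak{v}=\mathbb{H}^{n-1}$). (c) The subgroup $N_K^0(S_{\mathfrak{w}})S_{\mathfrak{w}}$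 of $G$ acts isometrically with cohomogeneity one on $\mathbb{H}H^n$, $S_{\mathfrak{w}}$ is a singular orbit of this action, and the other orbits are tubes around $S_{\mathfrak{w}}$.
   Context: **Quaternionic structure.** $\mathbb{H}^{n-1}$ carries its standard real inner product. A canonical basis $\{J_1,J_2,J_3\}$ consists of orthogonal endomorphisms with $J_i^2=-I$ and $J_iJ_{i+1}=J_{i+2}=-J_{i+1}J_i$, for $(i,i+1,i+2)$ any cyclic permutation of $(1,2,3)$. A real subspace $W\subset\mathbb{H}^{n-1}$ is totally real if $\langle J_jx,y\rangle=0$ for all $x,y\in W$, $j=1,2,3$. The group $Sp(n-1)Sp(1)$ acts on $\mathbb{H}^{n-1}$ in the standard way ($Sp(n-1)$ commuting with $J_1,J_2,J_3$, and $Sp(1)$ being the unit quaternions spanned by $I,J_1,J_2,J_3$). **Model of $\mathbb{H}H^n$.** Let $\mathfrak{z}$ be a three-dimensional Euclidean space with orthonormal basis $Z_1,Z_2,Z_3$, let $J:\mathfrak{z}\to\mathrm{End}(\mathfrak{v})$ be the linear map with $J_{Z_i}=J_i$, let $\mathfrak{n}=\mathfrak{v}\oplus\mathfrak{z}$ (orthogonal sum) with bracket $\langle[U,V]_{\mathfrak{n}},Z\rangle=\langle J_ZU,V\rangle$ for $U,V\in\mathfrak{v}$, $Z\in\mathfrak{z}$, and with $\mathfrak{z}$ central, and let $\mathfrak{a}=\mathbb{R}B$. On $\mathfrak{a}\oplus\mathfrak{n}$ put $\langle rB+U+X,sB+V+Y\rangle=rs+\langle U+X,V+Y\rangle_{\mathfrak{n}}$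 and $[rB+U+X,sB+V+Y]=[U,V]_{\mathfrak{n}}+\tfrac12rV-\tfrac12sU+rY-sX$. The simply connected Lie group $AN$ with this Lie algebra and the induced left-invariant metric is isometric to the quaternionic hyperbolic space $\mathbb{H}H^n$ (constant quaternionic sectional curvature $-1$). $S_{\mathfrak{w}}$ is the connected subgroup of $AN$ with Lie algebra $\mathfrak{a}\oplus\mathfrak{w}\oplus\mathfrak{z}$; it is viewed both as a submanifold of $AN=\mathbb{H}H^n$ and as a subgroup of $AN\subset G$ (acting by left translations). **Groups.** $G=Sp(n,1)$ is the connected component of the identity of the isometry group of $\mathbb{H}H^n$ (acting effectively, i.e. up to the finite kernel of the action), and $K=Sp(n)Sp(1)$ is the isotropy group of $G$ at the identity element of $AN=\mathbb{H}H^n$. $N_K(S_{\mathfrak{w}})=\{k\in K:kS_{\mathfrak{w}}k^{-1}\subset S_{\mathfrak{w}}\}$ is the normalizer of $S_{\mathfrak{w}}$ in $K$, and $N_K^0(S_{\mathfrak{w}})$ its connected component of the identity. **Other notions.** For a nonzero $\xi\in\mathfrak{w}^\perp$ let $F_Z\xi$ be the orthogonal projection of $J_Z\xi$ onto $\mathfrak{w}^\perp$. The quaternionic (generalized) Kähler angle of a unit $\xi\in\mathfrak{w}^\perp$ is the triple $0\le\varphi_1\le\varphi_2\le\varphi_3\le\pi/2$ such that $\cos^2\varphi_1,\cos^2\varphi_2,\cos^2\varphi_3$ are the eigenvalues of the quadratic form $Z\mapsto\langle F_Z\xi,F_Z\xi\rangle$ on $\mathfrak{z}$; it is constant if independent of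 $\xi$. The tube of radius $r>0$ around $S_{\mathfrak{w}}$ is the set of points $\gamma(r)$, where $\gamma$ runs over unit speed geodesics starting orthogonally at points of $S_{\mathfrak{w}}$. A hypersurface is isoparametric if it and its nearby parallel hypersurfaces have constant mean curvature. An isometric action has cohomogeneity one if its orbits of maximal dimension have codimension one; a singular orbit is one of smaller dimension. *)

(* Defs.v *)
From HB Require Import structures.
From mathcomp Require Import all_boot all_order all_algebra.
From mathcomp Require Import all_classical all_reals all_analysis.
From mathcomp Require Import ring.
Set Implicit Arguments.
Unset Strict Implicit.
Unset Printing Implicit Defensive.
Import Order.TTheory GRing.Theory Num.Theory numFieldNormedType.Exports.

Local Open Scope classical_set_scope.
Local Open Scope ring_scope.

(** * Riemannian geometry in a global chart

  The manifold is a finite-dimensional normed space [E] (all of it: a single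
  chart), its tangent spaces are all identified with [E], and [g p] is the
  inner product on the tangent space at [p]. *)

Section Smooth.
Context {R : realType}.

(* For [A] open. *)
Fixpoint Ck {E F : normedModType R} (k : nat) (A : set E) (f : E -> F) : Prop :=
  match k with
  | 0%N => forall x, A x -> {for x, continuous f}
  | k'.+1 => (forall x, A x -> differentiable f x) /\
             (forall v, Ck k' A (fun x => 'D_v f x))
  end.

Definition smooth_on {E F : normedModType R} (A : set E) (f : E -> F) :=
  forall k, Ck k A f.

Definition smooth_curve {E : normedModType R} (c : R -> E) :=
  smooth_on [set: R] c.

Definition tangent {E : normedModType R} (N : set E) (p : E) : set E :=
  [set v | exists c : R -> E, [/\ smooth_curve c, c 0 = p,
     (\forall t \near (0 : R), N (c t)) & derive1 c 0 = v]].

(* Embedded submanifolds, as local regular zero sets; [k] is the codimension. *)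
Definition submanifold {E : normedModType R} (k : nat) (N : set E) :=
  forall p, N p -> exists (U : set E) (f : E -> 'rV[R]_k),
    [/\ open U, U p, smooth_on U f,
        (forall q, U q -> (N q <-> f q = 0)) &
        (forall q, U q -> N q -> set_surj [set: E] [set: 'rV[R]_k] ('d f q))].

Definition hypersurface {E : normedModType R} (N : set E) :=
  N !=set0 /\ submanifold 1 N.

Definition smooth_along {E : normedModType R} (N : set E) (nu : E -> E) :=
  forall p, N p -> exists (U : set E) (nu' : E -> E),
    [/\ open U, U p, smooth_on U nu' & forall q, U q -> N q -> nu q = nu' q].

Lemma derive_eq (E F : normedModType R) (f : E -> F) (v a : E) (l : F) :
  h^-1 *: (f (h *: v + a) - f a) @[h --> 0^'] --> l -> 'D_v f a = l.
Proof. by move=> /cvg_lim; apply; exact: norm_hausdorff. Qed.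

Lemma cvg_triple {E1 E2 E3 : normedModType R} (F : set_system R)
    {FF : Filter F} (f1 : R -> E1) (f2 : R -> E2) (f3 : R -> E3)
    (a1 : E1) (a2 : E2) (a3 : E3) :
  f1 x @[x --> F] --> a1 -> f2 x @[x --> F] --> a2 -> f3 x @[x --> F] --> a3 ->
  (f1 x, f2 x, f3 x) @[x --> F] --> (a1, a2, a3).
Proof. by move=> c1 c2 c3; exact: cvg_pair (cvg_pair c1 c2) c3. Qed.

End Smooth.

Section Riemannian.
Context {R : realType} {E : normedModType R} (g : E -> E -> E -> R).

(* Koszul formula: the value at [p] of g(nabla_u v, w) for the constant
   vector fields [u], [v], [w] of the chart. *)
Definition christoffel (p u v w : E) : R :=
  2^-1 * ('D_u (fun q => g q v w) p + 'D_v (fun q => g q u w) p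
          - 'D_w (fun q => g q u v) p).

(* [a] is the Levi-Civita covariant derivative at time [t] of the vector field
   [V] along the curve [c]. *)
Definition covariant_derivative (c V : R -> E) (t : R) (a : E) :=
  forall w, g (c t) a w =
    g (c t) (derive1 V t) w + christoffel (c t) (derive1 c t) (V t) w.

Definition geodesic (c : R -> E) :=
  smooth_curve c /\ forall t, covariant_derivative c (derive1 c) t 0.

Definition normal_space (N : set E) (p : E) : set E :=
  [set x | forall v, tangent N p v -> g p x v = 0].

Definition tube (N : set E) (r : R) : set E :=
  [set q | exists c : R -> E,
     [/\ geodesic c, N (c 0), normal_space N (c 0) (derive1 c 0),
         g (c 0) (derive1 c 0) (derive1 c 0) = 1 & q = c r]].

Definition unit_normal_field (N : set E) (nu : E -> E) :=
  smooth_along N nu /\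
  forall p, N p -> normal_space N p (nu p) /\ g p (nu p) (nu p) = 1.

Definition parallel_hypersurface (N : set E) (nu : E -> E) (t : R) : set E :=
  [set q | exists c : R -> E,
     [/\ geodesic c, N (c 0), derive1 c 0 = nu (c 0) & q = c t]].

Definition orthonormal_basis (p : E) (T : set E) (d : nat) (e : 'I_d -> E) :=
  [/\ forall i, T (e i),
      forall i j, g p (e i) (e j) = (i == j)%:R &
      forall x, T x -> x = \sum_i g p x (e i) *: e i].

(* [S_nu X = Y], where [S_nu X = - nabla_X nu] is the shape operator at [p];
   nabla_X nu is computed along a curve of [N] with initial velocity [X]. *)
Definition shape_operator (N : set E) (nu : E -> E) (p X Y : E) :=
  exists c : R -> E, [/\ smooth_curve c, c 0 = p,
    (\forall t \near (0 : R), N (c t)), derive1 c 0 = X &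
    covariant_derivative c (nu \o c) 0 (- Y)].

(* The eigenvalues of the shape operator, listed with multiplicity. *)
Definition principal_curvatures (N : set E) (nu : E -> E) (p : E)
    (d : nat) (kappa : 'I_d -> R) :=
  exists e : 'I_d -> E, orthonormal_basis p (tangent N p) e /\
    forall i, shape_operator N nu p (e i) (kappa i *: e i).

(* The trace of the shape operator. *)
Definition mean_curvature (N : set E) (nu : E -> E) (p : E) (h : R) :=
  exists (d : nat) (e Y : 'I_d -> E),
    [/\ orthonormal_basis p (tangent N p) e,
        forall i, shape_operator N nu p (e i) (Y i) &
        h = \sum_i g p (Y i) (e i)].

Definition constant_principal_curvatures (N : set E) :=
  exists nu, unit_normal_field N nu /\
  exists (d : nat) (kappa : 'I_d -> R),
    forall p, N p -> principal_curvatures N nu p kappa.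

Definition constant_mean_curvature (N : set E) :=
  exists nu, unit_normal_field N nu /\
  exists h : R, forall p, N p -> mean_curvature N nu p h.

Definition isoparametric_hypersurface (N : set E) :=
  [/\ hypersurface N, constant_mean_curvature N &
      exists nu, unit_normal_field N nu /\
      \forall t \near (0 : R),
        hypersurface (parallel_hypersurface N nu t) /\
        constant_mean_curvature (parallel_hypersurface N nu t)].

Definition isometry : set (E -> E) :=
  [set f : E -> E | [/\ bijective f, smooth_on [set: E] f &
     forall p u v, g (f p) ('d f p u) ('d f p v) = g p u v]].

(* For a set of self-maps containing the identity, its identity component in
   the compact-open topology. *)
Definition identity_component (A : set (E -> E)) : set (E -> E) :=
  connected_component (A : set {compact-open, E -> E}) idfun.

Definition transformation_group (H : set (E -> E)) :=
  [/\ H idfun, forall f h, H f -> H h -> H (f \o h) &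
      forall f, H f -> exists h, [/\ H h, cancel f h & cancel h f]].

Definition orbit_of (H : set (E -> E)) (p : E) : set E := [set f p | f in H].

Definition cohomogeneity_one (H : set (E -> E)) :=
  (forall p, exists k, (1 <= k)%N /\ submanifold k (orbit_of H p)) /\
  (exists p, submanifold 1 (orbit_of H p)).

Definition singular_orbit (H : set (E -> E)) (N : set E) :=
  (exists p, N = orbit_of H p) /\ exists k, (1 < k)%N /\ submanifold k N.

End Riemannian.

(** * Quaternionic linear algebra

  The Euclidean space [v = H^(n-1)] is ['cV[R]_m] with [m = 4 (n - 1)]; its
  quaternionic structure is given by a canonical basis [J]. Indices in
  {1, 2, 3} taken cyclically are elements of ['I_3] = {0, 1, 2}, with addition
  modulo 3. *)

Section Quaternionic.
Context {R : realType} {m : nat} (J : 'I_3 -> 'M[R]_m).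

Definition dot {d : nat} (x y : 'cV[R]_d) : R := \sum_i x i 0 * y i 0.

Lemma dotE d (x y : 'cV[R]_d) : dot x y = (x^T *m y) 0 0.
Proof. by rewrite mxE; apply: eq_bigr => i _; rewrite mxE. Qed.

Lemma dotDl d (x y z : 'cV[R]_d) : dot (x + y) z = dot x z + dot y z.
Proof. by rewrite !dotE linearD /= mulmxDl mxE. Qed.
Lemma dotDr d (x y z : 'cV[R]_d) : dot z (x + y) = dot z x + dot z y.
Proof. by rewrite !dotE mulmxDr mxE. Qed.
Lemma dotZl d a (x z : 'cV[R]_d) : dot (a *: x) z = a * dot x z.
Proof. by rewrite !dotE linearZ /= -scalemxAl mxE. Qed.
Lemma dotZr d a (x z : 'cV[R]_d) : dot z (a *: x) = a * dot z x.
Proof. by rewrite !dotE -scalemxAr mxE. Qed.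

Lemma dotC d (x y : 'cV[R]_d) : dot x y = dot y x.
Proof. by apply: eq_bigr => i _; rewrite mulrC. Qed.

Definition canonical_basis := forall i : 'I_3,
  [/\ (J i)^T *m J i = 1%:M,
      J i *m J i = - 1%:M,
      J i *m J (i + 1) = J (i + 2) &
      J (i + 1) *m J i = - J (i + 2)].

Lemma canonical_skew i : canonical_basis -> (J i)^T = - J i.
Proof.
move=> /(_ i) [ortho sq _ _].
have : (J i)^T *m J i *m J i = J i by rewrite ortho mul1mx.
by rewrite -mulmxA sq mulmxN mulmx1 => E0; apply/eqP; rewrite -eqr_oppLR E0.
Qed.

Definition totally_real (W : {vspace 'cV[R]_m}) :=
  forall (j : 'I_3) x y, x \in W -> y \in W -> dot (J j *m x) y = 0.

Definition Sp : set 'M[R]_m :=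
  [set A | A^T *m A = 1%:M /\ forall i, A *m J i = J i *m A].

Definition Sp1 : set 'M[R]_m :=
  [set Q | exists (a : R) (b : 'I_3 -> R),
     a ^+ 2 + \sum_i b i ^+ 2 = 1 /\ Q = a%:M + \sum_i b i *: J i].

Definition SpSp1 : set 'M[R]_m :=
  [set A *m Q | A in Sp & Q in Sp1].

Definition matrix_group (H : set 'M[R]_m) :=
  [/\ H 1%:M, forall A B, H A -> H B -> H (A *m B) &
      forall A, H A -> A \in unitmx /\ H (invmx A)].

Definition unit_sphere (W : {vspace 'cV[R]_m}) : set 'cV[R]_m :=
  [set x | x \in W /\ dot x x = 1].

Definition acts_transitively (H : set 'M[R]_m) (S : set 'cV[R]_m) :=
  (forall A x, H A -> S x -> S (A *m x)) /\
  (forall x y, S x -> S y -> exists A, H A /\ A *m x = y).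

Definition orthogonal_complement (W : {vspace 'cV[R]_m}) : set 'cV[R]_m :=
  [set x | forall y, y \in W -> dot x y = 0].

Definition orthogonal_projection (W : {vspace 'cV[R]_m}) (x y : 'cV[R]_m) :=
  y \in W /\ orthogonal_complement W (x - y).

(* [F i] is F_{Z_i} xi, so the matrix below is that of the quadratic form
   |F_Z xi|^2 in the orthonormal basis Z_1, Z_2, Z_3. *)
Definition kahler_angle (W : {vspace 'cV[R]_m}) (xi : 'cV[R]_m)
    (phi : 'I_3 -> R) :=
  [/\ 0 <= phi 0, phi 0 <= phi 1, phi 1 <= phi 2, phi 2 <= pi / 2 &
      exists F : 'I_3 -> 'cV[R]_m,
        (forall i, orthogonal_projection W (J i *m xi) (F i)) /\
        char_poly (\matrix_(i, j) dot (F i) (F j)) =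
          \prod_i ('X - (cos (phi i) ^+ 2)%:P)].

Definition constant_kahler_angle (W : {vspace 'cV[R]_m}) (phi : 'I_3 -> R) :=
  forall xi, unit_sphere W xi -> kahler_angle W xi phi.

(* e_0 is [e 0], and e_1, e_2, e_3 are [e (lift 0 i)] for [i : 'I_3]. *)
Definition admissible_vectors (phi : 'I_3 -> R) (e : 'I_4 -> 'cV[R]_m) :=
  exists W : {vspace 'cV[R]_m},
  [/\ [/\ \dim W = 4, totally_real W & basis_of W [tuple e k | k < 4]],
      forall k, dot (e k) (e k) = 1,
      forall i : 'I_3, dot (e 0) (e (lift 0 i)) = 0 &
      forall i : 'I_3, dot (e (lift 0 i)) (e (lift 0 (i + 1))) =
        (cos (phi (i + 2)) - cos (phi i) * cos (phi (i + 1))) /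
        (sin (phi i) * sin (phi (i + 1)))].

Definition xi_vector (phi : 'I_3 -> R) (e : 'I_4 -> 'cV[R]_m) (k : 'I_4)
    : 'cV[R]_m :=
  if unlift 0 k is Some i
  then cos (phi i) *: (J i *m e 0) + sin (phi i) *: (J i *m e k)
  else e 0.

Definition wperp (phi : 'I_3 -> R) (e : 'I_4 -> 'cV[R]_m)
    : {vspace 'cV[R]_m} :=
  (<<[tuple xi_vector phi e k | k < 4]>>)%VS.

End Quaternionic.

(** * The group AN

  [((r, U), X) : AN R m] stands for r B + U + X in the Lie algebra, and for
  Exp(U + X) exp(r B) in the group; the identity element is [0]. *)

Notation AN R m := (R * 'cV[R]_m * 'cV[R]_3)%type.

Section DamekRicci.
Context {R : realType} {m : nat} (J : 'I_3 -> 'M[R]_m).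

Definition n_bracket (U V : 'cV[R]_m) : 'cV[R]_3 :=
  \col_i dot (J i *m U) V.

Lemma n_bracketDl U V W :
  n_bracket (U + V) W = n_bracket U W + n_bracket V W.
Proof. by apply/colP => i; rewrite !mxE mulmxDr dotDl. Qed.
Lemma n_bracketDr U V W :
  n_bracket W (U + V) = n_bracket W U + n_bracket W V.
Proof. by apply/colP => i; rewrite !mxE dotDr. Qed.
Lemma n_bracketZl a U W : n_bracket (a *: U) W = a *: n_bracket U W.
Proof. by apply/colP => i; rewrite !mxE -scalemxAr dotZl. Qed.
Lemma n_bracketZr a U W : n_bracket W (a *: U) = a *: n_bracket W U.
Proof. by apply/colP => i; rewrite !mxE dotZr. Qed.

Lemma n_bracket0l V : n_bracket 0 V = 0.
Proof. by rewrite -(scale0r 0) n_bracketZl scale0r. Qed.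
Lemma n_bracket0r V : n_bracket V 0 = 0.
Proof. by rewrite -(scale0r 0) n_bracketZr scale0r. Qed.

Lemma n_bracketC U V : canonical_basis J -> n_bracket U V = - n_bracket V U.
Proof.
move=> cJ; apply/colP => i; rewrite !mxE [in RHS]dotC !dotE trmx_mul.
by rewrite canonical_skew// mulmxN mulNmx mxE mulmxA.
Qed.

Lemma n_bracketxx U : canonical_basis J -> n_bracket U U = 0.
Proof.
move=> cJ; have /eqP := n_bracketC U U cJ.
by rewrite -addr_eq0 -mulr2n -scaler_nat scaler_eq0 pnatr_eq0 /= => /eqP.
Qed.

Definition an_bracket (x y : AN R m) : AN R m :=
  (0, (2^-1 * x.1.1) *: y.1.2 - (2^-1 * y.1.1) *: x.1.2,
   n_bracket x.1.2 y.1.2 + x.1.1 *: y.2 - y.1.1 *: x.2).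

Definition an_inner (x y : AN R m) : R :=
  x.1.1 * y.1.1 + dot x.1.2 y.1.2 + dot x.2 y.2.

Definition an_mul (p q : AN R m) : AN R m :=
  (p.1.1 + q.1.1, p.1.2 + expR (p.1.1 / 2) *: q.1.2,
   p.2 + expR p.1.1 *: q.2
       + (2^-1 * expR (p.1.1 / 2)) *: n_bracket p.1.2 q.1.2).

Definition an_inv (p : AN R m) : AN R m :=
  (- p.1.1, - (expR (- p.1.1 / 2) *: p.1.2), - (expR (- p.1.1) *: p.2)).

Lemma an_mulA p q r : an_mul p (an_mul q r) = an_mul (an_mul p q) r.
Proof.
case: p q r => [[a U] X] [[b V] Y] [[c W] Z]; rewrite /an_mul /=.
congr (_, _, _); first by rewrite addrA.
- by rewrite mulrDl expRD scalerDr scalerA addrA.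
- have e2 : expR a = expR (a / 2) * expR (a / 2).
    by rewrite -expRD; congr expR; field.
  rewrite n_bracketDr n_bracketDl !n_bracketZr !n_bracketZl mulrDl !expRD e2.
  by apply/colP => i; rewrite !mxE; ring.
Qed.

Lemma an_mul0 p : an_mul 0 p = p.
Proof.
case: p => [[a U] X]; rewrite /an_mul /=; congr (_, _, _).
- by rewrite add0r.
- by rewrite mul0r expR0 scale1r add0r.
- by rewrite n_bracket0l scaler0 addr0 expR0 scale1r add0r.
Qed.

Lemma an_mulV p : canonical_basis J -> an_mul (an_inv p) p = 0.
Proof.
case: p => [[a U] X] cJ; rewrite /an_mul /an_inv /=.
rewrite -scaleNr n_bracketZl n_bracketxx// !scaler0 addr0 scaleNr.
by congr (_, _, _); rewrite addNr.
Qed.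

(* The left-invariant vector field with value [a] at the identity. *)
Definition left_invariant (a p : AN R m) : AN R m := 'D_a (an_mul p) 0.

Lemma left_invariantE a p : left_invariant a p =
  (a.1.1, expR (p.1.1 / 2) *: a.1.2,
   expR p.1.1 *: a.2
   + (2^-1 * expR (p.1.1 / 2)) *: n_bracket p.1.2 a.1.2).
Proof.
apply: derive_eq.
apply: cvg_near_cst; near=> h.
have h0 : h != 0 by near: h; exact: nbhs_dnbhs_neq.
rewrite addr0; case: p a => [[r U] X] [[s V] Y]; rewrite /an_mul /=.
rewrite ?n_bracketDr ?n_bracketZr ?n_bracket0r ?scaler0 ?addr0.
congr (_, _, _) => /=.
- by rewrite [X in _ *: X](_ : _ = h * s) ?[LHS]mulKf//; rewrite addrC addKr.
- by apply/colP => i; rewrite !mxE; field.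
- by apply/colP => i; rewrite !mxE; field.
Unshelve. all: by end_near.
Qed.

Lemma is_derive_expRM (a : R) :
  is_derive (0 : R) 1 (fun h : R => expR (h * a)) a.
Proof.
apply: is_derive_eq; rewrite /= mul0r expR0 mul1r scaler0 add0r.
by rewrite /GRing.scale /= mulr1.
Qed.

Lemma expRM_slope (a : R) : h^-1 * (expR (h * a) - 1) @[h --> 0^'] --> a.
Proof.
have D := is_derive_expRM a; have dD := @ex_derive _ _ _ _ _ _ _ D.
have : h^-1 *: (expR ((h *: 1 + 0) * a) - expR (0 * a)) @[h --> 0^']
    --> 'D_1 (fun h : R => expR (h * a)) 0.
  exact: dD.
rewrite derive_val; apply: cvg_trans; apply: near_eq_cvg; near=> h.
by rewrite /= mul0r expR0 addr0 [h *: 1]mulr1.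
Unshelve. all: by end_near. Qed.

(* The Lie bracket of left-invariant vector fields, at the identity. *)
Lemma lie_bracketE (a b : AN R m) : canonical_basis J ->
  'D_a (left_invariant b) 0 - 'D_b (left_invariant a) 0 = an_bracket a b.
Proof.
move=> cJ.
have Dx (x y : AN R m) : 'D_x (left_invariant y) 0 =
  (0, (x.1.1 / 2) *: y.1.2, x.1.1 *: y.2 + 2^-1 *: n_bracket x.1.2 y.1.2).
  apply: derive_eq.
  case: x y => [[r U] X] [[s V] Y] /=.
  have E0 : (fun h : R => h^-1 *: (left_invariant (s, V, Y)
      (h *: (r, U, X) + 0) - left_invariant (s, V, Y) 0)) =1
    (fun h => (0, (h^-1 * (expR (h * (r / 2)) - 1)) *: V,
     (h^-1 * (expR (h * r) - 1)) *: Y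
     + (2^-1 * (h^-1 * h) * expR (h * (r / 2))) *: n_bracket U V)).
    move=> h; rewrite [h *: _ + 0]addr0 !left_invariantE /= !mul0r expR0.
    rewrite n_bracket0l n_bracketZl.
    have hr : h *: r = h * r by [].
    rewrite hr -(mulrA h r).
    congr (_, _, _) => /=.
    - by rewrite subrr scaler0.
    - by rewrite -scalerBl scalerA.
    - by apply/colP => i; rewrite !mxE; ring.
  rewrite (funext E0).
  apply: cvg_triple; first exact: cvg_cst.
  - by apply: cvgZr_tmp; exact: expRM_slope.
  - apply: cvgD; first by apply: cvgZr_tmp; exact: expRM_slope.
    apply: cvgZr_tmp.
    have c1 : (fun h : R => 2^-1 * (h^-1 * h)) @ (0 : R)^' --> (2^-1 : R).
      apply: cvg_near_cst; near=> h.
      by rewrite mulVf ?mulr1//; near: h; exact: nbhs_dnbhs_neq.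
    have c2 : (fun h : R => expR (h * (r / 2))) @ (0 : R)^' --> (1 : R).
      apply: cvg_within_filter.
      have c0 : (fun h : R => expR (h * (r / 2))) @ (0 : R)
          --> expR (0 * (r / 2)).
        have dD := @ex_derive _ _ _ _ _ _ _ (is_derive_expRM (r / 2)).
        exact: (differentiable_continuous (proj1 (derivable1_diffP _ _) dD)).
      by move: c0; rewrite mul0r expR0.
    by have := cvgM c1 c2; rewrite mulr1; apply.
apply: (etrans (congr2 (fun u v : AN R m => u - v) (Dx a b) (Dx b a))).
rewrite /an_bracket.
case: a b => [[r U] X] [[s V] Y] /=.
congr (_, _, _) => /=.
- by rewrite subr0.
- by rewrite ![2^-1 * _]mulrC.
- by rewrite (n_bracketC V U)//; apply/colP => i; rewrite !mxE; field.
Unshelve. all: by end_near.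
Qed.

Definition an_metric (p u v : AN R m) : R :=
  an_inner ('d (an_mul (an_inv p)) p u) ('d (an_mul (an_inv p)) p v).

Definition an_subgroup (H : set (AN R m)) :=
  [/\ H 0, forall p q, H p -> H q -> H (an_mul p q) &
      forall p, H p -> H (an_inv p)].

Definition one_parameter_subgroup (c : R -> AN R m) :=
  smooth_curve c /\ forall s t, c (s + t) = an_mul (c s) (c t).

(* The connected Lie subgroup with Lie algebra [h] is generated by the
   one-parameter subgroups with initial velocity in [h]. *)
Definition connected_subgroup (h : set (AN R m)) : set (AN R m) :=
  smallest an_subgroup [set p | exists (c : R -> AN R m) (t : R),
    [/\ one_parameter_subgroup c, h (derive1 c 0) & p = c t]].

(* S_w, in terms of the orthogonal complement [Wp] of w in v. *)
Definition S_w (Wp : {vspace 'cV[R]_m}) : set (AN R m) :=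
  connected_subgroup [set x | orthogonal_complement Wp x.1.2].

Definition G_group : set (AN R m -> AN R m) :=
  identity_component (isometry an_metric).

Definition K_group : set (AN R m -> AN R m) :=
  [set k | G_group k /\ k 0 = 0].

(* Elements of AN are regarded as elements of [G_group] through [an_mul]; the
   condition k S k^-1 `<=` S is written without inverses. *)
Definition N_K (S : set (AN R m)) : set (AN R m -> AN R m) :=
  [set k | K_group k /\ forall s, S s -> exists s', S s' /\
     k \o an_mul s = an_mul s' \o k].

Definition N_K0 (S : set (AN R m)) : set (AN R m -> AN R m) :=
  identity_component (N_K S).

Definition N_K0_S (S : set (AN R m)) : set (AN R m -> AN R m) :=
  [set k \o an_mul s | k in N_K0 S & s in S].

End DamekRicci.

(* Main.v *)
Require Import Defs.
From HB Require Import structures.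
From mathcomp Require Import all_boot all_order all_algebra.
From mathcomp Require Import all_classical all_reals all_analysis.
From mathcomp Require Import ring lra.
Set Implicit Arguments.
Unset Strict Implicit.
Unset Printing Implicit Defensive.
Import Order.TTheory GRing.Theory Num.Theory numFieldNormedType.Exports.

Local Open Scope classical_set_scope.
Local Open Scope ring_scope.

(** Everything rests on one function and one group. Let [P] be the orthogonal
   projection onto [w_perp]. The function [height], exp(-r) |P U|^2 at the point
   (r, U, X) of AN, is invariant under left translations by [S_w] and vanishes
   on [S_w] only. The group [stabilizer] consists of the elements of Sp(n-1)
   that preserve [w_perp].

   Algebra. The vectors e_0 and g_i = cos phi_i e_0 + sin phi_i e_i are totally
   real, and their inner products are the cosines of the phi_i, arranged so that
   the Gram matrix is diagonalised by the characters of the Klein four-group.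
   The inequality on the cosines says that its eigenvalues are positive. So, on
   the one hand, admissible vectors exist in four quaternionic dimensions
   ([admissible_exists]). On the other hand e_0 and the g_i span four pairwise
   orthogonal quaternionic lines ([uline]), and a unit quaternion q can act
   on each of these lines, its imaginary coordinates multiplied by the signs of
   the characters ([krot]). These maps are in Sp(n-1), and on
   xi_0, xi_1, xi_2, xi_3 they are right multiplications by quaternions
   ([krot_xi]): they preserve [w_perp] and move xi_0 to any point of its unit
   sphere, along paths starting at the identity ([wperp_path]). This proves (b).
   The compressions of J_1, J_2, J_3 to [w_perp] are cos phi_i times left
   multiplications by quaternion units, whence the Kaehler angle
   ([kahler_wperp]).

   Geometry. In the left-invariant frame the Koszul formula becomes explicit
   ([christoffelE]). Along a geodesic with velocity orthogonal to the centre
   the vector exp(-r/2) P U solves f'' = f/4 ([height_geodesic]); therefore the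
   tube of radius r is the level set where [height] equals 4 sinh^2(r/2)
   ([tube_level]), and the parallel hypersurfaces of a tube are tubes
   ([parallel_level]). The shape operator of a tube, read at the identity,
   depends only on the direction of P U, in a way that is equivariant under
   [stabilizer] ([normal_derivative], [rot_shape]). Since this group is
   transitive on directions, an eigenbasis at one direction, provided by the
   spectral theorem ([orthonormal_eigenbasis]), is carried to all others: the
   principal curvatures are constant ([level_principal_curvatures]), and so is
   the mean curvature of each tube. This proves (a).

   Orbits. Left translations by [S_w], and rotations A of U with A on one of the
   paths above, lie in the group of (c), because a path of isometries stays in
   an identity component. They act transitively on each level set of [height]
   and on [S_w] ([orbit_level], [orbit_S]). No larger set is an orbit, because an
   isometry preserving [S_w] cannot increase [height]: along a unit speed curve
   the square root y of [height] satisfies y' <= sqrt (1 + y^2/4), with equality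
   along normal geodesics ([isometry_height_le]). That the group of (c) is
   closed under inverses uses that an element of the normalizer maps [S_w]
   onto itself ([N_K_onto]), and that inverses of isometries are smooth
   ([isometry_group]). *)

(** * Smooth maps of normed spaces *)

Section SmoothAlgebra.
Context {R : realType}.

Definition smooth {E F : normedModType R} (f : E -> F) := smooth_on [set: E] f.

Lemma linear_diff (E F : normedModType R) (L : E -> F) x :
  linear L -> continuous L -> differentiable L x /\ 'd L x = L :> (E -> F).
Proof.
move=> lL cL.
pose LM := GRing.isLinear.Build _ _ _ _ _ lL.
pose L' : {linear _ -> _} := HB.pack L LM.
split; last by rewrite -[L]/(L' : E -> F) diff_lin.
by rewrite -[L]/(L' : E -> F); exact: linear_differentiable.
Qed.

Lemma derive_linear (E F : normedModType R) (L : E -> F) x v :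
  linear L -> continuous L -> 'D_v L x = L v.
Proof. by move=> lL cL; have [d e] := linear_diff x lL cL; rewrite deriveE// e. Qed.

Lemma derive_compose (E F G : normedModType R) (f : E -> F) (g : F -> G) x v :
  differentiable f x -> differentiable g (f x) ->
  'D_v (fun y => g (f y)) x = 'D_('D_v f x) g (f x).
Proof.
move=> df dg; rewrite !deriveE//; last exact: differentiable_comp.
by rewrite (diff_comp df dg).
Qed.

Lemma derive_lincomp (E F G : normedModType R) (L : F -> G) (f : E -> F) x v :
  linear L -> continuous L -> differentiable f x ->
  'D_v (fun y => L (f y)) x = L ('D_v f x).
Proof.
move=> lL cL df; have [dL _] := linear_diff (f x) lL cL.
by rewrite derive_compose// derive_linear.
Qed.

Lemma differentiable_lincomp (E F G : normedModType R) (L : F -> G)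
    (f : E -> F) x :
  linear L -> continuous L -> differentiable f x ->
  differentiable (fun y => L (f y)) x.
Proof.
move=> lL cL df; have [dL _] := linear_diff (f x) lL cL.
exact: differentiable_comp.
Qed.

(** Scaling, under a name that can carry a bilinear structure, so that the
   library differentiates it. *)
Definition scalar_product (F : normedModType R) : R -> F -> F :=
  fun a u => a *: u.

Lemma scalar_product_bilinear (F : normedModType R) :
  bilinear_for
    (GRing.Scale.Law.clone _ _ *:%R _) (GRing.Scale.Law.clone _ _ *:%R _)
    (@scalar_product F).
Proof.
split=> u a b c /=; rewrite /scalar_product; first by rewrite scalerDl scalerA.
by rewrite scalerDr !scalerA [u * a]mulrC.
Qed.

HB.instance Definition _ (F : normedModType R) :=
  bilinear_isBilinear.Build R R F F _ _ (@scalar_product F)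
    (@scalar_product_bilinear F).

Lemma differentiable_scale (E F : normedModType R) (k : E -> R) (f : E -> F) x :
  differentiable k x -> differentiable f x ->
  differentiable (fun y => k y *: f y) x /\
  forall v, 'D_v (fun y => k y *: f y) x = k x *: 'D_v f x + 'D_v k x *: f x.
Proof.
move=> dk df.
have cB : continuous (fun p : R * F => scalar_product p.1 p.2).
  by move=> p; apply: cvgZ; [exact: cvg_fst | exact: cvg_snd].
have dp : differentiable (fun y => (k y, f y)) x by exact: differentiable_pair.
have dB := differentiable_bilin (k x, f x) cB.
have dBf : differentiable (fun y => k y *: f y) x.
  exact: (differentiable_comp dp dB).
split=> // v; rewrite !deriveE//.
rewrite (_ : (fun y => k y *: f y) =
  (fun p => scalar_product p.1 p.2) \o (fun y => (k y, f y)))//.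
by rewrite (diff_comp dp dB) /= diff_bilin// diff_pair.
Qed.

Lemma Ck_derive (E F : normedModType R) k (f : E -> F) :
  Ck k.+1 setT f -> forall v, Ck k setT (fun x => 'D_v f x).
Proof. by case. Qed.

Lemma CkS (E F : normedModType R) k (f : E -> F) :
  Ck k.+1 setT f -> Ck k setT f.
Proof.
elim: k f => [|k IH] f [df Df].
  by move=> x _; apply: differentiable_continuous; exact: df.
by split=> // v; apply: IH; exact: Df.
Qed.

Lemma Ck_ext (E F : normedModType R) k (f g : E -> F) :
  f =1 g -> Ck k setT g -> Ck k setT f.
Proof. by move=> /funext ->. Qed.

Lemma Ck_cst (E F : normedModType R) k (a : F) :
  Ck k setT (fun _ : E => a).
Proof.
elim: k a => [|k IH] a /=; first by move=> x _; exact: cst_continuous.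
split=> [x _|v]; first exact: differentiable_cst.
by apply: (Ck_ext _ (IH 0)) => x; exact: derive_cst.
Qed.

(** Preservation of [Ck], here and below, is by induction on [k]: the
   differentiation rule expresses the derivative of the result through maps to
   which the induction hypothesis applies. *)
Lemma Ck_lincomp (E F G : normedModType R) k (L : F -> G) (f : E -> F) :
  linear L -> continuous L -> Ck k setT f -> Ck k setT (fun x => L (f x)).
Proof.
move=> lL cL; elim: k f => [|k IH] f.
  by move=> cf x _; apply: continuous_comp; [exact: cf | move=> ?; exact: cL].
move=> [df Df]; split=> [x _|v].
  by apply: differentiable_lincomp => //; exact: (df _ I).
apply: (@Ck_ext _ _ _ _ (fun x => L ('D_v f x))); last by apply: IH; exact: Df.
by move=> x; rewrite (derive_lincomp _ lL cL (df x I)).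
Qed.

Lemma Ck_id (E : normedModType R) k : Ck k setT (fun x : E => x).
Proof.
case: k => [|k]; first by move=> x _; exact: cvg_id.
split=> [x _|v]; first by apply: (linear_diff x (L := id) _ _).1 => // y; exact: cvg_id.
apply: (@Ck_ext _ _ _ _ (fun _ => v)); last exact: Ck_cst.
by move=> x; exact: derive_id.
Qed.

Lemma Ck_lin (E F : normedModType R) k (L : E -> F) :
  linear L -> continuous L -> Ck k setT L.
Proof. by move=> lL cL; apply: (Ck_lincomp lL cL (@Ck_id _ k)). Qed.

Lemma Ck_add (E F : normedModType R) k (f g : E -> F) :
  Ck k setT f -> Ck k setT g -> Ck k setT (fun x => f x + g x).
Proof.
elim: k f g => [|k IH] f g.
  by move=> cf cg x _; apply: cvgD; [exact: cf | exact: cg].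
move=> [df Df] [dg Dg]; split=> [x _|v].
  by apply: differentiableD; [exact: (df _ I)|exact: (dg _ I)].
apply: (@Ck_ext _ _ _ _ (fun x => 'D_v f x + 'D_v g x)); last by apply: IH; [exact: Df|exact: Dg].
by move=> x; rewrite deriveD//; apply: diff_derivable; [exact: (df _ I)|exact: (dg _ I)].
Qed.

Lemma Ck_sum (E F : normedModType R) k (I : Type) (s : seq I) (f : I -> E -> F) :
  (forall i, Ck k setT (f i)) -> Ck k setT (fun x => \sum_(i <- s) f i x).
Proof.
move=> cf; elim: s => [|i s IH].
  apply: (@Ck_ext _ _ _ _ (fun _ => 0)); last exact: Ck_cst.
  by move=> x; rewrite big_nil.
apply: (@Ck_ext _ _ _ _ (fun x => f i x + \sum_(i <- s) f i x)).
  by move=> x; rewrite big_cons.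
exact: Ck_add.
Qed.

Lemma Ck_scale (E F : normedModType R) k (a : E -> R) (f : E -> F) :
  Ck k setT a -> Ck k setT f -> Ck k setT (fun x => a x *: f x).
Proof.
elim: k a f => [|k IH] a f.
  by move=> cf cg x _; apply: cvgZ; [exact: cf | exact: cg].
move=> ca cf; split=> [x _|v].
  by apply: ((differentiable_scale _ _).1); [exact: ca.1|exact: cf.1].
apply: (@Ck_ext _ _ _ _ (fun x => a x *: 'D_v f x + 'D_v a x *: f x)).
  move=> x.
by rewrite ((differentiable_scale (ca.1 x I) (cf.1 x I)).2).
apply: Ck_add; apply: IH; try exact: CkS; exact: Ck_derive.
Qed.

Lemma Ck_mul (E : normedModType R) k (a b : E -> R) :
  Ck k setT a -> Ck k setT b -> Ck k setT (fun x => a x * b x).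
Proof. by move=> ca cb; exact: (Ck_scale ca cb). Qed.

Lemma Ck_pair (E F G : normedModType R) k (f : E -> F) (g : E -> G) :
  Ck k setT f -> Ck k setT g -> Ck k setT (fun x => (f x, g x)).
Proof.
elim: k f g => [|k IH] f g.
  by move=> cf cg x _; apply: cvg_pair; [exact: cf | exact: cg].
move=> [df Df] [dg Dg]; split=> [x _|v].
  by apply: differentiable_pair; [exact: (df _ I)|exact: (dg _ I)].
apply: (@Ck_ext _ _ _ _ (fun x => ('D_v f x, 'D_v g x))); last by apply: IH; [exact: Df|exact: Dg].
move=> x; have [dfx dgx] := (df x I, dg x I).
by rewrite !deriveE ?diff_pair//; exact: differentiable_pair.
Qed.

Lemma derive_scalar_comp (E : normedModType R) (h : R -> R) (dh : R) (f : E -> R) x v :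
  is_derive (f x) 1 h dh -> differentiable f x ->
  differentiable (fun y => h (f y)) x /\
  'D_v (fun y => h (f y)) x = dh * 'D_v f x.
Proof.
move=> Dh df; have dh1 : differentiable h (f x).
  by apply/derivable1_diffP; exact: (@ex_derive _ _ _ _ _ _ _ Dh).
split; first exact: differentiable_comp.
rewrite derive_compose// deriveE// -[in LHS](mulr1 ('D_v f x)).
have -> : 'D_v f x * 1 = 'D_v f x *: (1 : R) by [].
rewrite linearZ /= -deriveE// (@derive_val _ _ _ _ _ _ _ Dh).
by rewrite [LHS]mulrC.
Qed.

Lemma Ck_exp (E : normedModType R) k (f : E -> R) :
  Ck k setT f -> Ck k setT (fun x => expR (f x)).
Proof.
elim: k f => [|k IH] f.
  by move=> cf x _; apply: continuous_comp; [exact: cf|exact: continuous_expR].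
move=> cf; have D x v := derive_scalar_comp v (is_derive_expR (f x)) (cf.1 x I).
split=> [x _|v]; first exact: (D x 0).1.
apply: (@Ck_ext _ _ _ _ (fun x => expR (f x) * 'D_v f x)).
  by move=> x; exact: (D x v).2.
by apply: Ck_mul; [apply: IH; exact: CkS | exact: Ck_derive].
Qed.

Lemma is_derive_inv (y : R) : y != 0 -> is_derive y 1 (fun z => z^-1) (- y ^- 2).
Proof.
move=> y0; apply: DeriveDef; first exact: (derivableV (f := id) y0).
by rewrite (deriveV (f := id) y0)// derive_id /GRing.scale /= mulr1.
Qed.

Lemma Ck_inv (E : normedModType R) k (f : E -> R) : (forall x, f x != 0) ->
  Ck k setT f -> Ck k setT (fun x => (f x)^-1).
Proof.
move=> f0; elim: k => [|k IH].
  by move=> cf x _; apply: cvgV => //; exact: cf.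
move=> cf; have D x v := derive_scalar_comp v (is_derive_inv (f0 x)) (cf.1 x I).
split=> [x _|v]; first exact: (D x 0).1.
apply: (@Ck_ext _ _ _ _ (fun x => (-1) *: (((f x)^-1 * (f x)^-1) * 'D_v f x))).
  move=> x; rewrite (D x v).2 [_ *: _]mulN1r mulNr.
  by rewrite expr2 invfM.
apply: Ck_scale; first exact: Ck_cst.
apply: Ck_mul; last exact: Ck_derive.
by apply: Ck_mul; apply: IH; exact: CkS.
Qed.

Lemma Ck_ln (E : normedModType R) k (f : E -> R) : (forall x, 0 < f x) ->
  Ck k setT f -> Ck k setT (fun x => ln (f x)).
Proof.
move=> f0; case: k => [|k] cf.
  by move=> x _; apply: continuous_comp; [exact: cf|exact: continuous_ln (f0 x)].
have D x v := derive_scalar_comp v (is_derive1_ln (f0 x)) (cf.1 x I).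
split=> [x _|v]; first exact: (D x 0).1.
apply: (@Ck_ext _ _ _ _ (fun x => (f x)^-1 * 'D_v f x)).
  by move=> x; rewrite (D x v).2.
apply: Ck_mul; last exact: Ck_derive.
by apply: Ck_inv; [move=> x; rewrite gt_eqF | exact: CkS].
Qed.

End SmoothAlgebra.

(** * Finite-dimensional spaces *)

Section Frames.
Context {R : realType}.

(** A basis with continuous coordinate functions: the finite-dimensionality
   that normed spaces, products and column vectors share. *)
Definition framed (E : normedModType R) :=
  exists (n : nat) (b : 'I_n -> E) (l : 'I_n -> E -> R),
    [/\ forall i, linear (l i), forall i, continuous (l i),
        forall i j, l i (b j) = (i == j)%:R &
        forall x, x = \sum_i l i x *: b i].

Lemma framed_R : framed R.
Proof.
exists 1%N, (fun _ => 1), (fun _ => id); split => //.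
- by move=> i x; exact: cvg_id.
- by move=> i j; rewrite !ord1.
- by move=> x; rewrite big_ord1 [RHS]mulr1.
Qed.

Lemma framed_cV m : framed 'cV[R]_m.
Proof.
exists m, (fun i => delta_mx i 0), (fun i (v : 'cV[R]_m) => v i 0); split => //.
- by move=> i a x y; rewrite !mxE.
- by move=> i x; exact: coord_continuous.
- by move=> i j; rewrite mxE eqxx andbT.
- by move=> x; rewrite {1}(matrix_sum_delta x); apply: eq_bigr => i _; rewrite big_ord1.
Qed.

Lemma framed_pair (E F : normedModType R) :
  framed E -> framed F -> framed (E * F)%type.
Proof.
move=> [n [b [l [ll cl dl el]]]] [m [b' [l' [ll' cl' dl' el']]]].
exists (n + m)%N,
  (fun i => match fintype.split i with inl j => (b j, 0) | inr k => (0, b' k) end),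
  (fun i x => match fintype.split i with inl j => l j x.1 | inr k => l' k x.2 end).
have l0 (G : normedModType R) (g : G -> R) : linear g -> g 0 = 0.
  by move=> lg; have := lg (-1) 0 0; rewrite scaler0 addr0 scaleN1r addNr.
split.
- by move=> i; case: (fintype.split i) => j a x y /=; [rewrite ll | rewrite ll'].
- move=> i; case: (fintype.split i) => j x; apply: continuous_comp => //=.
  + exact: cvg_fst.
  + exact: cl.
  + exact: cvg_snd.
  + exact: cl'.
- move=> i j; rewrite -(splitK i) -(splitK j) !unsplitK.
  case: (fintype.split i) => i'; case: (fintype.split j) => j' /=.
  + by rewrite dl (inj_eq (@lshift_inj _ _)).
  + by rewrite l0// eq_lrshift.
  + by rewrite l0// eq_rlshift.
  + by rewrite dl' (inj_eq (@rshift_inj _ _)).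
- move=> [x y]; rewrite big_split_ord /=.
  under eq_bigr => i _ do rewrite (unsplitK (inl i)).
  under [X in _ = _ + X]eq_bigr => i _ do rewrite (unsplitK (inr i)).
  rewrite {1}(el x) {1}(el' y).
  have sp (I : finType) (f : I -> E * F) : \sum_i f i = (\sum_i (f i).1, \sum_i (f i).2).
    by elim: (index_enum I) => [|i s IH]; rewrite ?big_nil// !big_cons IH.
  rewrite !sp; congr (_, _) => /=.
  + by rewrite [X in _ = _ + X]big1 ?addr0// => i _; rewrite scaler0.
  + by rewrite [X in _ = X + _]big1 ?add0r// => i _; rewrite scaler0.
Qed.

Lemma linear_sumE (E F : lmodType R) (L : E -> F) (I : Type) (s : seq I)
    (a : I -> R) (x : I -> E) :
  linear L -> L (\sum_(i <- s) a i *: x i) = \sum_(i <- s) a i *: L (x i).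
Proof.
move=> lL; have L0 : L 0 = 0.
  by have := lL (-1) 0 0; rewrite scaler0 addr0 scaleN1r addNr.
elim: s => [|i s IH]; first by rewrite !big_nil.
by rewrite !big_cons lL IH.
Qed.

Lemma framed_linear_continuous (E F : normedModType R) (L : E -> F) :
  framed E -> linear L -> continuous L.
Proof.
move=> [n [b [l [ll cl _ el]]]] lL.
rewrite (_ : L = (fun x => \sum_i l i x *: L (b i))); last first.
  by apply/funext => x; rewrite {1}(el x) linear_sumE.
have c : Ck 0 setT (fun x : E => \sum_i l i x *: L (b i)).
  apply: Ck_sum => i y _; apply: cvgZ; [exact: cl | exact: cvg_cst].
by move=> x; exact: c.
Qed.

Lemma Ck_linear (E F G : normedModType R) k (L : F -> G) (f : E -> F) :
  framed F -> linear L -> Ck k setT f -> Ck k setT (fun x => L (f x)).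
Proof. by move=> fF lL; apply: Ck_lincomp => //; exact: framed_linear_continuous. Qed.

Lemma derive_linear_framed (E F G : normedModType R) (L : F -> G) (f : E -> F) x v :
  framed F -> linear L -> differentiable f x ->
  'D_v (fun y => L (f y)) x = L ('D_v f x).
Proof. by move=> fF lL; apply: derive_lincomp => //; exact: framed_linear_continuous. Qed.

(** The derivative of a composite involves [D_w g] in the varying direction
   [w = D_v f]; in a basis it is a finite sum of products of maps of lower
   class. *)
Lemma Ck_comp (E F G : normedModType R) k (f : E -> F) (g : F -> G) :
  framed F -> Ck k setT f -> smooth g -> Ck k setT (fun x => g (f x)).
Proof.
move=> [n [b [l [ll cl dl el]]]]; elim: k g => [|k IH] g cf sg.
  by move=> x _; apply: continuous_comp; [exact: cf|exact: (sg 0)].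
have dg y : differentiable g y by exact: ((sg 1%N).1 y I).
split=> [x _|v]; first by apply: differentiable_comp; [exact: (cf.1 x I)|].
apply: (@Ck_ext _ _ _ _ _ (fun x => \sum_i l i ('D_v f x) *: 'D_(b i) g (f x))).
  move=> x; rewrite (derive_compose v (cf.1 x I) (dg (f x))).
  rewrite deriveE// [in LHS](el ('D_v f x)) linear_sum.
  by apply: eq_bigr => i _; rewrite linearZ (deriveE _ (dg (f x))).
apply: Ck_sum => i; apply: Ck_scale.
  by apply: Ck_lincomp => //; exact: Ck_derive.
apply: (IH (fun y => 'D_(b i) g y)); first exact: CkS.
by move=> j; exact: (Ck_derive (sg j.+1)).
Qed.

Lemma smooth_comp (E F G : normedModType R) (f : E -> F) (g : F -> G) :
  framed F -> smooth f -> smooth g -> smooth (fun x => g (f x)).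
Proof. by move=> fF sf sg k; exact: Ck_comp. Qed.

Lemma bilinear_frameE (E F G : normedModType R) (B : E -> F -> G)
    n (b : 'I_n -> E) (l : 'I_n -> E -> R) x y :
  (forall y, linear (B^~ y)) -> x = \sum_i l i x *: b i ->
  B x y = \sum_i l i x *: B (b i) y.
Proof. by move=> lB xE; rewrite {1}xE (linear_sumE _ _ _ (lB y)). Qed.

Lemma Ck_bilinear (D E F G : normedModType R) k (B : E -> F -> G)
    (f : D -> E) (g : D -> F) :
  framed E -> framed F ->
  (forall y, linear (B^~ y)) -> (forall x, linear (B x)) ->
  Ck k setT f -> Ck k setT g -> Ck k setT (fun x => B (f x) (g x)).
Proof.
move=> [n [b [l [ll cl dl el]]]] fF lB rB cf cg.
apply: (@Ck_ext _ _ _ _ _ (fun x => \sum_i l i (f x) *: B (b i) (g x))).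
  by move=> x; exact: bilinear_frameE.
apply: Ck_sum => i; apply: Ck_scale; first exact: Ck_lincomp.
by apply: Ck_linear.
Qed.

Lemma derive_bilinear (D E F G : normedModType R) (B : E -> F -> G)
    (f : D -> E) (g : D -> F) x v :
  framed E -> framed F ->
  (forall y, linear (B^~ y)) -> (forall x, linear (B x)) ->
  differentiable f x -> differentiable g x ->
  differentiable (fun x => B (f x) (g x)) x /\
  'D_v (fun x => B (f x) (g x)) x = B ('D_v f x) (g x) + B (f x) ('D_v g x).
Proof.
move=> [n [b [l [ll cl dl el]]]] fF lB rB df dg.
have dt i : differentiable (fun y => l i (f y)) x by exact: differentiable_lincomp.
have dB i : differentiable (fun y => B (b i) (g y)) x.
  by apply: differentiable_lincomp => //; exact: framed_linear_continuous.
have ds i := differentiable_scale (dt i) (dB i).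
have -> : (fun x => B (f x) (g x)) =
    \sum_i (fun x => l i (f x) *: B (b i) (g x)).
  by apply/funext => y; rewrite fct_sumE; exact: bilinear_frameE.
split; first by apply: differentiable_sum => i; exact: (ds i).1.
rewrite derive_sum; last by move=> i; apply: diff_derivable; exact: (ds i).1.
under eq_bigr => i _ do rewrite (ds i).2 (derive_linear_framed _ fF (rB (b i)) dg)
  (derive_lincomp _ (ll i) (cl i) df).
rewrite big_split /= addrC; congr (_ + _).
  by rewrite (bilinear_frameE (g x) lB (el ('D_v f x))).
by rewrite (bilinear_frameE ('D_v g x) lB (el (f x))).
Qed.

End Frames.

(** * Inverses of smooth bijections *)

Section InverseFunction.
Context {R : realType}.

Lemma linear_at0 (E F : normedModType R) (L : E -> F) : linear L -> L 0 = 0.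
Proof. by move=> lL; have := lL (-1) 0 0; rewrite scaler0 addr0 scaleN1r addNr. Qed.

Lemma near_shift0 (E : normedModType R) (x : E) (P : E -> Prop) :
  (\forall y \near x, P y) <-> (\forall h \near (0 : E), P (h + x)).
Proof.
have c (a b : E) : (fun h : E => h + b) @ a --> a + b.
  by apply: cvgD; [exact: cvg_id | exact: cvg_cst].
split=> H.
  by have := c 0 x; rewrite add0r => /(_ _ H).
have := c x (- x); rewrite subrr => /(_ _ H); rewrite /nbhs /=.
by apply: filterS => y /=; rewrite subrK.
Qed.

Lemma differentiable_approx (E F : normedModType R) (f : E -> F) (x : E) :
  differentiable f x -> forall e : R, 0 < e ->
  \forall y \near x, `|f y - f x - 'd f x (y - x)| <= e * `|y - x|.
Proof.
move=> df e e0; apply/near_shift0.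
have /eqaddoP/(_ _ e0) := diff_locally df.
apply: filterS => h; rewrite addrK.
by rewrite -[(_ - _) h]/(f (h + x) - (f x + 'd f x h)) opprD addrA.
Qed.

Lemma approx_differentiable (E F : normedModType R) (f L : E -> F) (x : E) :
  linear L -> continuous L ->
  (forall e : R, 0 < e ->
    \forall y \near x, `|f y - f x - L (y - x)| <= e * `|y - x|) ->
  differentiable f x /\ 'd f x = L :> (E -> F).
Proof.
move=> lL cL H.
pose LM := GRing.isLinear.Build _ _ _ _ _ lL.
pose L' : {linear _ -> _} := HB.pack L LM.
have E0 : f \o shift x = cst (f x) + (L' : E -> F) +o_ 0 id.
  apply/eqaddoP => e e0; have /near_shift0 := H e e0.
  apply: filterS => h; rewrite addrK.
  by rewrite -[(_ - _) h]/(f (h + x) - (f x + L h)) opprD addrA.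
have dE : 'd f x = L' :> (E -> F) by exact: diff_unique.
by split; [apply/diff_locallyP; rewrite dE; split | rewrite dE].
Qed.

(** In a basis, an injective endomorphism is an invertible matrix. *)
Lemma framed_surjective (E : normedModType R) (T : E -> E) :
  framed E -> linear T -> (forall x, T x = 0 -> x = 0) ->
  exists A : E -> E, [/\ linear A, continuous A & forall v, T (A v) = v].
Proof.
move=> fE lT iT; have [n [b [l [ll cl dl el]]]] := fE.
pose M := \matrix_(i < n, j < n) l i (T (b j)).
pose vec x : 'cV[R]_n := \col_i l i x.
pose unvec (c : 'cV[R]_n) := \sum_i c i 0 *: b i.
have vecK x : unvec (vec x) = x.
  by rewrite [RHS]el; apply: eq_bigr => i _; rewrite mxE.
have lE i c : l i (unvec c) = c i 0.
  rewrite /unvec (linear_sumE _ _ _ (ll i)) (bigD1 i)//= dl eqxx [_ *: _]mulr1.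
  rewrite big1 ?addr0// => j ji; rewrite dl eq_sym (negbTE ji).
  by rewrite [_ *: _]mulr0.
have unvecK c : vec (unvec c) = c by apply/colP => i; rewrite mxE lE.
have MT c : vec (T (unvec c)) = M *m c.
  apply/colP => i; rewrite !mxE /unvec (linear_sumE _ _ _ lT).
  rewrite (linear_sumE _ _ _ (ll i)); apply: eq_bigr => j _.
  by rewrite mxE mulrC.
have Mu : M \in unitmx.
  rewrite -unitmx_tr -row_free_unit -kermx_eq0; apply/eqP/row_matrixP => i.
  rewrite row0; apply: trmx_inj; rewrite trmx0.
  set c := (row i _)^T; have : M *m c = 0.
    by rewrite /c -[M]trmxK -trmx_mul -row_mul trmxK mulmx_ker row0 trmx0.
  rewrite -MT => Tc; rewrite -(unvecK c) (iT (unvec c)); last first.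
    by rewrite -[LHS]vecK Tc /unvec big1// => j _; rewrite mxE scale0r.
  by apply/colP => j; rewrite !mxE (linear_at0 (ll j)).
have lin_un : linear unvec.
  move=> a x y; rewrite /unvec scaler_sumr -big_split; apply: eq_bigr => i _.
  by rewrite !mxE scalerDl scalerA.
have lin_vec : linear vec by move=> a x y; apply/colP => i; rewrite !mxE ll.
have lA : linear (fun v => unvec (invmx M *m vec v)).
  by move=> a x y; rewrite lin_vec mulmxDr -scalemxAr lin_un.
exists (fun v => unvec (invmx M *m vec v)); split => //.
  exact: framed_linear_continuous.
by move=> v; rewrite -[LHS]vecK MT mulmxA mulmxV// mul1mx vecK.
Qed.

(** A bijection with invertible differentials is open: minimise the distance
   of the images to a target point over a compact ball around the source; a
   critical point of that distance is a preimage of the target. *)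
Lemma inverse_continuous (E : normedModType R) (f h : E -> E) :
  framed E -> cancel f h -> cancel h f ->
  (forall x, differentiable f x) ->
  (forall x v, exists u, 'd f x u = v) -> continuous h.
Proof.
move=> fE fK hK df sf; have [n [b [l [ll cl dl el]]]] := fE.
have cf : continuous f by move=> x; exact: differentiable_continuous.
(* the Euclidean inner product of the frame, whose square norm is smooth *)
pose Q z w := \sum_i l i z *: l i w.
have lQ w : linear (Q^~ w).
  move=> a x y; rewrite /Q scaler_sumr -big_split; apply: eq_bigr => i _.
  by rewrite ll scalerDl scalerA.
have rQ z : linear (Q z).
  move=> a x y; rewrite /Q scaler_sumr -big_split; apply: eq_bigr => i _.
  by rewrite ll scalerDr !scalerA mulrC.
pose N z := Q z z.
have N_ge0 z : 0 <= N z by apply: sumr_ge0 => i _; exact: sqr_ge0.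
have Nl z i : l i z ^+ 2 <= N z.
  by rewrite /N /Q (bigD1 i)//= lerDl; apply: sumr_ge0 => j _; exact: sqr_ge0.
have N0 z : N z = 0 -> z = 0.
  move=> Nz; rewrite (el z) big1// => i _.
  have := Nl z i; rewrite Nz => /(le_trans (sqr_ge0 _)) _.
  have : l i z ^+ 2 = 0 by apply/eqP; rewrite eq_le sqr_ge0 -Nz Nl.
  by move/eqP; rewrite sqrf_eq0 => /eqP ->; rewrite scale0r.
have cN : continuous N.
  move=> z; apply: (@Ck_bilinear R E E E R 0 Q id id fE fE lQ rQ _ _ z I);
  move=> y _; exact: cvg_id.
have N2 y z : N (y + z) <= 2 * N y + 2 * N z.
  rewrite /N /Q !mulr_sumr -big_split; apply: ler_sum => i _.
  have := ll i 1 y z; rewrite !scale1r => ->.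
  have := sqr_ge0 (l i y - l i z); rewrite /GRing.scale /=; nra.
have Nopp z : N (- z) = N z.
  apply: eq_bigr => i _; have := ll i (-1) z 0; rewrite !scaleN1r !addr0.
  by rewrite (linear_at0 (ll i)) addr0 => ->; rewrite /GRing.scale /= mulrNN.
move=> y0; set x0 := h y0; have fx0 : f x0 = y0 by exact: hK.
move=> U Ux0; rewrite /nbhs /=.
pose B (d : R) := [set x | N (x - x0) <= d].
have cNx (g : E -> E) : continuous g -> forall a, continuous (fun x => N (g x - a)).
  move=> cg a x; apply: (@continuous_comp _ _ _ (fun x => g x - a) N); last exact: cN.
  by apply: cvgB; [exact: cg | exact: cvg_cst].
have cid : continuous (id : E -> E) by move=> x; exact: cvg_id.
have Bcompact (d : R) : 0 <= d -> compact (B d).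
  move=> d0; pose Phi (c : 'rV[R]_n) := x0 + \sum_i c 0 i *: b i.
  have cbox : compact [set v : 'rV[R]_n | forall i, `[- (1 + d), 1 + d]%classic (v ord0 i)].
    apply: (@rV_compact R n (fun=> `[- (1 + d), 1 + d]%classic)) => i.
    exact: segment_compact.
  have cPhi : continuous Phi.
    suff c0 : Ck 0 setT Phi by move=> c; exact: c0.
    apply: Ck_add; first exact: Ck_cst.
    apply: Ck_sum => i; apply: Ck_scale; last exact: Ck_cst.
    by move=> c _; exact: coord_continuous.
  apply: (@subclosed_compact _ _ (Phi @` [set v : 'rV[R]_n | forall i, `[- (1 + d), 1 + d]%classic (v ord0 i)])).
  - have := cNx id cid x0 => /continuous_closedP/(_ [set t | t <= d]).
    by apply; exact: closed_le.
  - by apply: continuous_compact => //; exact: continuous_subspaceT.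
  - move=> x Bx; exists (\row_i l i (x - x0)); last first.
      rewrite /Phi -[RHS](subrK x0) addrC; congr (_ + _); rewrite [RHS]el.
      by apply: eq_bigr => i _; rewrite mxE.
    move=> i /=; rewrite mxE in_itv /= -ler_norml -(@ler_pXn2r _ 2) ?nnegrE//; last lra.
    rewrite real_normK ?num_real// (le_trans (Nl _ i))// (le_trans Bx)//.
    by nra.
have [d d0 Bd] : exists2 d : R, 0 < d & B d `<=` U.
  have [e /= e0 eU] := (nbhs_normP _ _).1 Ux0.
  pose C := \sum_i `|b i|; have C0 : 0 <= C by exact: sumr_ge0.
  exists ((e / (1 + C)) ^+ 2); first by rewrite exprn_gt0// divr_gt0//; lra.
  have t0 : 0 < e / (1 + C) by rewrite divr_gt0//; lra.
  move=> x Bx; apply: eU; rewrite /= -normrN opprB [x - _]el.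
  apply: (le_lt_trans (ler_norm_sum _ _ _)).
  apply: (@le_lt_trans _ _ (\sum_i (e / (1 + C)) * `|b i|)).
    apply: ler_sum => i _; rewrite normrZ ler_wpM2r//.
    rewrite -(@ler_pXn2r _ 2) ?nnegrE//; last exact: ltW.
    by rewrite real_normK ?num_real// (le_trans (Nl _ i)).
  rewrite -mulr_sumr -/C -mulrA [_^-1 * _]mulrC mulrA ltr_pdivrMr; last lra.
  by nra.
(* [m] bounds from below the distance of [y0] to the image of the sphere; a
   target at square distance less than m/4 is closer to [y0] than to that
   image, so the minimum is attained inside the ball *)
pose Sd := [set x | N (x - x0) = d].
have [m m0 Sm] : exists2 m : R, 0 < m & forall x, Sd x -> m <= N (f x - y0).
  have [[z Sz]|S0] := pselect (exists z, Sd z); last first.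
    by exists 1 => // x Sx; exfalso; apply: S0; exists x.
  have cS : compact Sd.
    apply: (@subclosed_compact _ _ (B d)); last by move=> x; rewrite /Sd /B /= => ->.
      have := cNx id cid x0 => /continuous_closedP/(_ [set t | t = d]).
      by apply; exact: closed_eq.
    by apply: Bcompact; exact: ltW.
  have Sn0 : Sd !=set0 by exists z.
  have cw : {within Sd, continuous (fun x => N (f x - y0))}.
    by apply: continuous_subspaceT => x; exact: cNx.
  have [c /set_mem cin cmin] := compact_EVT_min Sn0 cS cw.
  exists (N (f c - y0)); last by move=> x Sx; apply: cmin; exact: mem_set.
  rewrite lt_neqAle N_ge0 andbT eq_sym; apply/eqP => /N0/eqP.
  rewrite subr_eq0 -fx0 => /eqP/(congr1 h); rewrite !fK => cx0.
  move: cin; rewrite /Sd /= cx0 subrr => N00.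
  have := Nopp 0; move: d0; rewrite -N00 /N /Q big1 ?ltxx// => i _.
  by rewrite (linear_at0 (ll i)) scale0r.
have near_y : \forall y \near y0, N (y - y0) < m / 4.
  have : N (y - y0) @[y --> y0] --> N (y0 - y0) by exact: cNx.
  have -> : N (y0 - y0) = 0.
    rewrite subrr /N /Q big1// => i _.
    by rewrite (linear_at0 (ll i)) scale0r.
  by move/cvgr_lt; apply; lra.
apply: filterS near_y => y Ny.
have cw : {within B d, continuous (fun x => N (f x - y))}.
  by apply: continuous_subspaceT => x; exact: cNx.
have Bx0 : B d x0.
  rewrite /B /= subrr /N /Q big1 ?ltW// => i _.
  by rewrite (linear_at0 (ll i)) scale0r.
have [c /set_mem cin cmin] :=
  compact_EVT_min (ex_intro _ x0 Bx0) (Bcompact _ (ltW d0)) cw.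
have Nc : N (f c - y) < m / 4.
  apply: le_lt_trans (cmin _ (mem_set Bx0)) _.
  by rewrite fx0 -Nopp opprB.
have cint : N (c - x0) < d.
  rewrite lt_neqAle; apply/andP; split=> //; apply/eqP => /Sm.
  have := N2 (f c - y) (y - y0); rewrite addrA subrK; lra.
suff fcy : f c = y by rewrite /= -fcy fK; exact: Bd.
(* differentiate the distance in the direction sent to [f c - y] *)
have [v dv] := sf c (f c - y).
pose Psi x := N (f x - y).
have dfy : differentiable (fun x => f x - y) c.
  by apply: differentiableB => //; exact: differentiable_cst.
have dPsi x : differentiable Psi x.
  have dx : differentiable (fun x => f x - y) x.
    by apply: differentiableB => //; exact: differentiable_cst.
  by have [] := derive_bilinear 0 fE fE lQ rQ dx dx.
have DPsi : 'D_v Psi c = 2 * N (f c - y).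
  have [_ ->] := derive_bilinear v fE fE lQ rQ dfy dfy.
  rewrite deriveB; last 2 first.
  - by apply: diff_derivable; exact: df.
  - exact: derivable_cst.
  by rewrite derive_cst subr0 deriveE// dv -mulr2n mulr_natl.
pose line (t : R) := c + t *: v.
have dline t : differentiable line t /\ 'D_1 line t = v.
  have dt : differentiable (fun t : R => t *: v) t.
    by apply: differentiableZl; apply: (@ex_diff _ _ _ _ _ _ _ (is_diff_id t)).
  have dl' : differentiable line t by apply: differentiableD => //; exact: differentiable_cst.
  split=> //; rewrite deriveD; last 2 first.
  - exact: derivable_cst.
  - exact: diff_derivable.
  rewrite derive_cst add0r.
  have [_ ->] := differentiable_scale (@ex_diff _ _ _ _ _ _ _ (is_diff_id t)) (@differentiable_cst R R E v t).
  by rewrite derive_cst derive_id scaler0 add0r scale1r.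
pose phi t := Psi (line t).
have dphi t : derivable phi t 1.
  apply: diff_derivable; apply: differentiable_comp; first exact: (dline t).1.
  exact: dPsi.
have phi0 : 'D_1 phi 0 = 2 * N (f c - y).
  rewrite (derive_compose _ (dline 0).1 (dPsi _)) (dline 0).2.
  by rewrite /line scale0r addr0.
have near_t : \forall t \near (0 : R), N (line t - x0) < d.
  have : N (line t - x0) @[t --> (0 : R)] --> N (line 0 - x0).
    apply: (@continuous_comp _ _ _ line (fun x => N (x - x0))).
      by apply: differentiable_continuous; exact: (dline 0).1.
    exact: (cNx id).
  by move/cvgr_lt; apply; rewrite /line scale0r addr0.
have [e /= e0 He] := (nbhs_normP _ _).1 near_t.
have : is_derive (0 : R) 1 phi 0.
  apply: (@derive1_at_min _ phi (- e) e).
  - by lra.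
  - by move=> t _; exact: dphi.
  - by rewrite in_itv /=; apply/andP; split; lra.
  - move=> t; rewrite in_itv /= => te.
    have -> : phi 0 = N (f c - y) by rewrite /phi /Psi /line scale0r addr0.
    apply: cmin; apply: mem_set; apply: ltW; apply: He => /=.
    by rewrite sub0r normrN ltr_norml.
move=> /(@derive_val _ _ _ _ _ _ _); rewrite phi0 => /eqP.
by rewrite mulf_eq0 pnatr_eq0 /= => /eqP/N0/eqP; rewrite subr_eq0 => /eqP.
Qed.

End InverseFunction.

Section SmoothInverse.
Context {R : realType}.

Lemma linear_bound (E F : normedModType R) (L : E -> F) :
  linear L -> continuous L -> exists2 C : R, 0 < C & forall x, `|L x| <= C * `|x|.
Proof.
move=> lL cL.
pose LM := GRing.isLinear.Build _ _ _ _ _ lL.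
pose L' : {linear _ -> _} := HB.pack L LM.
have [C C0 HC] := @linear_lipschitz R E F L' cL.
by exists C => // x; exact: HC.
Qed.

(** Put w = h y - x0 and z = y - y0, so that z = df w + r with r = o(w) and
   w = A z - A r for the inverse A of df. By continuity of [h] the error r is
   small against w, hence |w| <= 2 C |z|, and A r is small against z. *)
Lemma inverse_differentiable (E : normedModType R) (f h : E -> E) :
  framed E -> cancel f h -> cancel h f ->
  (forall x, differentiable f x) ->
  (forall x u, 'd f x u = 0 -> u = 0) ->
  forall y, differentiable h y /\ forall u, 'd h y ('d f (h y) u) = u.
Proof.
move=> fE fK hK df inj.
have lT x : linear ('d f x) by move=> a u v; rewrite linearP.
have ch : continuous h.
  apply: (@inverse_continuous R E f) => // x v.
  have [A [_ _ AT]] := framed_surjective fE (lT x) (inj x).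
  by exists (A v).
move=> y0; set x0 := h y0; have fx0 : f x0 = y0 by exact: hK.
have [A [lA cA TA]] := framed_surjective fE (lT x0) (inj x0).
have AT u : A ('d f x0 u) = u.
  by apply/eqP; rewrite -subr_eq0; apply/eqP/(inj x0); rewrite linearB TA subrr.
have [C C0 HC] := linear_bound lA cA.
have AB u v : A (u - v) = A u - A v.
  by rewrite addrC -scaleN1r lA scaleN1r addrC.
have [dh hE] : differentiable h y0 /\ 'd h y0 = A :> (E -> E).
  apply: approx_differentiable => // e e0.
  (* the first bound makes [A r] at most half of [w], the second at most [e z] *)
  pose e' := Num.min (2 * C)^-1 (e / (2 * C * C)).
  have e'0 : 0 < e'.
    by rewrite lt_min invr_gt0 divr_gt0 ?mulr_gt0.
  have e'1 : C * e' <= 2^-1.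
    have : e' <= (2 * C)^-1 by rewrite ge_min lexx.
    by move=> /(ler_wpM2l (ltW C0)) /le_trans; apply; rewrite invfM mulrCA divff ?gt_eqF// mulr1.
  have e'2 : C * e' * (2 * C) <= e.
    have : e' <= e / (2 * C * C) by rewrite ge_min lexx orbT.
    rewrite ler_pdivlMr; last by rewrite !mulr_gt0.
    by apply: le_trans; rewrite le_eqVlt; apply/orP; left; apply/eqP; ring.
  have := ch y0 _ (differentiable_approx (df x0) e'0).
  rewrite /nbhs /=; apply: filterS => y /=; rewrite hK fx0 -/x0.
  set w := h y - x0; set z := y - y0 => Hr.
  set r := z - 'd f x0 w in Hr *.
  have wE : w = A z - A r by rewrite -AB /r opprB addrC subrK AT.
  have Ar : `|A r| <= C * e' * `|w|.
    by rewrite (le_trans (HC _))// -mulrA ler_wpM2l// ltW.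
  have w2 : `|w| <= 2 * C * `|z|.
    have : `|w| <= `|A z| + `|A r| by rewrite {1}wE ler_normB.
    have := HC z; have : C * e' * `|w| <= 2^-1 * `|w| by rewrite ler_wpM2r.
    by move: Ar; lra.
  rewrite [X in `|X|](_ : _ = - A r); last by rewrite wE addrAC subrr add0r.
  rewrite normrN (le_trans Ar)//.
  apply: (@le_trans _ _ (C * e' * (2 * C * `|z|))).
    by rewrite ler_wpM2l// mulr_ge0 ?ltW.
  by rewrite mulrA ler_wpM2r.
by split=> // u; rewrite hE AT.
Qed.

(** The derivative of [h] is [A] evaluated along [h], so each order of
   differentiability of [h] gives the next. *)
Lemma smooth_inverse (E : normedModType R) (f h : E -> E) (A : E -> E -> E) :
  framed E -> cancel f h -> cancel h f -> smooth f ->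
  (forall x u, 'd f x u = 0 -> u = 0) ->
  (forall x v, 'd f x (A x v) = v) ->
  (forall v, smooth (fun x => A x v)) -> smooth h.
Proof.
move=> fE fK hK sf inj fA sA.
have df x : differentiable f x by exact: ((sf 1%N).1 x I).
have dh := inverse_differentiable fE fK hK df inj.
elim=> [|k IH].
  by move=> y _; apply: differentiable_continuous; exact: (dh y).1.
split=> [y _|v]; first exact: (dh y).1.
apply: (@Ck_ext _ _ _ _ _ (fun y => A (h y) v)).
  move=> y; rewrite (deriveE _ (dh y).1).
  by rewrite -{1}(fA (h y) v) (dh y).2.
exact: (Ck_comp fE IH (sA v)).
Qed.

End SmoothInverse.

(** * Transformation groups and their identity components *)

Section PostComposition.
Context {T U V : topologicalType}.

Definition postcomp (f : U -> V) (h : {compact-open, T -> U}) :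
  {compact-open, T -> V} := f \o h.

Lemma postcomp_continuous (f : U -> V) : continuous f ->
  continuous (postcomp f).
Proof.
move=> cf h; apply/compact_open_cvgP.
  by apply: fmap_filter; apply: nbhs_filter.
move=> K O cK oO fhKO.
have oP : open (f @^-1` O) by apply: open_comp => // x _; exact: cf.
have ow : open ([set g | g @` K `<=` f @^-1` O] : set {compact-open, T -> U}).
  exact: compact_open_open.
have hw : [set g : {compact-open, T -> U} | g @` K `<=` f @^-1` O] h.
  by move=> _ [x Kx <-]; apply: fhKO; exists x.
have nw := open_nbhs_nbhs (conj ow hw).
apply: filterS nw => k kK _ [x Kx <-].
by apply: (kK (k x)); exists x.
Qed.

End PostComposition.

Section Groups.
Context {R : realType} {E : normedModType R}.

Notation CO := {compact-open, E -> E}.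

Lemma identity_component_sub (A : set (E -> E)) : identity_component A `<=` A.
Proof. exact: (@connected_component_sub CO A idfun). Qed.

(** Composition with a fixed map is continuous for the compact-open topology,
   so it permutes the connected components of a group of continuous maps. *)
Lemma identity_component_group (A : set (E -> E)) :
  transformation_group A -> (forall f, A f -> continuous f) ->
  transformation_group (identity_component A).
Proof.
move=> [A1 AM AV] Ac.
pose T := CO.
pose C : set T := connected_component (A : set T) (idfun : T).
have C1 : C idfun by exact: connected_component_refl.
have cC : connected C by exact: component_connected.
have step (f g : E -> E) : A f -> C g -> C (f \o g) -> forall h, C h -> C (f \o h).
  move=> Af Cg Cfg h Ch.
  have cfC : connected (postcomp f @` C).
    apply: connected_continuous_connected => //.
    by apply: continuous_subspaceT; exact: postcomp_continuous (Ac _ Af).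
  have sfC : postcomp f @` C `<=` connected_component (A : set T) (f \o g : T).
    apply: connected_component_max => //; first by exists g.
    by move=> _ [k /identity_component_sub Ak <-]; exact: AM.
  apply: connected_component_trans Cfg _.
  by apply: sfC; exists h.
split; first exact: C1.
- by move=> f h Cf Ch; apply: (@step f idfun) => //; exact: identity_component_sub.
- move=> f Cf; have Af := identity_component_sub Cf.
  have [h [Ah fK hK]] := AV f Af; exists h; split=> //.
  have hf : h \o f = idfun by apply/funext => x /=; rewrite fK.
  by apply: (@step h f Ah Cf _ idfun C1); rewrite hf.
Qed.

(** A jointly continuous family is a continuous path for the compact-open
   topology. *)
Lemma path_identity_component (A : set (E -> E)) (F : R -> E -> E) :
  continuous (uncurry F) -> (forall t, A (F t)) -> F 0 = idfun ->
  forall t, identity_component A (F t).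
Proof.
move=> cF AF F0 t.
pose T := CO.
have cc : continuous ((F : R -> T)) by exact: (continuous_curry_fun cF).
have cim : connected ((F : R -> T) @` setT).
  apply: connected_continuous_connected; last exact: continuous_subspaceT.
  by apply/connected_intervalP => x y z.
have sub : (F : R -> T) @` setT `<=` connected_component (A : set T) (idfun : T).
  apply: connected_component_max => //; first by exists 0.
  by move=> _ [s _ <-].
by apply: sub; exists t.
Qed.

End Groups.

Section Isometries.
Context {R : realType} {E : normedModType R} (g : E -> E -> E -> R).

Lemma isometry_diff f x : Defs.isometry g f -> differentiable f x.
Proof. by move=> [_ sf _]; exact: ((sf 1%N).1 x I). Qed.

Lemma isometry_continuous f : Defs.isometry g f -> continuous f.
Proof. by move=> If x; apply: differentiable_continuous; exact: isometry_diff. Qed.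

(** Besides being closed under composition, isometries have smooth inverses:
   in a smooth orthonormal frame [e], the inverse of the differential is
   its adjoint. *)
Lemma isometry_group (I : finType) (e : I -> E -> E) :
  framed E ->
  (forall p u, u = \sum_i g p u (e i p) *: e i p) ->
  (forall p u v w a, g p (a *: u + v) w = a * g p u w + g p v w) ->
  (forall P u v : E -> E, smooth P -> smooth u -> smooth v ->
     smooth (fun p => g (P p) (u p) (v p))) ->
  (forall i, smooth (e i)) ->
  transformation_group (Defs.isometry g).
Proof.
move=> fE eE gl sg se; split.
- split; first by exists idfun.
  + by move=> k; exact: Ck_id.
  + move=> p u v.
    have [dE] := @linear_diff R E E idfun p (fun _ _ _ => erefl) (fun x => @cvg_id _ _).
    by move=> ->.
- move=> f h If Ih; have [bf sf gf] := If; have [bh sh gh] := Ih; split.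
  + exact: bij_comp.
  + exact: (smooth_comp fE sh sf).
  + move=> p u v.
    have -> := @diff_comp R E E E h f p (isometry_diff p Ih) (isometry_diff (h p) If).
    by rewrite /= gf gh.
- move=> f If; have [bf sf gf] := If; have [h fK hK] := bf.
  have g0 p w : g p 0 w = 0.
    have := gl p 0 0 w 1; rewrite scaler0 addr0 mul1r => /eqP.
    by rewrite -subr_eq0 opprD addrA subrr sub0r oppr_eq0 => /eqP.
  have inj x u : 'd f x u = 0 -> u = 0.
    move=> du; rewrite (eE x u) big1// => i _.
    by rewrite -gf du g0 scale0r.
  pose A x v := \sum_i g (f x) v ('d f x (e i x)) *: e i x.
  have lf x : linear ('d f x) by move=> a u v; rewrite linearP.
  have fA x v : 'd f x (A x v) = v.
    have [B [_ _ BT]] := framed_surjective fE (lf x) (inj x).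
    rewrite -{2}(BT v) [in RHS](eE x (B v)); congr ('d f x _).
    by apply: eq_bigr => i _; rewrite -[in LHS](BT v) gf.
  have sde i : smooth (fun x => 'd f x (e i x)).
    have [n' [b [l [ll cl dl el]]]] := fE.
    move=> k; apply: (@Ck_ext _ _ _ _ _ (fun x => \sum_j l j (e i x) *: 'D_(b j) f x)).
      move=> x; rewrite {1}(el (e i x)) linear_sum; apply: eq_bigr => j _.
      by rewrite linearZ (deriveE _ (isometry_diff x If)).
    apply: Ck_sum => j; apply: Ck_scale; last exact: (Ck_derive (sf k.+1)).
    by apply: Ck_lincomp => //; exact: se.
  have sA v : smooth (fun x => A x v).
    move=> k; apply: Ck_sum => i; apply: Ck_scale; last exact: se.
    by apply: sg => //; [move=> k'; exact: Ck_cst].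
  have sh : smooth h := smooth_inverse fE fK hK sf inj fA sA.
  exists h; split => //; split => //; first by exists f.
  move=> p u v.
  have [_ dh] := inverse_differentiable fE fK hK (fun x => isometry_diff x If) inj p.
  rewrite -(fA (h p) u) -(fA (h p) v) !dh.
  by rewrite -[in LHS]gf !fA [in LHS]hK.
Qed.

End Isometries.

(** * A calculus of directional derivatives *)

Section HasDerivative.
Context {R : realType}.

(** Both facts travel together, so that the derivative of an explicit expression
   is found by following its syntax. *)
Definition has_deriv {E F : normedModType R} (f : E -> F) (x v : E) (l : F) :=
  differentiable f x /\ 'D_v f x = l.

Lemma HD_eq (E F : normedModType R) (f : E -> F) x v l l' :
  has_deriv f x v l -> l = l' -> has_deriv f x v l'.
Proof. by move=> + <-. Qed.

Lemma HD_ext (E F : normedModType R) (f g : E -> F) x v l :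
  f =1 g -> has_deriv g x v l -> has_deriv f x v l.
Proof. by move=> /funext ->. Qed.

Lemma HD_cst (E F : normedModType R) (a : F) (x v : E) :
  has_deriv (fun _ => a) x v 0.
Proof. by split; [exact: differentiable_cst | exact: derive_cst]. Qed.

Lemma HD_lincomp (E F G : normedModType R) (L : F -> G) (f : E -> F) x v l :
  framed F -> linear L -> has_deriv f x v l ->
  has_deriv (fun y => L (f y)) x v (L l).
Proof.
move=> fF lL [df <-]; split; last exact: derive_linear_framed.
by apply: differentiable_lincomp => //; exact: framed_linear_continuous.
Qed.

Lemma HD_id (E : normedModType R) (x v : E) : has_deriv id x v v.
Proof.
split; last exact: derive_id.
by apply: (linear_diff x (L := id) _ _).1 => // y; exact: cvg_id.
Qed.

Lemma HD_add (E F : normedModType R) (f g : E -> F) x v l k :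
  has_deriv f x v l -> has_deriv g x v k ->
  has_deriv (fun y => f y + g y) x v (l + k).
Proof.
move=> [df <-] [dg <-]; split; first exact: differentiableD.
by rewrite deriveD//; exact: diff_derivable.
Qed.

Lemma HD_opp (E F : normedModType R) (f : E -> F) x v l :
  has_deriv f x v l -> has_deriv (fun y => - f y) x v (- l).
Proof.
move=> [df <-]; split; first exact: differentiableN.
by rewrite deriveN//; exact: diff_derivable.
Qed.

Lemma HD_sub (E F : normedModType R) (f g : E -> F) x v l k :
  has_deriv f x v l -> has_deriv g x v k ->
  has_deriv (fun y => f y - g y) x v (l - k).
Proof. by move=> Hf Hg; exact: HD_add Hf (HD_opp Hg). Qed.

Lemma HD_scale (E F : normedModType R) (a : E -> R) (f : E -> F) x v k l :
  has_deriv a x v k -> has_deriv f x v l ->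
  has_deriv (fun y => a y *: f y) x v (a x *: l + k *: f x).
Proof.
move=> [da <-] [df <-]; have [d H] := differentiable_scale da df.
by split=> //; exact: H.
Qed.

Lemma HD_mul (E : normedModType R) (a b : E -> R) x v k l :
  has_deriv a x v k -> has_deriv b x v l ->
  has_deriv (fun y => a y * b y) x v (a x * l + k * b x).
Proof. exact: HD_scale. Qed.

Lemma HD_exp (E : normedModType R) (a : E -> R) x v k :
  has_deriv a x v k -> has_deriv (fun y => expR (a y)) x v (expR (a x) * k).
Proof.
move=> [da <-]; have [d H] := derive_scalar_comp v (is_derive_expR (a x)) da.
by split.
Qed.

Lemma HD_inv (E : normedModType R) (a : E -> R) x v k : a x != 0 ->
  has_deriv a x v k -> has_deriv (fun y => (a y)^-1) x v (- (a x) ^- 2 * k).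
Proof.
move=> a0 [da <-]; have [d H] := derive_scalar_comp v (is_derive_inv a0) da.
by split.
Qed.

Lemma HD_ln (E : normedModType R) (a : E -> R) x v k : 0 < a x ->
  has_deriv a x v k -> has_deriv (fun y => ln (a y)) x v ((a x)^-1 * k).
Proof.
move=> a0 [da <-]; have [d H] := derive_scalar_comp v (is_derive1_ln a0) da.
by split.
Qed.

Lemma HD_sqrt (E : normedModType R) (a : E -> R) x v k : 0 < a x ->
  has_deriv a x v k ->
  has_deriv (fun y => Num.sqrt (a y)) x v ((2 * Num.sqrt (a x))^-1 * k).
Proof.
move=> a0 [da <-]; have [d H] := derive_scalar_comp v (is_derive1_sqrt a0) da.
by split.
Qed.

Lemma HD_bilinear (D E F G : normedModType R) (B : E -> F -> G)
    (f : D -> E) (g : D -> F) x v k l :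
  framed E -> framed F ->
  (forall y, linear (B^~ y)) -> (forall x, linear (B x)) ->
  has_deriv f x v k -> has_deriv g x v l ->
  has_deriv (fun x => B (f x) (g x)) x v (B k (g x) + B (f x) l).
Proof.
move=> fE fF lB rB [df <-] [dg <-].
by have [] := derive_bilinear v fE fF lB rB df dg.
Qed.

Lemma HD_pair (E F G : normedModType R) (f : E -> F) (g : E -> G) x v k l :
  has_deriv f x v k -> has_deriv g x v l ->
  has_deriv (fun y => (f y, g y)) x v (k, l).
Proof.
move=> [df <-] [dg <-].
have dp : differentiable (fun y => (f y, g y)) x by exact: differentiable_pair.
by split=> //; rewrite !deriveE ?diff_pair.
Qed.

Lemma HD_comp (E F G : normedModType R) (f : E -> F) (g : F -> G) x v k l :
  has_deriv f x v k -> has_deriv g (f x) k l ->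
  has_deriv (fun y => g (f y)) x v l.
Proof.
move=> [df <-] [dg <-]; split; first exact: differentiable_comp.
exact: derive_compose.
Qed.

Lemma HD_smooth (E F : normedModType R) (f : E -> F) x v :
  smooth f -> has_deriv f x v ('D_v f x).
Proof. by move=> sf; split => //; exact: ((sf 1%N).1 x I). Qed.

Lemma HD_nonincreasing (f f' : R -> R) :
  (forall t, has_deriv f t 1 (f' t)) -> (forall t, f' t <= 0) ->
  forall a b, a <= b -> f b <= f a.
Proof.
move=> df f0 a b; rewrite le_eqVlt => /orP[/eqP ->//|ab].
have dd (x : R) : x \in `]a, b[ -> is_derive x 1 f (f' x).
  move=> _; apply: DeriveDef; last exact: (df x).2.
  by apply: diff_derivable; exact: (df x).1.
have cf : {within `[a, b], continuous f}.
  by apply: continuous_subspaceT => x; apply: differentiable_continuous; exact: (df x).1.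
have [c _ E] := @MVT_segment R f f' a b (ltW ab) dd cf.
by rewrite -subr_le0 E mulr_le0_ge0// subr_ge0 ltW.
Qed.

Lemma HD0_constant (f : R -> R) :
  (forall t, has_deriv f t 1 0) -> forall s t, f s = f t.
Proof.
move=> df; suff H a b : a <= b -> f a = f b.
  by move=> s t; case/orP: (le_total s t) => /H.
move=> ab; apply: le_anti; rewrite (HD_nonincreasing df _ ab)// andbT -lerN2.
apply: (@HD_nonincreasing (fun t => - f t) (fun=> 0)) => // t.
by have := HD_opp (df t); rewrite oppr0.
Qed.

End HasDerivative.

(** * The metric of AN *)

Section MetricAN.
Context {R : realType} {m : nat} (J : 'I_3 -> 'M[R]_m).

Notation E := (AN R m).
Notation br := (n_bracket J).
Notation g := (an_metric J).

Lemma framed_AN : framed (AN R m).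
Proof.
by apply: framed_pair; [apply: framed_pair; [exact: framed_R|] |]; exact: framed_cV.
Qed.

Lemma br_linearl y : linear (br^~ y).
Proof. by move=> a u v; rewrite n_bracketDl n_bracketZl. Qed.
Lemma br_linearr x : linear (br x).
Proof. by move=> a u v; rewrite n_bracketDr n_bracketZr. Qed.
Lemma dot_linearl d (y : 'cV[R]_d) : linear (dot^~ y).
Proof. by move=> a u v; rewrite dotDl dotZl. Qed.
Lemma dot_linearr d (x : 'cV[R]_d) : linear (dot x).
Proof. by move=> a u v; rewrite dotDr dotZr. Qed.
Lemma coA_linear : linear (fun p : AN R m => p.1.1). Proof. by []. Qed.
Lemma coU_linear : linear (fun p : AN R m => p.1.2). Proof. by []. Qed.
Lemma coX_linear : linear (fun p : AN R m => p.2). Proof. by []. Qed.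

Lemma dot0l d (y : 'cV[R]_d) : dot 0 y = 0.
Proof. by rewrite -(scale0r 0) dotZl mul0r. Qed.
Lemma dot0r d (y : 'cV[R]_d) : dot y 0 = 0.
Proof. by rewrite dotC dot0l. Qed.
Lemma dotNl d (x y : 'cV[R]_d) : dot (- x) y = - dot x y.
Proof. by rewrite -scaleN1r dotZl mulN1r. Qed.
Lemma dotNr d (x y : 'cV[R]_d) : dot x (- y) = - dot x y.
Proof. by rewrite -scaleN1r dotZr mulN1r. Qed.
Lemma dotBl d (x y z : 'cV[R]_d) : dot (x - y) z = dot x z - dot y z.
Proof. by rewrite dotDl dotNl. Qed.
Lemma dotBr d (x y z : 'cV[R]_d) : dot z (x - y) = dot z x - dot z y.
Proof. by rewrite dotDr dotNr. Qed.
Lemma dot_ge0 d (x : 'cV[R]_d) : 0 <= dot x x.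
Proof. by apply: sumr_ge0 => i _; exact: sqr_ge0. Qed.
Lemma dot_eq0 d (x : 'cV[R]_d) : dot x x = 0 -> x = 0.
Proof.
move=> x0; apply/colP => i; rewrite mxE; apply/eqP; rewrite -sqrf_eq0.
move: x0; rewrite /dot => /eqP; rewrite psumr_eq0; last by move=> *; exact: sqr_ge0.
by move=> /allP/(_ i (mem_index_enum _)); rewrite expr2.
Qed.

Lemma HD_dot (D : normedModType R) d (f h : D -> 'cV[R]_d) x v k l :
  has_deriv f x v k -> has_deriv h x v l ->
  has_deriv (fun y => dot (f y) (h y)) x v (dot k (h x) + dot (f x) l).
Proof.
by apply: HD_bilinear; [exact: framed_cV..|exact: dot_linearl|exact: dot_linearr].
Qed.

Lemma HD_br (D : normedModType R) (f h : D -> 'cV[R]_m) x v k l :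
  has_deriv f x v k -> has_deriv h x v l ->
  has_deriv (fun y => br (f y) (h y)) x v (br k (h x) + br (f x) l).
Proof.
by apply: HD_bilinear; [exact: framed_cV..|exact: br_linearl|exact: br_linearr].
Qed.

Lemma HD_A (D : normedModType R) (f : D -> AN R m) x v l :
  has_deriv f x v l -> has_deriv (fun y => (f y).1.1) x v l.1.1.
Proof. exact: (HD_lincomp framed_AN coA_linear). Qed.
Lemma HD_U (D : normedModType R) (f : D -> AN R m) x v l :
  has_deriv f x v l -> has_deriv (fun y => (f y).1.2) x v l.1.2.
Proof. exact: (HD_lincomp framed_AN coU_linear). Qed.
Lemma HD_X (D : normedModType R) (f : D -> AN R m) x v l :
  has_deriv f x v l -> has_deriv (fun y => (f y).2) x v l.2.
Proof. exact: (HD_lincomp framed_AN coX_linear). Qed.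

Lemma Ck_dot (D : normedModType R) k d (f h : D -> 'cV[R]_d) :
  Ck k setT f -> Ck k setT h -> Ck k setT (fun y => dot (f y) (h y)).
Proof.
by apply: Ck_bilinear; [exact: framed_cV..|exact: dot_linearl|exact: dot_linearr].
Qed.
Lemma Ck_br (D : normedModType R) k (f h : D -> 'cV[R]_m) :
  Ck k setT f -> Ck k setT h -> Ck k setT (fun y => br (f y) (h y)).
Proof.
by apply: Ck_bilinear; [exact: framed_cV..|exact: br_linearl|exact: br_linearr].
Qed.
Lemma Ck_A (D : normedModType R) k (f : D -> AN R m) :
  Ck k setT f -> Ck k setT (fun y => (f y).1.1).
Proof. exact: (Ck_linear framed_AN coA_linear). Qed.
Lemma Ck_U (D : normedModType R) k (f : D -> AN R m) :
  Ck k setT f -> Ck k setT (fun y => (f y).1.2).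
Proof. exact: (Ck_linear framed_AN coU_linear). Qed.
Lemma Ck_X (D : normedModType R) k (f : D -> AN R m) :
  Ck k setT f -> Ck k setT (fun y => (f y).2).
Proof. exact: (Ck_linear framed_AN coX_linear). Qed.
Lemma Ck_opp (D F : normedModType R) k (f : D -> F) :
  Ck k setT f -> Ck k setT (fun y => - f y).
Proof.
move=> cf; apply: (@Ck_ext _ _ _ _ _ (fun y => (-1) *: f y)).
  by move=> y; rewrite scaleN1r.
by apply: Ck_scale => //; exact: Ck_cst.
Qed.
Lemma Ck_sub (D F : normedModType R) k (f h : D -> F) :
  Ck k setT f -> Ck k setT h -> Ck k setT (fun y => f y - h y).
Proof. by move=> cf ch; apply: Ck_add => //; exact: Ck_opp. Qed.

(** The vertical part of a tangent vector: its component along the centre,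
   up to the factor exp(-r). *)
Definition zeta (p u : AN R m) : 'cV[R]_3 := u.2 - 2^-1 *: br p.1.2 u.1.2.

(** The value at the identity of the left-invariant field through a tangent
   vector [u] at [p]. *)
Definition body (p u : AN R m) : AN R m :=
  (u.1.1, expR (- p.1.1 / 2) *: u.1.2, expR (- p.1.1) *: zeta p u).

Lemma zetaDl p u v : zeta p (u + v) = zeta p u + zeta p v.
Proof. by rewrite /zeta /= n_bracketDr scalerDr opprD addrACA. Qed.
Lemma zetaZl p a u : zeta p (a *: u) = a *: zeta p u.
Proof. by rewrite /zeta /= n_bracketZr scalerBr !scalerA mulrC. Qed.
Lemma zeta_linear p : linear (zeta p).
Proof. by move=> a u v; rewrite zetaDl zetaZl. Qed.

Lemma expR_half (x : R) : expR x = expR (x / 2) * expR (x / 2).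
Proof. by rewrite -expRD; congr expR; lra. Qed.
Lemma expRNr (x : R) : expR (- x) * expR x = 1.
Proof. by rewrite mulrC expRxMexpNx_1. Qed.

Lemma diff_an_mul s p u : differentiable (an_mul J s) p /\ 'd (an_mul J s) p u =
  (u.1.1, expR (s.1.1 / 2) *: u.1.2,
   expR s.1.1 *: u.2 + (2^-1 * expR (s.1.1 / 2)) *: br s.1.2 u.1.2).
Proof.
suff H : has_deriv (an_mul J s) p u (u.1.1, expR (s.1.1 / 2) *: u.1.2,
   expR s.1.1 *: u.2 + (2^-1 * expR (s.1.1 / 2)) *: br s.1.2 u.1.2).
  by case: H => d; rewrite deriveE.
apply: HD_eq.
  apply: HD_pair; first apply: HD_pair.
  - by apply: HD_add; [exact: HD_cst | exact: HD_A (HD_id _ _)].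
  - apply: HD_add; first exact: HD_cst.
    by apply: HD_scale; [exact: HD_cst | exact: HD_U (HD_id _ _)].
  - apply: HD_add; first apply: HD_add; first exact: HD_cst.
    + by apply: HD_scale; [exact: HD_cst | exact: HD_X (HD_id _ _)].
    + apply: HD_scale; first exact: HD_cst.
      by apply: HD_br; [exact: HD_cst | exact: HD_U (HD_id _ _)].
by rewrite !add0r !scale0r !addr0 n_bracket0l add0r.
Qed.

Lemma an_metric_body p u v : g p u v = an_inner (body p u) (body p v).
Proof.
rewrite /an_metric !(diff_an_mul _ _ _).2 /body /= /zeta.
have Ez (w : AN R m) : expR (- p.1.1) *: w.2 +
    (2^-1 * expR (- p.1.1 / 2)) *: br (- (expR (- p.1.1 / 2) *: p.1.2)) w.1.2 =
    expR (- p.1.1) *: (w.2 - 2^-1 *: br p.1.2 w.1.2).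
  rewrite -scaleNr n_bracketZl scalerBr !scalerA -scaleNr; congr (_ + _ *: _).
  by rewrite [in RHS]expR_half; ring.
by rewrite !Ez.
Qed.

Lemma an_metricE p u v : g p u v = u.1.1 * v.1.1 +
  expR (- p.1.1) * dot u.1.2 v.1.2 +
  expR (- p.1.1) ^+ 2 * dot (zeta p u) (zeta p v).
Proof.
rewrite an_metric_body /an_inner /body /= !dotZl !dotZr !mulrA.
by rewrite -[in LHS]expR_half expr2.
Qed.

Lemma body_left_invariant p a : body p (left_invariant J a p) = a.
Proof.
rewrite left_invariantE /body /zeta /=.
case: a => [[r U] X] /=; congr (_, _, _).
  by rewrite scalerA -expRD (_ : _ + _ = 0) ?expR0 ?scale1r//; lra.
rewrite n_bracketZr scalerA addrK scalerA expRNr scale1r//.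
Qed.

Lemma left_invariant_body p u : left_invariant J (body p u) p = u.
Proof.
rewrite left_invariantE /body /zeta /=.
case: u => [[r U] X] /=; congr (_, _, _).
  by rewrite scalerA -expRD (_ : _ + _ = 0) ?expR0 ?scale1r//; lra.
rewrite scalerA expRxMexpNx_1 scale1r n_bracketZr scalerA -mulrA -expRD.
by rewrite (_ : _ / 2 + _ = 0) ?expR0 ?mulr1 ?subrK//; lra.
Qed.

Lemma left_invariant_linear (p : AN R m) : linear (fun a => left_invariant J a p).
Proof.
move=> c a b; rewrite !left_invariantE /=; congr (_, _, _) => /=.
  by rewrite scalerDr !scalerA mulrC.
rewrite n_bracketDr n_bracketZr !scalerDr !scalerA addrACA.
by rewrite ![c * _]mulrC.
Qed.

Lemma an_inner_linear a : linear (an_inner^~ a : AN R m -> R).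
Proof.
move=> c x y; rewrite /an_inner /= !dotDl !dotZl /GRing.scale /=; ring.
Qed.

Lemma an_metric_linear (p u v w : AN R m) (a : R) : g p (a *: u + v) w = a * g p u w + g p v w.
Proof.
rewrite !an_metricE zeta_linear.
have -> : (a *: u + v).1.1 = a * u.1.1 + v.1.1 by [].
have -> : (a *: u + v).1.2 = a *: u.1.2 + v.1.2 by [].
by rewrite !(dotDl (_ *: _)) !dotZl; ring.
Qed.

Definition an_basis (i : unit + 'I_m + 'I_3) : AN R m :=
  match i with
  | inl (inl _) => (1, 0, 0)
  | inl (inr j) => (0, delta_mx j 0, 0)
  | inr j => (0, 0, delta_mx j 0)
  end.

Lemma dot_delta d (x : 'cV[R]_d) j : dot x (delta_mx j 0) = x j 0.
Proof.
rewrite /dot (bigD1 j)//= mxE !eqxx mulr1 big1 ?addr0// => i ij.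
by rewrite mxE (negbTE ij) mulr0.
Qed.

Lemma an_basisE (x : AN R m) : x = \sum_i an_inner x (an_basis i) *: an_basis i.
Proof.
have sp1 (F G : lmodType R) (I : finType) (f : I -> F * G) : \sum_i f i = (\sum_i (f i).1, \sum_i (f i).2).
  by elim: (index_enum I) => [|i s IH]; rewrite ?big_nil// !big_cons IH.
have cE d (z : 'cV[R]_d) : z = \sum_i z i 0 *: delta_mx i 0.
  by rewrite {1}(matrix_sum_delta z); apply: eq_bigr => i _; rewrite big_ord1.
case: x => [[r U] X]; rewrite big_sumType /= big_sumType /= !sp1 /an_inner /=.
congr (_, _, _) => /=.
- rewrite (big_pred1 tt)/=; last by case.
  rewrite big1 ?addr0; last by move=> i _; rewrite scaler0.
  rewrite big1 ?addr0; last by move=> i _; rewrite scaler0.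
  by rewrite !dot0r !addr0 mulr1 [RHS]mulr1.
- rewrite big1 ?add0r; last by move=> i _; rewrite scaler0.
  rewrite [X in _ = _ + X]big1 ?addr0; last by move=> i _; rewrite scaler0.
  rewrite {1}(cE _ U); apply: eq_bigr => i _.
  by rewrite mulr0 add0r dot_delta dot0r addr0.
- rewrite big1 ?add0r; last by move=> i _; rewrite scaler0.
  rewrite big1 ?add0r; last by move=> i _; rewrite scaler0.
  rewrite {1}(cE _ X); apply: eq_bigr => i _.
  by rewrite mulr0 add0r dot_delta dot0r add0r.
Qed.

Definition an_frame i (p : AN R m) := left_invariant J (an_basis i) p.

Lemma an_frameE p u : u = \sum_i g p u (an_frame i p) *: an_frame i p.
Proof.
rewrite -{1}(left_invariant_body p u) [X in left_invariant J X p]an_basisE.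
rewrite (linear_sumE _ _ _ (left_invariant_linear p)).
by apply: eq_bigr => i _; rewrite an_metric_body body_left_invariant.
Qed.

Lemma smooth_left_invariant a : smooth (left_invariant J a).
Proof.
move=> k; apply: (Ck_ext (left_invariantE J a)).
have cid := @Ck_id R (AN R m) k.
have chalf : Ck k setT (fun p : AN R m => expR (p.1.1 / 2)).
  by apply: Ck_exp; apply: Ck_mul; [exact: Ck_A cid | exact: Ck_cst].
apply: Ck_pair; first apply: Ck_pair.
- exact: Ck_cst.
- by apply: Ck_scale => //; exact: Ck_cst.
- apply: Ck_add; apply: Ck_scale; try exact: Ck_cst.
  + exact: Ck_exp (Ck_A cid).
  + by apply: Ck_mul => //; exact: Ck_cst.
  + by apply: Ck_br; [exact: Ck_U cid | exact: Ck_cst].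
Qed.

Lemma Ck_zeta (D : normedModType R) k (P u : D -> AN R m) :
  Ck k setT P -> Ck k setT u -> Ck k setT (fun p => zeta (P p) (u p)).
Proof.
move=> cP cu; apply: Ck_sub; first exact: Ck_X.
by apply: Ck_scale; [exact: Ck_cst | apply: Ck_br; exact: Ck_U].
Qed.

Lemma Ck_metric (D : normedModType R) k (P u v : D -> AN R m) :
  Ck k setT P -> Ck k setT u -> Ck k setT v ->
  Ck k setT (fun p => g (P p) (u p) (v p)).
Proof.
move=> cP cu cv; apply: (@Ck_ext _ _ _ _ _ _ (fun p => an_metricE _ _ _)).
have ce : Ck k setT (fun p => expR (- (P p).1.1)).
  by apply: Ck_exp; apply: Ck_opp; exact: Ck_A.
apply: Ck_add; first apply: Ck_add; first by apply: Ck_mul; exact: Ck_A.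
- by apply: Ck_mul => //; apply: Ck_dot; exact: Ck_U.
- by apply: Ck_mul; [exact: Ck_mul | apply: Ck_dot; exact: Ck_zeta].
Qed.

Lemma an_isometry_group : transformation_group (Defs.isometry g).
Proof.
apply: (isometry_group (e := an_frame)).
- exact: framed_AN.
- exact: an_frameE.
- exact: an_metric_linear.
- by move=> P u v sP su sv k; exact: Ck_metric.
- by move=> i; exact: smooth_left_invariant.
Qed.

Lemma HD_zeta p u v : has_deriv (fun q => zeta q v) p u (- (2^-1 *: br u.1.2 v.1.2)).
Proof.
apply: HD_eq.
  apply: HD_sub; first exact: HD_cst.
  apply: HD_scale; first exact: HD_cst.
  by apply: HD_br; [exact: HD_U (HD_id _ _) | exact: HD_cst].
by rewrite sub0r scale0r addr0 n_bracket0r addr0.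
Qed.

Lemma derive_metric (p u v w : AN R m) : 'D_u (fun q => g q v w) p =
  - u.1.1 * expR (- p.1.1) * dot v.1.2 w.1.2
  - 2 * u.1.1 * expR (- p.1.1) ^+ 2 * dot (zeta p v) (zeta p w)
  - 2^-1 * expR (- p.1.1) ^+ 2 *
    (dot (br u.1.2 v.1.2) (zeta p w) + dot (zeta p v) (br u.1.2 w.1.2)).
Proof.
suff [] : has_deriv (fun q => g q v w) p u
  (- u.1.1 * expR (- p.1.1) * dot v.1.2 w.1.2
  - 2 * u.1.1 * expR (- p.1.1) ^+ 2 * dot (zeta p v) (zeta p w)
  - 2^-1 * expR (- p.1.1) ^+ 2 *
    (dot (br u.1.2 v.1.2) (zeta p w) + dot (zeta p v) (br u.1.2 w.1.2))) by [].
have He : has_deriv (fun q : AN R m => expR (- q.1.1)) p u (expR (- p.1.1) * - u.1.1).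
  by apply: HD_exp; apply: HD_opp; exact: HD_A (HD_id _ _).
apply: (HD_ext (fun q => an_metricE q v w)).
apply: HD_eq.
  apply: HD_add; first apply: HD_add; first exact: HD_cst.
  - by apply: HD_mul; [exact: He | exact: HD_cst].
  - apply: HD_mul; first exact: (HD_mul He He).
    by apply: HD_dot; exact: HD_zeta.
by rewrite !dotNl !dotNr !dotZl !dotZr; ring.
Qed.

Lemma christoffelE (p u v w : AN R m) : canonical_basis J ->
  christoffel g p u v w =
  - 2^-1 * expR (- p.1.1) *
    (u.1.1 * dot v.1.2 w.1.2 + v.1.1 * dot u.1.2 w.1.2 - w.1.1 * dot u.1.2 v.1.2)
  - expR (- p.1.1) ^+ 2 *
    (u.1.1 * dot (zeta p v) (zeta p w) + v.1.1 * dot (zeta p u) (zeta p w)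
     - w.1.1 * dot (zeta p u) (zeta p v))
  - 2^-1 * expR (- p.1.1) ^+ 2 *
    (dot (zeta p v) (br u.1.2 w.1.2) + dot (zeta p u) (br v.1.2 w.1.2)).
Proof.
move=> cJ; rewrite /christoffel !derive_metric.
rewrite (n_bracketC w.1.2 u.1.2)// (n_bracketC w.1.2 v.1.2)// (n_bracketC v.1.2 u.1.2)//.
rewrite !(dotNl, dotNr) [dot (br u.1.2 w.1.2) _]dotC.
by field.
Qed.

Lemma an_mul_smooth s : smooth (an_mul J s).
Proof.
move=> k; have cid := @Ck_id R (AN R m) k.
apply: Ck_pair; first apply: Ck_pair.
- by apply: Ck_add; [exact: Ck_cst | exact: Ck_A cid].
- apply: Ck_add; first exact: Ck_cst.
  by apply: Ck_scale; [exact: Ck_cst | exact: Ck_U cid].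
- apply: Ck_add; first (apply: Ck_add; first exact: Ck_cst).
  + by apply: Ck_scale; [exact: Ck_cst | exact: Ck_X cid].
  + apply: Ck_scale; first exact: Ck_cst.
    by apply: Ck_br; [exact: Ck_cst | exact: Ck_U cid].
Qed.

Lemma an_mulV' p : canonical_basis J -> an_mul J p (an_inv p) = 0.
Proof.
case: p => [[a U] X] cJ; rewrite /an_mul /an_inv /=.
rewrite -!scaleNr n_bracketZr n_bracketxx// !scaler0 addr0 !scalerA.
congr (_, _, _) => /=.
- by rewrite subrr.
- by rewrite mulrN -expRD (_ : _ / 2 + _ = 0) ?expR0 ?scaleN1r ?subrr//; lra.
- by rewrite mulrN expRxMexpNx_1 scaleN1r subrr.
Qed.

Lemma an_mulp0 p : an_mul J p 0 = p.
Proof.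
case: p => [[a U] X]; rewrite /an_mul /=.
by rewrite n_bracket0r !scaler0 !addr0.
Qed.

(** Left-invariant fields are preserved by left translations, so the value at
   the identity does not change; left translations are therefore isometries. *)
Lemma an_mul_body s p u : body (an_mul J s p) ('d (an_mul J s) p u) = body p u.
Proof.
rewrite (diff_an_mul s p u).2 /body /zeta /an_mul /=; congr (_, _, _).
  by rewrite scalerA -expRD; congr (expR _ *: _); lra.
rewrite n_bracketZr n_bracketDl n_bracketZl scalerDr !scalerA.
have -> : expR (- (s.1.1 + p.1.1)) = expR (- p.1.1) * expR (- s.1.1).
  by rewrite -expRD; congr expR; lra.
have e2 := expR_half s.1.1; have e3 := expRNr s.1.1.
set e := expR (s.1.1 / 2) in e2 *; set f := expR (- s.1.1) in e3 *.
rewrite e2 in e3; rewrite e2.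
apply/colP => i; rewrite !mxE.
set c := expR (- p.1.1); set x := u.2 i 0.
set y := dot _ _; set z := dot _ _.
transitivity (c * (f * (e * e)) * (x - 2^-1 * z)); first by field.
by rewrite e3 mulr1; field.
Qed.

Lemma an_mul_isometry s : canonical_basis J -> Defs.isometry g (an_mul J s).
Proof.
move=> cJ; split.
- exists (an_mul J (an_inv s)) => p; rewrite an_mulA.
    by rewrite an_mulV// an_mul0.
  by rewrite an_mulV'// an_mul0.
- exact: an_mul_smooth.
- by move=> p u v; rewrite !an_metric_body !an_mul_body.
Qed.

End MetricAN.

(** * Quaternionic linear algebra *)

Section QuaternionAlgebra.
Context {R : realType} {m : nat} (J : 'I_3 -> 'M[R]_m) (cJ : canonical_basis J).

Lemma JJ_sq i : J i *m J i = - 1%:M. Proof. by case: (cJ i). Qed.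
Lemma J_tr i : (J i)^T = - J i. Proof. exact: canonical_skew. Qed.

Lemma ord3_cases (i : 'I_3) : [\/ i = 0, i = 1 | i = 2].
Proof.
case: i => -[|[|[|//]]] Hi; [apply: Or31|apply: Or32|apply: Or33]; exact: val_inj.
Qed.

Lemma sum_ord3 (V : nmodType) (F : 'I_3 -> V) : \sum_i F i = F 0 + F 1 + F 2.
Proof.
rewrite !big_ord_recl big_ord0 addr0 addrA.
by congr (_ + _ + _); congr F; exact: val_inj.
Qed.

Lemma JJ01 : J 0 *m J 1 = J 2. Proof. by case: (cJ 0) => _ _; rewrite !add0r. Qed.
Lemma JJ10 : J 1 *m J 0 = - J 2. Proof. by case: (cJ 0) => _ _ _; rewrite !add0r. Qed.
Let i3_12 : (1 + 2 : 'I_3) = 0. Proof. exact: val_inj. Qed.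
Let i3_21 : (2 + 1 : 'I_3) = 0. Proof. exact: val_inj. Qed.
Let i3_22 : (2 + 2 : 'I_3) = 1. Proof. exact: val_inj. Qed.
Lemma JJ12 : J 1 *m J 2 = J 0. Proof. by case: (cJ 1) => _ _; rewrite i3_12. Qed.
Lemma JJ21 : J 2 *m J 1 = - J 0. Proof. by case: (cJ 1) => _ _ _; rewrite i3_12. Qed.
Lemma JJ20 : J 2 *m J 0 = J 1. Proof. by case: (cJ 2) => _ _; rewrite i3_21 i3_22. Qed.
Lemma JJ02 : J 0 *m J 2 = - J 1. Proof. by case: (cJ 2) => _ _ _; rewrite i3_21 i3_22. Qed.

Definition JJE := (JJ_sq, JJ01, JJ10, JJ12, JJ21, JJ20, JJ02).

Lemma dot_J i x y : dot (J i *m x) y = - dot x (J i *m y).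
Proof. by rewrite !dotE trmx_mul J_tr mulmxN mulNmx mxE mulmxA. Qed.

Lemma dot_JJ i x y : dot (J i *m x) (J i *m y) = dot x y.
Proof. by rewrite dot_J mulmxA JJ_sq mulNmx mul1mx dotNr opprK. Qed.

Lemma dot_Jxx i x : dot (J i *m x) x = 0.
Proof. by have := dot_J i x x; rewrite [dot x _]dotC; lra. Qed.

(** Half the sum of the conjugates of [X] under the eight unit quaternions +-1,
   +-J_i, which therefore commutes with the quaternionic structure. *)
Definition average (X : 'M[R]_m) : 'M[R]_m := X - \sum_i J i *m X *m J i.

Lemma averageE X : average X =
  X - (J 0 *m X *m J 0 + J 1 *m X *m J 1 + J 2 *m X *m J 2).
Proof. by rewrite /average sum_ord3. Qed.

Lemma averageD X Y : average (X + Y) = average X + average Y.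
Proof.
rewrite /average; under eq_bigr => i _ do rewrite mulmxDr mulmxDl.
by rewrite big_split opprD addrACA.
Qed.

Lemma averageZ a X : average (a *: X) = a *: average X.
Proof.
rewrite /average scalerBr scaler_sumr; congr (_ - _).
by apply: eq_bigr => i _; rewrite -scalemxAr -scalemxAl.
Qed.

Lemma average_tr X : (average X)^T = average X^T.
Proof.
rewrite /average linearB/= linear_sum/=; congr (_ - _); apply: eq_bigr => i _.
by rewrite !trmx_mul J_tr !mulNmx !mulmxN opprK mulmxA.
Qed.

Lemma average_comm X i : average X *m J i = J i *m average X.
Proof.
rewrite averageE mulmxBl mulmxBr !mulmxDl !mulmxDr -!mulmxA.
case: (ord3_cases i) => ->; rewrite ?JJE !mulmxA ?JJE -?mulmxA ?JJE;
  rewrite ?mulmxN ?mulNmx ?mulmx1 ?mul1mx ?mulmxA.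
all: set a := X *m _; set b := _ *m X; apply/matrixP => j k; rewrite !mxE; ring.
Qed.

(** Conjugating by [J i] permutes the eight unit quaternions, so [J i] can be
   moved around inside an average. *)
Lemma average_swap X i : average (X *m J i) = average (J i *m X).
Proof.
rewrite !averageE -!mulmxA.
case: (ord3_cases i) => ->; rewrite ?JJE !mulmxA ?JJE -?mulmxA ?JJE;
  rewrite ?mulmxN ?mulNmx ?mulmx1 ?mul1mx ?mulmxA.
all: set a := X *m _; set b := _ *m X; apply/matrixP => j k; rewrite !mxE; ring.
Qed.

Lemma average_mulr X Y : (forall i, Y *m J i = J i *m Y) ->
  average (X *m Y) = average X *m Y.
Proof.
move=> YJ; rewrite /average mulmxBl mulmx_suml; congr (_ - _).
by apply: eq_bigr => i _; rewrite -!mulmxA YJ.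
Qed.

Definition quat (c : R) (b : 'I_3 -> R) : 'M[R]_m := c%:M + \sum_i b i *: J i.

Lemma quatE c b x : quat c b *m x = c *: x + \sum_i b i *: (J i *m x) :> 'cV_m.
Proof.
rewrite mulmxDl mul_scalar_mx mulmx_suml; congr (_ + _).
by apply: eq_bigr => i _; rewrite -scalemxAl.
Qed.

Lemma quat_tr c b : (quat c b)^T = quat c (fun i => - b i).
Proof.
rewrite /quat linearD/= tr_scalar_mx linear_sum/=; congr (_ + _).
by apply: eq_bigr => i _; rewrite linearZ/= J_tr scalerN scaleNr.
Qed.

Lemma quat_norm c b : quat c b *m quat c (fun i => - b i) =
  (c ^+ 2 + \sum_i b i ^+ 2)%:M.
Proof.
rewrite /quat !sum_ord3 !(mulmxDl, mulmxDr) -!scalemxAl -!scalemxAr !scalerA.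
rewrite !JJE !scalerN !mul_scalar_mx !mul_mx_scalar.
apply/matrixP => i j; rewrite !mxE.
by case: (i == j); rewrite ?mulr0n ?mulr1n; ring.
Qed.

Lemma average_quat X c b : average (X *m quat c b) = average (quat c b *m X).
Proof.
rewrite /quat mulmxDr mulmxDl !averageD mul_mx_scalar mul_scalar_mx; congr (_ + _).
rewrite !sum_ord3 !(mulmxDl, mulmxDr) !averageD -!scalemxAl -!scalemxAr !averageZ.
by rewrite !average_swap.
Qed.

(** On the quaternionic line of [u], the quaternion-linear map that sends [u] to
   [H u]; zero on the orthogonal complement of that line. *)
Definition line (u : 'cV[R]_m) (H : 'M[R]_m) : 'M[R]_m :=
  (dot u u)^-1 *: average (H *m (u *m u^T)).

Lemma lineD u H K : line u (H + K) = line u H + line u K.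
Proof. by rewrite /line mulmxDl averageD scalerDr. Qed.

Lemma line_comm u H i : line u H *m J i = J i *m line u H.
Proof. by rewrite -scalemxAl average_comm scalemxAr. Qed.

Lemma line_tr u c b : (line u (quat c b))^T = line u (quat c (fun i => - b i)).
Proof.
rewrite /line linearZ/= average_tr trmx_mul quat_tr average_quat.
by rewrite trmx_mul trmxK.
Qed.

Lemma outer_mul (u x : 'cV[R]_m) : u *m u^T *m x = dot u x *: u.
Proof.
rewrite -mulmxA [u^T *m x]mx11_scalar mul_mx_scalar.
by rewrite -dotE.
Qed.

Lemma average_outer H u x : average (H *m (u *m u^T)) *m x =
  dot u x *: (H *m u) + \sum_i dot (J i *m u) x *: (J i *m (H *m u)).
Proof.
rewrite /average mulmxBl -mulmxA outer_mul -scalemxAr mulmx_suml -sumrN.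
congr (_ + _); apply: eq_bigr => i _.
rewrite -!mulmxA [u^T *m _]mx11_scalar mul_mx_scalar -dotE -!scalemxAr.
by rewrite dot_J scaleNr.
Qed.

Lemma line_self u H : u != 0 -> line u H *m u = H *m u.
Proof.
move=> u0; rewrite -scalemxAl average_outer big1 ?addr0.
  rewrite scalerA mulVf ?scale1r//; apply/eqP => /dot_eq0 /eqP; exact/negP.
by move=> i _; rewrite dot_Jxx scale0r.
Qed.

Lemma line_orthogonal u H x :
  dot u x = 0 -> (forall i, dot (J i *m u) x = 0) -> line u H *m x = 0.
Proof.
move=> ux Jux; rewrite -scalemxAl average_outer ux scale0r add0r big1 ?scaler0//.
by move=> i _; rewrite Jux scale0r.
Qed.

Lemma line_mul u H c b : u != 0 ->
  line u H *m line u (quat c b) = line u (quat c b *m H).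
Proof.
move=> u0; have N0 : dot u u != 0 by apply/eqP => /dot_eq0 /eqP; exact/negP.
set L := line u (quat c b).
have LJ i : L *m J i = J i *m L by exact: line_comm.
rewrite {1}/line -scalemxAl -(average_mulr _ LJ) /line; congr (_ *: _).
rewrite -(mulmxA H); have -> : u *m u^T *m L = u *m u^T *m quat c b.
  rewrite -!mulmxA; congr (_ *m _); apply: trmx_inj.
  rewrite !trmx_mul trmxK line_tr quat_tr; exact: line_self.
by rewrite mulmxA average_quat !mulmxA.
Qed.

Lemma line_mul0 u v H c b :
  dot u v = 0 -> (forall i, dot (J i *m u) v = 0) ->
  line u H *m line v (quat c b) = 0.
Proof.
move=> uv Juv; set L := line v (quat c b).
have LJ i : L *m J i = J i *m L by exact: line_comm.
rewrite {1}/line -scalemxAl -(average_mulr _ LJ).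
have -> : H *m (u *m u^T) *m L = 0.
  rewrite -!mulmxA; have -> : u^T *m L = 0.
    apply: trmx_inj; rewrite trmx_mul trmxK line_tr trmx0.
    by apply: line_orthogonal => [|i]; rewrite dotC// -[RHS]oppr0 -(Juv i) dot_J opprK.
  by rewrite !mulmx0.
by rewrite -(scale0r 0) averageZ !scale0r scaler0.
Qed.

End QuaternionAlgebra.

Section Rotations.
Context {R : realType} {m : nat} (J : 'I_3 -> 'M[R]_m) (cJ : canonical_basis J).
Context {I : finType} (u : I -> 'cV[R]_m) (eps : 'I_3 -> I -> R).
Hypothesis u_neq0 : forall l, u l != 0.
Hypothesis u_ortho : forall l l', l != l' -> dot (u l) (u l') = 0.
Hypothesis u_real : forall i l l', dot (J i *m u l) (u l') = 0.

(** Acts on the quaternionic line of [u l] as the quaternion with coordinates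
   [c] and [b i * eps i l], in the coordinate determined by [u l], and
   trivially on the orthogonal complement of these lines. *)
Definition rotation (c : R) (b : 'I_3 -> R) : 'M[R]_m :=
  1%:M + \sum_l line J (u l) (quat J (c - 1) (fun i => b i * eps i l)).

Lemma rotation_comm c b i : rotation c b *m J i = J i *m rotation c b.
Proof.
rewrite mulmxDl mulmxDr mul1mx mulmx1 mulmx_suml mulmx_sumr; congr (_ + _).
by apply: eq_bigr => l _; rewrite line_comm.
Qed.

Lemma rotation_line c b l :
  rotation c b *m u l = quat J c (fun i => b i * eps i l) *m u l.
Proof.
rewrite mulmxDl mul1mx mulmx_suml (bigD1 l)//= big1; last first.
  move=> l' ll'; apply: line_orthogonal => //; first exact: u_ortho.
rewrite addr0 line_self// !quatE//.
by rewrite scalerBl scale1r addrA [X in X + _]addrC subrK.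
Qed.

Lemma rotation_Sp c b : (forall i l, eps i l ^+ 2 = 1) ->
  c ^+ 2 + \sum_i b i ^+ 2 = 1 -> Sp J (rotation c b).
Proof.
move=> e1 cb; split; last exact: rotation_comm.
pose q l := quat J (c - 1) (fun i => b i * eps i l).
pose q' l := quat J (c - 1) (fun i => - (b i * eps i l)).
have -> : (rotation c b)^T = 1%:M + \sum_l line J (u l) (q' l).
  rewrite /rotation linearD/= trmx1 linear_sum/=; congr (_ + _).
  by apply: eq_bigr => l _; rewrite line_tr.
rewrite /rotation mulmxDl mul1mx mulmxDr mulmx1 -addrA -[RHS]addr0; congr (_ + _).
rewrite mulmx_suml -!big_split big1// => l _ /=.
rewrite mulmx_sumr (bigD1 l)//= big1 ?addr0; last first.
  by move=> l' ll'; rewrite line_mul0// u_ortho// eq_sym.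
rewrite line_mul// -/(q l) -/(q' l) -!lineD.
suff -> : q l + (q' l + q l *m q' l) = 0.
  by rewrite /line mul0mx -(scale0r 0) averageZ !scale0r scaler0.
rewrite /q' /q quat_norm// /quat.
rewrite (_ : \sum_i (b i * eps i l) ^+ 2 = 1 - c ^+ 2); last first.
  rewrite -cb [_ + \sum_i _]addrC addrK; apply: eq_bigr => i _.
  by rewrite exprMn e1 mulr1.
rewrite !sum_ord3; apply/matrixP => i j; rewrite !mxE.
by case: (i == j); rewrite ?mulr0n ?mulr1n; ring.
Qed.

End Rotations.

(** * Four-dimensional subspaces of constant Kaehler angle *)

Section KahlerSubspace.
Context {R : realType} {m : nat} (J : 'I_3 -> 'M[R]_m) (cJ : canonical_basis J).
Context (c : 'I_3 -> R) (g0 : 'cV[R]_m) (g : 'I_3 -> 'cV[R]_m).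

(** A totally real family with the inner products of the vectors
   [xi_0] and [- J_i xi_i]; indexed by the Klein four-group, it has
   a Gram matrix that is invariant under translations. *)
Hypothesis g00 : dot g0 g0 = 1.
Hypothesis gii : forall i, dot (g i) (g i) = 1.
Hypothesis g0i : forall i, dot g0 (g i) = c i.
Hypothesis gij : forall i, dot (g i) (g (i + 1)) = c (i + 2).
Hypothesis r00 : forall k, dot (J k *m g0) g0 = 0.
Hypothesis r0i : forall k i, dot (J k *m g0) (g i) = 0.
Hypothesis rij : forall k i j, dot (J k *m g i) (g j) = 0.
Hypothesis c_pos : [/\ 0 < 1 + c 0 + c 1 + c 2, 0 < 1 + c 0 - c 1 - c 2,
  0 < 1 - c 0 + c 1 - c 2 & 0 < 1 - c 0 - c 1 + c 2].

(** The three nontrivial characters of the Klein four-group. *)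
Definition klein (i : 'I_3) (l : bool * bool) : R :=
  match val i with
  | 0%N => (-1) ^+ l.1
  | 1%N => (-1) ^+ l.2
  | _ => (-1) ^+ l.1 * (-1) ^+ l.2
  end.

Lemma klein_sq i l : klein i l ^+ 2 = 1.
Proof.
by case: (ord3_cases i) => ->; case: l => -[] []; rewrite /klein /= ?expr0 ?expr1; ring.
Qed.

Lemma sum_klein (V : nmodType) (F : bool * bool -> V) : \sum_l F l =
  F (true, true) + F (true, false) + F (false, true) + F (false, false).
Proof.
rewrite (eq_bigr (fun p => F (p.1, p.2))); last by case.
rewrite -(pair_bigA _ (fun a b => F (a, b))) /= !big_bool /=.
by rewrite addrA.
Qed.

(** The characters diagonalise the Gram matrix of [g]. *)
Definition uline (l : bool * bool) : 'cV[R]_m := g0 + \sum_i klein i l *: g i.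

Let g01 : dot (g 0) (g 1) = c 2.
Proof. by have := gij 0; rewrite !add0r. Qed.
Let g12 : dot (g 1) (g 2) = c 0.
Proof. by have := gij 1; rewrite (_ : 1 + 2 = 0 :> 'I_3)//; exact: val_inj. Qed.
Let g20 : dot (g 0) (g 2) = c 1.
Proof.
have := gij 2; rewrite (_ : 2 + 1 = 0 :> 'I_3); last exact: val_inj.
by rewrite (_ : 2 + 2 = 1 :> 'I_3) ?[dot (g 2) _]dotC//; exact: val_inj.
Qed.
Let gi0 i : dot (g i) g0 = c i. Proof. by rewrite dotC. Qed.
Let g10 : dot (g 1) (g 0) = c 2. Proof. by rewrite dotC. Qed.
Let g21 : dot (g 2) (g 1) = c 0. Proof. by rewrite dotC. Qed.
Let g02 : dot (g 2) (g 0) = c 1. Proof. by rewrite dotC. Qed.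
Let gramE := (g00, gii, g0i, gi0, g01, g12, g20, g10, g21, g02).

Lemma uline_dot l l' : dot (uline l) (uline l') =
  if l == l' then 4 * (1 + \sum_i klein i l * c i) else 0.
Proof.
rewrite /uline !sum_ord3 !(dotDl, dotDr, dotZl, dotZr) !gramE.
by case: l l' => -[] [] [] [] []; rewrite /klein /= ?expr0 ?expr1; ring.
Qed.

Lemma uline_neq0 l : uline l != 0.
Proof.
apply/eqP => u0; have := uline_dot l l; rewrite u0 dot0l eqxx sum_ord3.
case: c_pos; case: l {u0} => -[] []; rewrite /klein /= ?expr0 ?expr1; lra.
Qed.

Lemma uline_ortho l l' : l != l' -> dot (uline l) (uline l') = 0.
Proof. by move=> ll'; rewrite uline_dot (negbTE ll'). Qed.

Let ri0 k i : dot (J k *m g i) g0 = 0.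
Proof. by rewrite dot_J// dotC -/(dot _ _) r0i oppr0. Qed.

Lemma uline_real k l l' : dot (J k *m uline l) (uline l') = 0.
Proof.
rewrite /uline !sum_ord3 !mulmxDr -!scalemxAr.
rewrite !(dotDl, dotDr, dotZl, dotZr) !(r00, r0i, ri0, rij).
by rewrite !(mulr0, addr0).
Qed.

Lemma uline_sum : g0 = 4^-1 *: \sum_l uline l.
Proof.
rewrite sum_klein /uline !sum_ord3 /klein /= ?expr0 ?expr1.
by apply/colP => j; rewrite !mxE; field.
Qed.

Lemma uline_sumi i : g i = 4^-1 *: \sum_l klein i l *: uline l.
Proof.
rewrite sum_klein /uline !sum_ord3.
by case: (ord3_cases i) => ->; rewrite /klein /= ?expr0 ?expr1;
  apply/colP => j; rewrite !mxE; field.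
Qed.

(** The vectors xi_0 and xi_k = J_k g_k, where
   g_k = cos phi_k e_0 + sin phi_k e_k. *)
Definition xi (k : 'I_4) : 'cV[R]_m :=
  if unlift 0 k is Some i then J i *m g i else g0.

Lemma xi0 : xi 0 = g0. Proof. by rewrite /xi unlift_none. Qed.
Lemma xiS i : xi (lift 0 i) = J i *m g i. Proof. by rewrite /xi liftK. Qed.

(** Along the four lines of [uline] the imaginary part of [q] acts with the signs
   of the characters. Since g_0 and g_i are the averages of [uline] against the
   trivial character and the character [klein i], these signs turn g_0 into g_i
   and g_j into g_k, which the rotation needs to stay in the span of [xi]. *)
Definition krot (q : 'I_4 -> R) : 'M[R]_m :=
  rotation J uline klein (q 0) (fun i => q (lift 0 i)).

Lemma sum_ord4 (V : nmodType) (F : 'I_4 -> V) :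
  \sum_k F k = F 0 + \sum_i F (lift 0 i).
Proof. by rewrite big_ord_recl. Qed.

Lemma krot_Sp q : \sum_k q k ^+ 2 = 1 -> Sp J (krot q).
Proof.
rewrite sum_ord4 => q1; apply: rotation_Sp => //.
- exact: uline_neq0.
- exact: uline_ortho.
- exact: uline_real.
- exact: klein_sq.
Qed.

Lemma krot_uline q l : krot q *m uline l =
  q 0 *: uline l + \sum_i (q (lift 0 i) * klein i l) *: (J i *m uline l).
Proof.
by rewrite /krot rotation_line ?quatE//; [exact: uline_neq0|exact: uline_ortho|exact: uline_real].
Qed.

Lemma krot_g0 q : krot q *m g0 = q 0 *: g0 + \sum_i q (lift 0 i) *: (J i *m g i).
Proof.
rewrite {1}uline_sum -scalemxAr mulmx_sumr.
under eq_bigr => l _ do rewrite krot_uline.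
rewrite big_split /= scalerDr -scaler_sumr scalerA mulrC -scalerA -uline_sum.
congr (_ + _); rewrite exchange_big scaler_sumr; apply: eq_bigr => i _.
rewrite [in RHS]uline_sumi -scalemxAr mulmx_sumr scalerA mulrC -scalerA; congr (_ *: _).
by rewrite scaler_sumr; apply: eq_bigr => l _; rewrite -scalemxAr scalerA mulrC.
Qed.

Lemma krot_g q j : krot q *m g j = q 0 *: g j +
  \sum_i q (lift 0 i) *: (4^-1 *: \sum_l (klein i l * klein j l) *: (J i *m uline l)).
Proof.
rewrite {1}uline_sumi -scalemxAr mulmx_sumr.
under eq_bigr => l _ do rewrite -scalemxAr krot_uline scalerDr scalerA mulrC -scalerA.
rewrite big_split /= scalerDr -scaler_sumr scalerA mulrC -scalerA -uline_sumi.
congr (_ + _); under eq_bigr => l _ do rewrite scaler_sumr.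
rewrite exchange_big scaler_sumr; apply: eq_bigr => i _.
rewrite scalerA mulrC -scalerA; congr (_ *: _); rewrite scaler_sumr.
by apply: eq_bigr => l _; rewrite !scalerA; congr (_ *: _); ring.
Qed.

Lemma sum_cyc (V : nmodType) (F : 'I_3 -> V) j :
  \sum_i F i = F j + F (j + 1) + F (j + 2).
Proof.
have E12 : (1 + 2 : 'I_3) = 0 by exact: val_inj.
have E21 : (2 + 1 : 'I_3) = 0 by exact: val_inj.
have E22 : (2 + 2 : 'I_3) = 1 by exact: val_inj.
rewrite sum_ord3; case: (ord3_cases j) => ->; rewrite ?add0r//.
- by rewrite E12 -addrA addrC.
- by rewrite E21 E22 addrC addrA.
Qed.

Lemma klein_cyc j l : klein j l * klein (j + 1) l = klein (j + 2) l.
Proof.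
have E12 : (1 + 2 : 'I_3) = 0 by exact: val_inj.
have E21 : (2 + 1 : 'I_3) = 0 by exact: val_inj.
have E22 : (2 + 2 : 'I_3) = 1 by exact: val_inj.
case: (ord3_cases j) => ->; rewrite ?add0r ?E12 ?E21 ?E22;
by case: l => -[] []; rewrite /klein /= ?expr0 ?expr1; ring.
Qed.

Lemma krot_g_cyc q j : krot q *m g j = q 0 *: g j + (q (lift 0 j) *: (J j *m g0) +
   q (lift 0 (j + 1)) *: (J (j + 1) *m g (j + 2)) +
   q (lift 0 (j + 2)) *: (J (j + 2) *m g (j + 1))).
Proof.
have kl l : klein (j + 2) l * klein j l = klein (j + 1) l.
  by rewrite -klein_cyc mulrC mulrA -expr2 klein_sq mul1r.
rewrite krot_g (sum_cyc _ j); congr (_ + (_ *: _ + _ *: _ + _ *: _)).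
- rewrite [in RHS]uline_sum -scalemxAr mulmx_sumr; congr (_ *: _).
  by apply: eq_bigr => l _; rewrite -expr2 klein_sq scale1r.
- rewrite [in RHS]uline_sumi -scalemxAr mulmx_sumr; congr (_ *: _).
  by apply: eq_bigr => l _; rewrite -scalemxAr mulrC klein_cyc.
- rewrite [in RHS]uline_sumi -scalemxAr mulmx_sumr; congr (_ *: _).
  by apply: eq_bigr => l _; rewrite -scalemxAr kl.
Qed.

(** The rotations act on the span of [xi] as right multiplications by
   quaternions. *)
Lemma krot_xi q j : krot q *m xi (lift 0 j) = q 0 *: xi (lift 0 j)
   - q (lift 0 j) *: xi 0 + q (lift 0 (j + 1)) *: xi (lift 0 (j + 2))
   - q (lift 0 (j + 2)) *: xi (lift 0 (j + 1)).
Proof.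
rewrite !xiS xi0 mulmxA rotation_comm// -mulmxA krot_g_cyc.
rewrite !mulmxDr -!scalemxAr !mulmxA JJ_sq//.
have [_ _ -> _] := cJ j.
have -> : J j *m J (j + 2) = - J (j + 1).
  have [_ _ _] := cJ (j + 2); rewrite (_ : j + 2 + 1 = j); last first.
    by rewrite -addrA (_ : 2 + 1 = 0 :> 'I_3) ?addr0//; exact: val_inj.
  by rewrite (_ : j + 2 + 2 = j + 1)// -addrA (_ : 2 + 2 = 1 :> 'I_3)//; exact: val_inj.
by rewrite !mulNmx mul1mx !scalerN !addrA.
Qed.

Lemma krot_xi0 q : krot q *m xi 0 = \sum_k q k *: xi k.
Proof.
rewrite xi0 krot_g0 sum_ord4 xi0; congr (_ + _).
by apply: eq_bigr => i _; rewrite xiS.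
Qed.

Lemma krot_span q (x : 'I_4 -> R) :
  exists y : 'I_4 -> R, krot q *m (\sum_k x k *: xi k) = \sum_k y k *: xi k.
Proof.
suff H k : exists y : 'I_4 -> R, krot q *m xi k = \sum_l y l *: xi l.
  have [y Hy] := choice H.
  exists (fun l => \sum_k x k * y k l); rewrite mulmx_sumr.
  under eq_bigr => k _ do rewrite -scalemxAr Hy scaler_sumr.
  rewrite exchange_big; apply: eq_bigr => l _.
  by rewrite scaler_suml; apply: eq_bigr => k _; rewrite scalerA.
case: (unliftP 0 k) => [j|] ->; last by exists q; exact: krot_xi0.
exists (fun l => q 0 * (l == lift 0 j)%:R - q (lift 0 j) * (l == 0)%:R
  + q (lift 0 (j + 1)) * (l == lift 0 (j + 2))%:R
  - q (lift 0 (j + 2)) * (l == lift 0 (j + 1))%:R).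
have sel k0 a : a *: xi k0 = \sum_l (a * (l == k0)%:R) *: xi l.
  rewrite (bigD1 k0)//= eqxx mulr1 big1 ?addr0// => l /negbTE ->.
  by rewrite mulr0 scale0r.
rewrite krot_xi !sel -sumrN -big_split -big_split -sumrN -big_split.
by apply: eq_bigr => l _; rewrite !scalerDl !scaleNr.
Qed.

Lemma dot_xi k l : dot (xi k) (xi l) = (k == l)%:R.
Proof.
have d0 i : dot (xi 0) (xi (lift 0 i)) = 0.
  by rewrite xi0 xiS dotC dot_J// -[LHS]opprK opprK -dot_J// ri0.
case: (unliftP 0 k) => [i|] ->; case: (unliftP 0 l) => [j|] ->.
- rewrite !xiS (inj_eq lift_inj).
  have E12 : (1 + 2 : 'I_3) = 0 by exact: val_inj.
  have JJd (a b k0 : 'I_3) (s : bool) : J a *m J b = (-1) ^+ s *: J k0 ->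
      dot (J a *m g a) (J b *m g b) = 0.
    move=> H; rewrite dot_J// mulmxA H -scalemxAl dotZr.
    by rewrite dotC rij mulr0 oppr0.
  have [->|ij] := eqVneq i j; first by rewrite dot_JJ// gii.
  move: ij; case: (ord3_cases i) => ->; case: (ord3_cases j) => -> // _.
  + by apply: (JJd _ _ 2 false); rewrite JJ01// scale1r.
  + by apply: (JJd _ _ 1 true); rewrite JJ02// scaleN1r.
  + by apply: (JJd _ _ 2 true); rewrite JJ10// scaleN1r.
  + by apply: (JJd _ _ 0 false); rewrite JJ12// scale1r.
  + by apply: (JJd _ _ 1 false); rewrite JJ20// scale1r.
  + by apply: (JJd _ _ 0 true); rewrite JJ21// scaleN1r.
- by rewrite dotC d0.
- by rewrite d0.
- by rewrite xi0 g00.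
Qed.

(** The compressions of [J_i] to the span of [xi] are [c i] times left
   multiplications by the quaternion units. *)
Lemma dot_Jxi0 i j : dot (J i *m xi 0) (xi (lift 0 j)) = c i * (i == j)%:R.
Proof.
rewrite xi0 xiS.
have JJd (a b k0 : 'I_3) (s : bool) : J a *m J b = (-1) ^+ s *: J k0 ->
    dot (J a *m g0) (J b *m g b) = 0.
  move=> H; rewrite dot_J// mulmxA H -scalemxAl dotZr dotC ri0.
  by rewrite mulr0 oppr0.
have [->|ij] := eqVneq i j; first by rewrite dot_JJ// g0i mulr1.
rewrite mulr0; move: ij; case: (ord3_cases i) => ->; case: (ord3_cases j) => -> // _.
+ by apply: (JJd _ _ 2 false); rewrite JJ01// scale1r.
+ by apply: (JJd _ _ 1 true); rewrite JJ02// scaleN1r.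
+ by apply: (JJd _ _ 2 true); rewrite JJ10// scaleN1r.
+ by apply: (JJd _ _ 0 false); rewrite JJ12// scale1r.
+ by apply: (JJd _ _ 1 false); rewrite JJ20// scale1r.
+ by apply: (JJd _ _ 0 true); rewrite JJ21// scaleN1r.
Qed.

Lemma dot_Jxi i : dot (J i *m xi (lift 0 (i + 1))) (xi (lift 0 (i + 2))) = c i.
Proof.
have [_ _ JJ1 _] := cJ i.
rewrite !xiS mulmxA JJ1 dot_JJ//.
have -> : i + 2 = i + 1 + 1 by rewrite -addrA; congr (_ + _); exact: val_inj.
rewrite gij; congr c; rewrite -addrA (_ : 1 + 2 = 0 :> 'I_3) ?addr0//.
exact: val_inj.
Qed.

Lemma ord3_cyc (i : 'I_3) : [/\ i + 1 + 1 = i + 2, i + 1 + 2 = i, i + 2 + 1 = i & i + 2 + 2 = i + 1].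
Proof. by case: (ord3_cases i) => ->; split; exact: val_inj. Qed.

Lemma ord3_neq (i : 'I_3) : [/\ (i == i + 1) = false, (i == i + 2) = false & (i + 1 == i + 2) = false].
Proof. by case: (ord3_cases i) => ->; split. Qed.

Lemma dot_xi_Jsum i (x : 'I_4 -> R) : let y := J i *m \sum_k x k *: xi k in
  [/\ dot y (xi 0) = - (c i * x (lift 0 i)),
      dot y (xi (lift 0 i)) = c i * x 0,
      dot y (xi (lift 0 (i + 1))) = - (c i * x (lift 0 (i + 2))) &
      dot y (xi (lift 0 (i + 2))) = c i * x (lift 0 (i + 1))].
Proof.
have [n1 n2 n3] := ord3_neq i.
have Jii k : dot (J i *m xi k) (xi k) = 0 by exact: dot_Jxx.
have sw k l : dot (J i *m xi k) (xi l) = - dot (J i *m xi l) (xi k).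
  by rewrite dot_J// dotC.
have z j : i != j -> dot (J i *m xi 0) (xi (lift 0 j)) = 0.
  by move=> /negbTE ij; rewrite dot_Jxi0 ij mulr0.
have zi j : i != j -> dot (J i *m xi (lift 0 i)) (xi (lift 0 j)) = 0.
  move=> ij; rewrite !xiS mulmxA JJ_sq// mulNmx mul1mx dotNl dotC rij; exact: oppr0.
have e y : y = J i *m \sum_k x k *: xi k -> forall l, dot y (xi l) =
    x 0 * dot (J i *m xi 0) (xi l) +
    (x (lift 0 i) * dot (J i *m xi (lift 0 i)) (xi l) +
     x (lift 0 (i + 1)) * dot (J i *m xi (lift 0 (i + 1))) (xi l) +
     x (lift 0 (i + 2)) * dot (J i *m xi (lift 0 (i + 2))) (xi l)).
  move=> -> l; rewrite sum_ord4 (sum_cyc _ i) !mulmxDr -!scalemxAr.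
  by rewrite !dotDl !dotZl.
move=> y; split; rewrite (e y erefl).
- rewrite Jii (sw _ 0) dot_Jxi0 eqxx (sw (lift 0 (i + 1)) 0) (sw (lift 0 (i + 2)) 0).
  by rewrite !z ?n1 ?n2// (mulr1 (c i)); ring.
- rewrite Jii dot_Jxi0 eqxx (sw _ (lift 0 i)) zi ?n1// (sw _ (lift 0 i)) zi ?n2//.
  by rewrite (mulr1 (c i)); ring.
- rewrite z ?n1// zi ?n1// Jii (sw (lift 0 (i + 2))) dot_Jxi; ring.
- rewrite z ?n2// zi ?n2// Jii dot_Jxi; ring.
Qed.

(** Left multiplications by distinct quaternion units send a vector to
   orthogonal vectors. *)
Lemma dot_compression i j (x : 'I_4 -> R) : \sum_k x k ^+ 2 = 1 ->
  \sum_k dot (J i *m \sum_k x k *: xi k) (xi k) *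
          dot (J j *m \sum_k x k *: xi k) (xi k) = c i ^+ 2 * (i == j)%:R.
Proof.
move=> x1; have [n1 n2 n3] := ord3_neq i; have [c1 c2 c3 c4] := ord3_cyc i.
have := dot_xi_Jsum i x; set yi := J i *m _ => -[a0 a1 a2 a3].
have [->|ij] := eqVneq j i.
  rewrite sum_ord4 (sum_cyc _ i) a0 a1 a2 a3 mulr1 -[RHS]mulr1 -x1 sum_ord4.
  rewrite (sum_cyc _ i); ring.
rewrite mulr0.
have := dot_xi_Jsum j x; set yj := J j *m _.
have : j = i + 1 \/ j = i + 2.
  by move: ij; case: (ord3_cases i) => ->; case: (ord3_cases j) => -> // _;
    (by left; exact: val_inj) || (by right; exact: val_inj).
rewrite sum_ord4 (sum_cyc _ i) a0 a1 a2 a3.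
clearbody yj; case=> ->; rewrite ?c1 ?c2 ?c3 ?c4 => -[-> -> -> ->]; ring.
Qed.

End KahlerSubspace.

Section Admissible.
Context {R : realType} {m : nat} (J : 'I_3 -> 'M[R]_m) (cJ : canonical_basis J).
Context (phi : 'I_3 -> R).
Hypotheses (phi0 : 0 < phi 0) (phi01 : phi 0 <= phi 1) (phi12 : phi 1 <= phi 2)
  (phi2 : phi 2 <= pi / 2) (phi_sum : cos (phi 0) + cos (phi 1) < 1 + cos (phi 2)).

Lemma phi_range i : 0 < phi i <= pi / 2.
Proof.
have p := pi_gt0 R.
move: phi0 phi01 phi12 phi2 p; case: (ord3_cases i) => ->;
  move: (phi 0) (phi 1) (phi 2) (pi / 2) => x y z t *; apply/andP; split; lra.
Qed.

Lemma sin_phi_gt0 i : 0 < sin (phi i).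
Proof.
have p := pi_gt0 R; have /andP[a b] := phi_range i.
by apply: sin_gt0_pi; apply/andP; split; lra.
Qed.

Lemma cos_phi_le (i j : 'I_3) : phi i <= phi j -> cos (phi j) <= cos (phi i).
Proof.
have p := pi_gt0 R; have /andP[a b] := phi_range i; have /andP[a' b'] := phi_range j.
move=> ij; rewrite leNgt; apply/negP; rewrite ltr_cos; last 2 first.
- by rewrite in_itv /=; apply/andP; split; lra.
- by rewrite in_itv /=; apply/andP; split; lra.
- by rewrite ltNge ij.
Qed.

Lemma cos_phi_lt1 i : cos (phi i) < 1.
Proof.
have s := sin_phi_gt0 i; have := cos2Dsin2 (phi i).
have := cos_le1 (phi i); rewrite le_eqVlt => /orP[/eqP ->|//].
by have := exprn_gt0 2 s; lra.
Qed.

Lemma cos_phi_pos : let c i := cos (phi i) in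
  [/\ 0 < 1 + c 0 + c 1 + c 2, 0 < 1 + c 0 - c 1 - c 2,
      0 < 1 - c 0 + c 1 - c 2 & 0 < 1 - c 0 - c 1 + c 2].
Proof.
have c01 := cos_phi_le phi01; have c12 := cos_phi_le phi12.
have l0 := cos_phi_lt1 0.
have c_ge0 i : 0 <= cos (phi i).
  have p := pi_gt0 R; have /andP[a b] := phi_range i.
  by apply: cos_ge0_pihalf; apply/andP; split; lra.
move: c01 c12 l0 (c_ge0 0) (c_ge0 1) (c_ge0 2) phi_sum => /=.
by move: (cos (phi 0)) (cos (phi 1)) (cos (phi 2)) => x y z *; split; lra.
Qed.

Definition gvec (e : 'I_4 -> 'cV[R]_m) (i : 'I_3) : 'cV[R]_m :=
  cos (phi i) *: e 0 + sin (phi i) *: e (lift 0 i).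

Lemma xi_vectorE e : xi_vector J phi e = xi J (e 0) (gvec e).
Proof.
apply/funext => k; rewrite /xi_vector /xi; case: (unliftP 0 k) => [i ->|//].
by rewrite /gvec mulmxDr -!scalemxAr.
Qed.

(** Passing from [e] to [gvec e] undoes the division by the sines: the inner
   products become the cosines themselves. *)
Lemma admissible_gram e : admissible_vectors J phi e ->
  [/\ dot (e 0) (e 0) = 1, forall i, dot (gvec e i) (gvec e i) = 1,
      forall i, dot (e 0) (gvec e i) = cos (phi i) &
      forall i, dot (gvec e i) (gvec e (i + 1)) = cos (phi (i + 2))] /\
  [/\ forall k, dot (J k *m e 0) (e 0) = 0,
      forall k i, dot (J k *m e 0) (gvec e i) = 0 &
      forall k i j, dot (J k *m gvec e i) (gvec e j) = 0].
Proof.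
move=> [W [[dW trW bW] e1 e0i eij]].
have eW k : e k \in W.
  by apply: (basis_mem bW); rewrite -(tnth_mktuple e k); exact: mem_tnth.
have gW i : gvec e i \in W by apply: memvD; apply: memvZ; exact: eW.
split; split.
- exact: e1.
- move=> i; rewrite !(dotDl, dotDr, dotZl, dotZr) !e1 [dot (e (lift _ _)) _]dotC !e0i.
  by have := cos2Dsin2 (phi i); lra.
- by move=> i; rewrite !(dotDr, dotZr) e1 e0i mulr1 mulr0 addr0.
- move=> i; rewrite !(dotDl, dotDr, dotZl, dotZr) !e1 [dot (e (lift _ _)) (e 0)]dotC.
  rewrite !e0i eij.
  have s1 := sin_phi_gt0 i; have s2 := sin_phi_gt0 (i + 1).
  by field; rewrite !gt_eqF.
- by move=> k; exact: trW.
- by move=> k i; exact: trW.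
- by move=> k i j; exact: trW.
Qed.

Lemma mem_wperp e x : reflect (exists a, x = \sum_k a k *: xi J (e 0) (gvec e) k)
  (x \in wperp J phi e).
Proof.
apply: (iffP idP) => [/coord_span xE|[a ->]].
  exists (fun k => coord [tuple xi_vector J phi e k | k < 4] k x).
  rewrite {1}xE; apply: eq_bigr => k _; congr (_ *: _).
  by rewrite -tnth_nth tnth_mktuple xi_vectorE.
apply: memv_suml => k _; apply: memvZ; apply: memv_span.
rewrite -xi_vectorE -(tnth_mktuple (xi_vector J phi e) k); exact: mem_tnth.
Qed.

(** ** Existence of admissible vectors *)

Lemma orthogonal_vector n (a : 'I_n -> 'cV[R]_m) : (n < m)%N ->
  exists x : 'cV[R]_m, dot x x = 1 /\ forall k, dot (a k) x = 0.
Proof.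
move=> nm; pose A := \matrix_(k < n) (a k)^T.
have : kermx A^T != 0.
  rewrite -mxrank_eq0 mxrank_ker mxrank_tr subn_eq0 -ltnNge.
  exact: leq_ltn_trans (rank_leq_row A) nm.
move=> /matrix0Pn [i [j ij0]]; pose y := (row i (kermx A^T))^T.
have y0 : y != 0.
  apply/eqP => /matrixP/(_ j 0); rewrite /y [LHS]mxE [LHS]mxE [RHS]mxE => y0.
  by move: ij0; rewrite y0 eqxx.
have ay k : dot (a k) y = 0.
  have : A *m y = 0.
    by rewrite -[A]trmxK -trmx_mul -row_mul mulmx_ker row0 trmx0.
  move=> /matrixP/(_ k 0); rewrite [LHS]mxE [RHS]mxE => <-.
  by apply: eq_bigr => l _; rewrite [A k l]mxE [(a k)^T _ _]mxE.
have N0 : 0 < dot y y.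
  rewrite lt_neqAle dot_ge0 andbT eq_sym; apply/eqP => /dot_eq0 /eqP; exact/negP.
exists ((Num.sqrt (dot y y))^-1 *: y); split.
  rewrite dotZl dotZr mulrA -invfM -expr2 sqr_sqrtr ?ltW// mulVf// gt_eqF//.
by move=> k; rewrite dotZr ay mulr0.
Qed.

(** Each vector is taken orthogonal to the quaternionic lines of the preceding
   ones, which together span at most 4k dimensions. *)
Lemma quaternionic_orthonormal k : (4 * k <= m)%N ->
  exists f : 'I_k -> 'cV[R]_m, (forall i j, dot (f i) (f j) = (i == j)%:R) /\
    forall l i j, dot (J l *m f i) (f j) = 0.
Proof.
elim: k => [|k IH] km; first by exists (fun _ => 0); split=> [[]|l []].
have [f [fo fr]] := IH (leq_trans (leq_mul (leqnn 4) (leqnSn k)) km).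
pose a (p : 'I_#|{: option 'I_3 * 'I_k}|) : 'cV[R]_m :=
  let p' := enum_val p in
  if p'.1 is Some l then J l *m f p'.2 else f p'.2.
have [|x [x1 ax]] := @orthogonal_vector _ a.
  by rewrite card_prod card_option !card_ord; rewrite mulnS in km;
  by apply: leq_trans km; rewrite -add1n leq_add2r.
have fx i : dot (f i) x = 0.
  by have := ax (enum_rank (None, i)); rewrite /a enum_rankK.
have Jfx l i : dot (J l *m f i) x = 0.
  by have := ax (enum_rank (Some l, i)); rewrite /a enum_rankK.
have Jxf l i : dot (J l *m x) (f i) = 0.
  by rewrite dotC -[RHS]oppr0 -(Jfx l i) dot_J// opprK.
exists (fun i => if unlift 0 i is Some j then f j else x); split.
- move=> i j; case: (unliftP 0 i) => [i'|] ->; case: (unliftP 0 j) => [j'|] ->.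
  + by rewrite fo (inj_eq lift_inj).
  + by rewrite fx.
  + by rewrite dotC fx.
  + by rewrite x1.
- move=> l i j; case: (unliftP 0 i) => [i'|] _; case: (unliftP 0 j) => [j'|] _ //.
  exact: dot_Jxx.
Qed.

(** The Gram matrix of [e_0] and the [gvec e i] is diagonalised by the characters
   of the Klein four-group, with the eigenvalues [lam l], which the condition
   on the cosines makes positive. Their square roots are the coordinates of the
   vectors in four quaternionically orthonormal ones. *)
Lemma admissible_exists : (16 <= m)%N ->
  exists e : 'I_4 -> 'cV[R]_m, admissible_vectors J phi e.
Proof.
move=> m16; have [f0 [f0o f0r]] := @quaternionic_orthonormal 4 m16.
have c4 : #|{: bool * bool}| = 4%N by rewrite card_prod !card_bool.
pose f (l : bool * bool) := f0 (cast_ord c4 (enum_rank l)).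
have fo l l' : dot (f l) (f l') = (l == l')%:R.
  by rewrite /f f0o (inj_eq (@cast_ord_inj _ _ _)) (inj_eq enum_rank_inj).
have fr k l l' : dot (J k *m f l) (f l') = 0 by exact: f0r.
pose c i := cos (phi i); pose s i := sin (phi i).
have s0 i : s i != 0 by rewrite gt_eqF// sin_phi_gt0.
pose lam l := 1 + \sum_i klein i l * c i.
have lam0 l : 0 < lam l.
  rewrite /lam /c sum_ord3; have := cos_phi_pos => /=.
  move: (cos (phi 0)) (cos (phi 1)) (cos (phi 2)) => x y z [].
  by case: l => -[] []; rewrite /klein /= ?expr0 ?expr1; lra.
pose mu l := Num.sqrt (lam l).
have mu2 l : mu l * mu l = lam l by rewrite -expr2 sqr_sqrtr// ltW.
pose e (k : 'I_4) := if unlift 0 k is Some i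
  then (2 * s i)^-1 *: \sum_l ((klein i l - c i) * mu l) *: f l
  else 2^-1 *: \sum_l mu l *: f l.
have dotf (a b : bool * bool -> R) : dot (\sum_l a l *: f l) (\sum_l b l *: f l) =
    \sum_l a l * b l.
  rewrite (linear_sumE _ _ _ (@dot_linearl _ _ _)); apply: eq_bigr => l _.
  rewrite (linear_sumE _ _ _ (@dot_linearr _ _ _)) (bigD1 l)//= fo eqxx.
  rewrite big1 ?addr0; last by move=> l' ll'; rewrite fo eq_sym (negbTE ll') scaler0.
  by rewrite [b l *: _]mulr1.
have e0E : e 0 = 2^-1 *: \sum_l mu l *: f l by rewrite /e unlift_none.
have eiE i : e (lift 0 i) = (2 * s i)^-1 *: \sum_l ((klein i l - c i) * mu l) *: f l.
  by rewrite /e liftK.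
have cs i : c i ^+ 2 + s i ^+ 2 = 1 by exact: cos2Dsin2.
have d00 : dot (e 0) (e 0) = 1.
  rewrite e0E dotZl dotZr dotf; under eq_bigr => l _ do rewrite mu2.
  rewrite sum_klein /lam !sum_ord3 /klein /= ?expr0 ?expr1; by field.
have dij i j : dot (e (lift 0 i)) (e (lift 0 j)) =
    (4 * s i * s j)^-1 * \sum_l (klein i l - c i) * (klein j l - c j) * lam l.
  rewrite !eiE dotZl dotZr dotf !mulr_sumr; apply: eq_bigr => l _.
  by rewrite -mu2; field; rewrite !s0.
have dii i : dot (e (lift 0 i)) (e (lift 0 i)) = 1.
  rewrite dij sum_klein /lam !sum_ord3; have := cs i.
  have := s0 i; case: (ord3_cases i) => ->; rewrite /klein /= ?expr0 ?expr1.
  - move=> s00 E0; rewrite (_ : _ + _ = 4 * (1 - c 0 ^+ 2)); last by ring.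
    by have -> : 1 - c 0 ^+ 2 = s 0 ^+ 2; [rewrite -E0; ring | field].
  - move=> s00 E0; rewrite (_ : _ + _ = 4 * (1 - c 1 ^+ 2)); last by ring.
    by have -> : 1 - c 1 ^+ 2 = s 1 ^+ 2; [rewrite -E0; ring | field].
  - move=> s00 E0; rewrite (_ : _ + _ = 4 * (1 - c 2 ^+ 2)); last by ring.
    by have -> : 1 - c 2 ^+ 2 = s 2 ^+ 2; [rewrite -E0; ring | field].
have d0i i : dot (e 0) (e (lift 0 i)) = 0.
  rewrite e0E eiE dotZl dotZr dotf.
  rewrite (eq_bigr (fun l => (klein i l - c i) * lam l)); last first.
    by move=> l _; rewrite mulrC -mulrA mu2.
  rewrite sum_klein /lam !sum_ord3.
  case: (ord3_cases i) => ->; rewrite /klein /= ?expr0 ?expr1;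
  by rewrite (_ : _ + _ = 0) ?mulr0//; ring.
have dic i : dot (e (lift 0 i)) (e (lift 0 (i + 1))) =
    (c (i + 2) - c i * c (i + 1)) / (s i * s (i + 1)).
  rewrite dij.
  rewrite (_ : \sum_l _ = 4 * (c (i + 2) - c i * c (i + 1))).
    by have := s0 i; have := s0 (i + 1); move=> ? ?; field; apply/andP.
  have [c1 c2 c3 c4'] := ord3_cyc i.
  rewrite sum_klein /lam !sum_ord3.
  have E12 : (1 + 2 : 'I_3) = 0 by exact: val_inj.
  have E21 : (2 + 1 : 'I_3) = 0 by exact: val_inj.
  have E22 : (2 + 2 : 'I_3) = 1 by exact: val_inj.
  case: (ord3_cases i) => ->; rewrite ?add0r ?E12 ?E21 ?E22;
  by rewrite /klein /= ?expr0 ?expr1; ring.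
exists e.
pose W : {vspace 'cV[R]_m} := (<<[tuple e k | k < 4]>>)%VS.
exists W.
have eW k : e k \in W.
  by apply: memv_span; rewrite -(tnth_mktuple e k); exact: mem_tnth.
have eF k : exists a, e k = \sum_l a l *: f l.
  case: (unliftP 0 k) => [i|] ->.
    exists (fun l => (2 * s i)^-1 * ((klein i l - c i) * mu l)); rewrite eiE scaler_sumr.
    by apply: eq_bigr => l _; rewrite scalerA.
  exists (fun l => 2^-1 * mu l); rewrite e0E scaler_sumr.
  by apply: eq_bigr => l _; rewrite scalerA.
have WE x : x \in W -> exists a, x = \sum_k a k *: e k.
  move=> /coord_span xE; exists (fun k => coord [tuple e k | k < 4] k x).
  rewrite {1}xE; apply: eq_bigr => k _; congr (_ *: _).
  by rewrite -tnth_nth tnth_mktuple.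
have fW l : f l \in W.
  have -> : f l = (2 * mu l)^-1 *: (e 0 + \sum_i klein i l *: (c i *: e 0 + s i *: e (lift 0 i))).
    have seE i : s i *: e (lift 0 i) = 2^-1 *: \sum_l ((klein i l - c i) * mu l) *: f l.
      by rewrite eiE scalerA; congr (_ *: _); field.
    have m0 : mu l != 0 by rewrite gt_eqF// sqrtr_gt0.
    under eq_bigr => i _ do rewrite seE e0E.
    rewrite e0E sum_ord3 !sum_klein.
    move: m0; case: l => -[] [] m0; rewrite /klein /= ?expr0 ?expr1;
    by apply/colP => j; rewrite !mxE; field.
  by apply: memvZ; apply: memvD => //; apply: memv_suml => i _; apply: memvZ;
    apply: memvD; apply: memvZ.
have free_e : free [tuple e k | k < 4].
  pose F := [tuple f0 k | k < 4].
  have freeF : free F.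
    apply/freeP => a a0 i.
    have FE (k : 'I_4) : F`_k = f0 k by rewrite -tnth_nth tnth_mktuple.
    have : dot (\sum_(k < 4) a k *: F`_k) (f0 i) = a i.
      under eq_bigr => k _ do rewrite FE.
      rewrite (linear_sumE _ _ _ (@dot_linearl _ _ _)) (bigD1 i)//=.
      rewrite f0o eqxx big1 ?addr0 ?[_ *: _]mulr1// => k ki.
      by rewrite f0o (negbTE ki) scaler0.
    by rewrite a0 dot0l.
  have FW : (<<F>> <= W)%VS.
    apply/span_subvP => x /mapP [k _ ->].
    have -> : f0 k = f (enum_val (cast_ord (esym c4) k)).
      by rewrite /f enum_valK cast_ordKV.
    exact: fW.
  rewrite /free eqn_leq dim_span andTb; apply: leq_trans (dimvS FW).
  by move: freeF; rewrite /free => /eqP ->; rewrite !size_tuple leqnn.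
split; [split| |exact: d0i|exact: dic].
- by move: free_e; rewrite /free size_tuple => /eqP.
- move=> j x y /WE [a ->] /WE [b ->].
  rewrite mulmx_sumr (big_morph (dot^~ _) (fun x y => dotDl x y _) (dot0l _)) big1// => k _.
  rewrite (big_morph (dot _) (fun x y => dotDr x y _) (dot0r _)) big1// => k' _.
  rewrite -scalemxAr dotZl dotZr; have [a' ->] := eF k; have [b' ->] := eF k'.
  rewrite mulmx_sumr (big_morph (dot^~ _) (fun x y => dotDl x y _) (dot0l _)) big1 ?mulr0// => l _.
  rewrite (big_morph (dot _) (fun x y => dotDr x y _) (dot0r _)) big1// => l' _.
  by rewrite -scalemxAr dotZl dotZr fr !mulr0.
- by apply/andP; split=> //; rewrite eqxx.
- by move=> k; case: (unliftP 0 k) => [i|] ->.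
Qed.

End Admissible.

(** * Symmetries of [w_perp] *)

Section RotationPaths.
Context {R : realType} {m : nat} (J : 'I_3 -> 'M[R]_m) (cJ : canonical_basis J).

Lemma Ck_mulmx (D : normedModType R) k (A : 'M[R]_m) (x : D -> 'cV[R]_m) :
  Ck k setT x -> Ck k setT (fun t => A *m x t).
Proof.
move=> cx; have lA : linear (mulmx A : 'cV[R]_m -> 'cV[R]_m).
  by move=> a y z; rewrite mulmxDr scalemxAr.
exact: (Ck_linear (framed_cV m) lA cx).
Qed.

Lemma Ck_quat (D : normedModType R) k (c : D -> R) (b : 'I_3 -> D -> R)
    (x : D -> 'cV[R]_m) :
  Ck k setT c -> (forall i, Ck k setT (b i)) -> Ck k setT x ->
  Ck k setT (fun t => quat J (c t) (b^~ t) *m x t).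
Proof.
move=> cc cb cx; apply: (@Ck_ext _ _ _ _ _ _ (fun t => quatE J (c t) (b^~ t) (x t))).
apply: Ck_add; first exact: Ck_scale.
by apply: Ck_sum => i; apply: Ck_scale; [exact: cb | exact: Ck_mulmx].
Qed.

Lemma Ck_line (D : normedModType R) k (u : 'cV[R]_m) (c : D -> R)
    (b : 'I_3 -> D -> R) (x : D -> 'cV[R]_m) :
  Ck k setT c -> (forall i, Ck k setT (b i)) -> Ck k setT x ->
  Ck k setT (fun t => line J u (quat J (c t) (b^~ t)) *m x t).
Proof.
move=> cc cb cx.
have cu : Ck k setT (fun t => quat J (c t) (b^~ t) *m u).
  by apply: Ck_quat => //; exact: Ck_cst.
have E0 t : line J u (quat J (c t) (b^~ t)) *m x t =
    (dot u u)^-1 *: (dot u (x t) *: (quat J (c t) (b^~ t) *m u) +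
    \sum_i dot (J i *m u) (x t) *: (J i *m (quat J (c t) (b^~ t) *m u))).
  by rewrite /line -scalemxAl average_outer.
apply: (Ck_ext E0).
have cd (y : 'cV[R]_m) : Ck k setT (fun t => dot y (x t)).
  by apply: Ck_dot => //; exact: Ck_cst.
apply: Ck_scale; first exact: Ck_cst.
apply: Ck_add; first by apply: Ck_scale; [exact: cd | exact: cu].
by apply: Ck_sum => i; apply: Ck_scale; [exact: cd | exact: Ck_mulmx].
Qed.

Lemma Ck_rotation (D : normedModType R) k (I : finType) (u : I -> 'cV[R]_m)
    (eps : 'I_3 -> I -> R) (c : D -> R) (b : 'I_3 -> D -> R) (x : D -> 'cV[R]_m) :
  Ck k setT c -> (forall i, Ck k setT (b i)) -> Ck k setT x ->
  Ck k setT (fun t => rotation J u eps (c t) (b^~ t) *m x t).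
Proof.
move=> cc cb cx.
have E0 t : rotation J u eps (c t) (b^~ t) *m x t = x t +
    \sum_l line J (u l) (quat J (c t - 1) (fun i => b i t * eps i l)) *m x t.
  by rewrite /rotation mulmxDl mul1mx mulmx_suml.
apply: (Ck_ext E0); apply: Ck_add => //; apply: Ck_sum => l.
apply: (@Ck_line D k (u l) (fun t => c t - 1) (fun i t => b i t * eps i l) x) => //.
  by apply: Ck_sub => //; exact: Ck_cst.
by move=> i; apply: Ck_mul; [exact: cb | exact: Ck_cst].
Qed.

End RotationPaths.

Section SubspaceSymmetries.
Context {R : realType} {m : nat} (J : 'I_3 -> 'M[R]_m) (cJ : canonical_basis J).
Context (phi : 'I_3 -> R).
Hypotheses (phi0 : 0 < phi 0) (phi01 : phi 0 <= phi 1) (phi12 : phi 1 <= phi 2)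
  (phi2 : phi 2 <= pi / 2) (phi_sum : cos (phi 0) + cos (phi 1) < 1 + cos (phi 2)).
Context (e : 'I_4 -> 'cV[R]_m) (adm : admissible_vectors J phi e).

Notation Wp := (wperp J phi e).
Notation xi := (xi J (e 0) (gvec phi e)).
Let gram := admissible_gram phi0 phi01 phi12 phi2 adm.

Lemma xi_ortho k l : dot (xi k) (xi l) = (k == l)%:R.
Proof. by case: gram => -[? ? ? ?] [? ? ?]; exact: dot_xi. Qed.

Lemma span_coord (a : 'I_4 -> R) l : dot (\sum_k a k *: xi k) (xi l) = a l.
Proof.
rewrite (linear_sumE _ _ _ (@dot_linearl _ _ _)) (bigD1 l)//= xi_ortho eqxx.
rewrite [_ *: _]mulr1 big1 ?addr0// => k kl.
by rewrite xi_ortho (negbTE kl) scaler0.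
Qed.

Lemma span_dot (a b : 'I_4 -> R) :
  dot (\sum_k a k *: xi k) (\sum_k b k *: xi k) = \sum_k a k * b k.
Proof.
rewrite (linear_sumE _ _ _ (@dot_linearr _ _ _)); apply: eq_bigr => k _.
by rewrite span_coord [LHS]mulrC.
Qed.

Lemma xi_mem k : xi k \in Wp.
Proof.
apply/mem_wperp; exists (fun l => (l == k)%:R).
rewrite (bigD1 k)//= eqxx scale1r big1 ?addr0// => l /negbTE ->.
by rewrite scale0r.
Qed.

Lemma wperp_sphereP x : unit_sphere Wp x <->
  exists a, \sum_k a k ^+ 2 = 1 /\ x = \sum_k a k *: xi k.
Proof.
split=> [[/mem_wperp [a ->]]|[a [a1 ->]]].
  by rewrite span_dot => a1; exists a; split.
by split; [apply/mem_wperp; exists a | rewrite span_dot].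
Qed.

(** At each unit vector the quadratic form is already diagonal in the basis
   Z_1, Z_2, Z_3, with the entries cos^2 phi_i. *)
Lemma kahler_wperp : constant_kahler_angle J Wp phi.
Proof.
move=> x /wperp_sphereP [a [a1 xE]].
have pr := phi_range phi0 phi01 phi12 phi2.
split; [exact: ltW| exact: phi01| exact: phi12| exact: phi2|].
exists (fun i => \sum_k dot (J i *m x) (xi k) *: xi k); split.
  move=> i; split; first by apply/mem_wperp; exists (fun k => dot (J i *m x) (xi k)).
  move=> y /mem_wperp [b ->].
  rewrite (linear_sumE _ _ _ (@dot_linearr _ _ _)) big1// => k _.
  by rewrite dotBl span_coord subrr scaler0.
set M := \matrix_(i, j) _.
have ME i j : M i j = cos (phi i) ^+ 2 * (i == j)%:R.
  rewrite mxE span_dot xE; case: gram => -[h1 h2 h3 h4] [h5 h6 h7].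
  exact: (dot_compression cJ h3 h4 h6 h7).
rewrite char_poly_trig; last first.
  by apply/is_trig_mxP => i j ij; rewrite ME -val_eqE /= (ltn_eqF ij) mulr0.
by apply: eq_bigr => i _; rewrite ME eqxx mulr1.
Qed.

(** Each point of the unit sphere is reached from [xi 0] along a path of
   symmetries starting at the identity: a great circle of unit quaternions. *)
Lemma wperp_path (q : 'I_4 -> R) : \sum_k q k ^+ 2 = 1 ->
  exists F : R -> 'M[R]_m,
  [/\ continuous (fun tx : R * 'cV[R]_m => F tx.1 *m tx.2), F 0 = 1%:M,
      forall t, Sp J (F t) /\ forall x, x \in Wp -> F t *m x \in Wp &
      F 1 *m xi 0 = \sum_k q k *: xi k].
Proof.
case: gram => -[h1 h2 h3 h4] [h5 h6 h7].
have cp := cos_phi_pos phi0 phi01 phi12 phi2 phi_sum.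
move=> q1.
have q0 : -1 <= q 0 <= 1.
  rewrite -ler_norml -(@ler_pXn2r _ 2) ?nnegrE// expr1n real_normK ?num_real//.
  by rewrite -q1 sum_ord4 lerDl sumr_ge0// => i _; exact: sqr_ge0.
pose s := Num.sqrt (1 - q 0 ^+ 2).
have sq : \sum_i q (lift 0 i) ^+ 2 = 1 - q 0 ^+ 2 by rewrite -q1 sum_ord4 addrAC subrr add0r.
have s2 : s ^+ 2 = 1 - q 0 ^+ 2.
  by rewrite sqr_sqrtr// -sq sumr_ge0// => i _; exact: sqr_ge0.
(* the imaginary part of [q] is [s] times the unit vector [d], arbitrary if s = 0 *)
have [d [d1 qd]] : exists d : 'I_3 -> R, \sum_i d i ^+ 2 = 1 /\ forall i, q (lift 0 i) = s * d i.
  have [s0|s0] := eqVneq s 0.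
    exists (fun i => (i == 0)%:R); split.
      by rewrite sum_ord3 /= expr0n !addr0 expr1n.
    move=> i; rewrite s0 mul0r; apply/eqP; rewrite -sqrf_eq0.
    move/eqP: sq; rewrite -s2 s0 expr0n psumr_eq0; last by move=> *; exact: sqr_ge0.
    by move=> /allP/(_ i (mem_index_enum _)).
  exists (fun i => q (lift 0 i) / s); split; last by move=> i; field.
  under eq_bigr => i _ do rewrite exprMn.
  by rewrite -mulr_suml sq -s2 -exprMn divff// expr1n.
pose th := acos (q 0).
pose Q t (k : 'I_4) := if unlift 0 k is Some i then sin (t * th) * d i else cos (t * th).
have Q0 t : Q t 0 = cos (t * th) by rewrite /Q unlift_none.
have QS t i : Q t (lift 0 i) = sin (t * th) * d i by rewrite /Q liftK.
have Q1 t : \sum_k Q t k ^+ 2 = 1.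
  rewrite sum_ord4 Q0; under eq_bigr => i _ do rewrite QS exprMn.
  by rewrite -mulr_sumr d1 mulr1 cos2Dsin2.
exists (fun t => krot J (e 0) (gvec phi e) (Q t)); split.
- have cQ k : Ck 0 setT (fun tx : R * 'cV[R]_m => Q tx.1 k).
    have ct : Ck 0 setT (fun tx : R * 'cV[R]_m => tx.1 * th).
      apply: Ck_mul; last exact: Ck_cst.
      by move=> x _; exact: cvg_fst.
    case: (unliftP 0 k) => [i|] ->.
      apply: (@Ck_ext _ _ _ _ _ (fun tx : R * 'cV[R]_m => sin (tx.1 * th) * d i)).
        by move=> tx; rewrite QS.
      apply: Ck_mul; last exact: Ck_cst.
      by move=> x _; apply: continuous_comp; [exact: ct | exact: continuous_sin].
    apply: (@Ck_ext _ _ _ _ _ (fun tx : R * 'cV[R]_m => cos (tx.1 * th))).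
      by move=> tx; rewrite Q0.
    by move=> x _; apply: continuous_comp; [exact: ct | exact: continuous_cos].
  have c2 : Ck 0 setT (fun tx : R * 'cV[R]_m => tx.2) by move=> x _; exact: cvg_snd.
  suff c : Ck 0 setT (fun tx : R * 'cV[R]_m =>
      krot J (e 0) (gvec phi e) (Q tx.1) *m tx.2) by move=> x; exact: c.
  exact: (Ck_rotation cJ _ _ (cQ 0) (fun i => cQ (lift 0 i)) c2).
- rewrite /krot /rotation big1 ?addr0// => l _.
  rewrite Q0 mul0r cos0 subrr /line /quat big1 ?addr0; last first.
    by move=> i _; rewrite QS mul0r sin0 mul0r mul0r scale0r.
  by rewrite raddf0 mul0mx -(scale0r 0) averageZ !scale0r scaler0.
- move=> t; split; first exact: (krot_Sp cJ h1 h2 h3 h4 h5 h6 h7 cp (Q1 t)).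
  move=> x /mem_wperp [a ->].
  have [b ->] := krot_span cJ h1 h2 h3 h4 h5 h6 h7 cp (Q t) a.
  by apply/mem_wperp; exists b.
- rewrite (krot_xi0 cJ h1 h2 h3 h4 h5 h6 h7 cp) sum_ord4 Q0 mul1r acosK ?in_itv//.
  rewrite [RHS]sum_ord4; congr (_ + _); apply: eq_bigr => i _; congr (_ *: _).
  by rewrite QS mul1r sin_acos// qd.
Qed.

Definition stabilizer : set 'M[R]_m :=
  [set A | Sp J A /\ forall x, x \in Wp -> A *m x \in Wp].

Lemma Sp_tr A : Sp J A -> [/\ A \in unitmx, invmx A = A^T & Sp J A^T].
Proof.
move=> [A1 AJ]; have [uA uA'] := mulmx1_unit A1.
have AA : A *m A^T = 1%:M by rewrite (mulmx1C A1).
have iA : invmx A = A^T by rewrite -[RHS]mul1mx -(mulVmx uA') -mulmxA AA mulmx1.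
split=> //; split; first by rewrite trmxK.
move=> i; apply: trmx_inj; rewrite !trmx_mul trmxK J_tr// mulmxN mulNmx.
by rewrite AJ.
Qed.

(** A symmetry has a matrix [M] with [M M^T = 1] in the orthonormal basis [xi],
   so that its inverse preserves [w_perp] as well. *)
Lemma stabilizer_tr A : stabilizer A -> stabilizer A^T.
Proof.
move=> [sA AW]; split; first by case: (Sp_tr sA).
have coord k : exists b, A *m xi k = \sum_l b l *: xi l.
  by have /mem_wperp := AW _ (xi_mem k).
have [B HB] := choice coord; pose M := \matrix_(k < 4, l < 4) B k l.
have MM : M *m M^T = 1%:M.
  apply/matrixP => k l; rewrite !mxE -xi_ortho.
  have -> : dot (xi k) (xi l) = dot (A *m xi k) (A *m xi l).
    by rewrite !dotE trmx_mul -mulmxA [A^T *m _]mulmxA sA.1 mul1mx.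
  by rewrite !HB span_dot; apply: eq_bigr => i _; rewrite !mxE.
have MM' := mulmx1C MM.
move=> x /mem_wperp [a ->]; rewrite mulmx_sumr; apply: memv_suml => k _.
rewrite -scalemxAr; apply: memvZ.
have -> : xi k = A *m \sum_l B l k *: xi l.
  rewrite mulmx_sumr; under eq_bigr => l _ do rewrite -scalemxAr HB scaler_sumr.
  rewrite exchange_big; transitivity (\sum_l (l == k)%:R *: xi l).
    rewrite (bigD1 k)//= eqxx scale1r big1 ?addr0// => l /negbTE ->.
    by rewrite scale0r.
  apply: eq_bigr => l _; under eq_bigr => i _ do rewrite scalerA.
  rewrite -scaler_suml; congr (_ *: _).
  have : (M^T *m M) k l = (l == k)%:R by rewrite MM' mxE eq_sym.
  by rewrite mxE => <-; apply: eq_bigr => i _; rewrite !mxE.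
rewrite mulmxA sA.1 mul1mx; apply: memv_suml => l _; apply: memvZ; exact: xi_mem.
Qed.

Lemma stabilizer_group : matrix_group stabilizer.
Proof.
split.
- by split; [split; [rewrite trmx1 mulmx1|move=> i; rewrite mul1mx mulmx1] | move=> x; rewrite mul1mx].
- move=> A B [[A1 AJ] AW] [[B1 BJ] BW]; split; [split|].
  + by rewrite trmx_mul -mulmxA [A^T *m _]mulmxA A1 mul1mx.
  + by move=> i; rewrite -mulmxA BJ !mulmxA AJ.
  + by move=> x xW; rewrite -mulmxA; apply: AW; exact: BW.
- move=> A sA; have [u -> _] := Sp_tr sA.1.
  by split=> //; exact: stabilizer_tr.
Qed.

Lemma stabilizer_transitive : acts_transitively stabilizer (unit_sphere Wp).
Proof.
have iso A x y : stabilizer A -> dot (A *m x) (A *m y) = dot x y.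
  by move=> [[A1 _] _]; rewrite !dotE trmx_mul -mulmxA [A^T *m _]mulmxA A1 mul1mx.
split=> [A x sA [xW x1]|x y].
  by split; [exact: sA.2 | rewrite iso].
have reach z : unit_sphere Wp z -> exists A, stabilizer A /\ A *m xi 0 = z.
  move=> /wperp_sphereP [a [a1 ->]]; have [F [_ _ sF F1]] := wperp_path a1.
  by exists (F 1); split.
move=> /reach [A [sA <-]] /reach [B [sB <-]].
have [s1 sM _] := stabilizer_group.
exists (B *m A^T); split; first by apply: sM => //; exact: stabilizer_tr.
by rewrite -mulmxA [A^T *m _]mulmxA sA.1.1 mul1mx.
Qed.

Lemma stabilizer_SpSp1 : stabilizer `<=` SpSp1 J.
Proof.
move=> A [sA _]; exists A => //; exists 1%:M; last by rewrite mulmx1.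
exists 1, (fun _ => 0); split.
  by rewrite expr1n big1 ?addr0// => i _; rewrite expr0n.
by rewrite big1 ?addr0// => i _; rewrite scale0r.
Qed.

End SubspaceSymmetries.

(** * Geodesics of AN *)

Section HalfArguments.
Context {R : realType}.

(** Twice the hyperbolic sine and cosine of the half argument. *)
Definition sh (t : R) : R := expR (t / 2) - expR (- (t / 2)).
Definition ch (t : R) : R := expR (t / 2) + expR (- (t / 2)).

Lemma ch_gt0 t : 0 < ch t. Proof. by rewrite addr_gt0 ?expR_gt0. Qed.
Lemma ch_neq0 t : ch t != 0. Proof. by rewrite gt_eqF ?ch_gt0. Qed.

Lemma sh_gt0 t : 0 < t -> 0 < sh t.
Proof. by move=> t0; rewrite subr_gt0 ltr_expR; lra. Qed.

Lemma sh0 : sh 0 = 0. Proof. by rewrite /sh mul0r oppr0 subrr. Qed.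
Lemma chsh t : ch t ^+ 2 = sh t ^+ 2 + 4.
Proof.
have e : expR (t / 2) * expR (- (t / 2)) = 1 by exact: expRxMexpNx_1.
rewrite /ch /sh; set x := expR (t / 2) in e *; set y := expR (- _) in e *.
by transitivity ((x - y) ^+ 2 + 4 * (x * y)); [ring | rewrite e mulr1].
Qed.

Lemma sh_surj (x : R) : 0 < x -> exists t, 0 < t /\ sh t = x.
Proof.
move=> x0; pose z := (x + Num.sqrt (x ^+ 2 + 4)) / 2.
have s2 : Num.sqrt (x ^+ 2 + 4) ^+ 2 = x ^+ 2 + 4 by rewrite sqr_sqrtr//; nra.
have s0 : 0 <= Num.sqrt (x ^+ 2 + 4) by exact: sqrtr_ge0.
have s1 : 2 < Num.sqrt (x ^+ 2 + 4) by nra.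
have z0 : 1 < z by rewrite /z; lra.
exists (2 * ln z); split; first by rewrite mulr_gt0// ln_gt0.
rewrite /sh mulrAC divff// mul1r expRN lnK ?posrE; last by lra.
by apply: (mulIf (x := z)); [rewrite gt_eqF//; lra | rewrite mulrBl mulVf ?gt_eqF//; [rewrite /z; nra | lra]].
Qed.

Lemma HD_sh (D : normedModType R) (a : D -> R) x v k :
  has_deriv a x v k -> has_deriv (fun y => sh (a y)) x v (ch (a x) / 2 * k).
Proof.
move=> Ha; have H2 : has_deriv (fun y => a y / 2) x v (k / 2).
  apply: HD_eq; first by apply: HD_mul; [exact: Ha | exact: HD_cst].
  by rewrite mulr0 add0r.
apply: HD_eq; first exact: HD_sub (HD_exp H2) (HD_exp (HD_opp H2)).
by rewrite /ch; field.
Qed.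

Lemma HD_ch (D : normedModType R) (a : D -> R) x v k :
  has_deriv a x v k -> has_deriv (fun y => ch (a y)) x v (sh (a x) / 2 * k).
Proof.
move=> Ha; have H2 : has_deriv (fun y => a y / 2) x v (k / 2).
  apply: HD_eq; first by apply: HD_mul; [exact: Ha | exact: HD_cst].
  by rewrite mulr0 add0r.
apply: HD_eq; first exact: HD_add (HD_exp H2) (HD_exp (HD_opp H2)).
by rewrite /sh; field.
Qed.

Lemma Ck_half (D : normedModType R) k (a : D -> R) :
  Ck k setT a -> Ck k setT (fun y => expR (a y / 2)) /\ Ck k setT (fun y => expR (- (a y / 2))).
Proof.
move=> ca; have c2 : Ck k setT (fun y => a y / 2) by apply: Ck_mul => //; exact: Ck_cst.
by split; [exact: Ck_exp | apply: Ck_exp; exact: Ck_opp].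
Qed.
Lemma Ck_sh (D : normedModType R) k (a : D -> R) :
  Ck k setT a -> Ck k setT (fun y => sh (a y)).
Proof. by move=> /Ck_half[]; exact: Ck_sub. Qed.
Lemma Ck_ch (D : normedModType R) k (a : D -> R) :
  Ck k setT a -> Ck k setT (fun y => ch (a y)).
Proof. by move=> /Ck_half[]; exact: Ck_add. Qed.

(** The quantities [A] and [B] below are conserved. *)
Lemma quarter_ode (f f1 : R -> R) :
  (forall t, has_deriv f t 1 (f1 t)) -> (forall t, has_deriv f1 t 1 (f t / 4)) ->
  forall t, f t = (f1 0) * sh t + (f 0) / 2 * ch t.
Proof.
move=> Hf Hf1 t.
have Hid u : has_deriv (fun x : R => x / 2) u 1 (1 / 2).
  apply: HD_eq; first by apply: HD_mul; [exact: HD_id | exact: HD_cst].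
  by rewrite mulr0 add0r.
pose A t := expR (- (t / 2)) * (f1 t + f t / 2).
pose B t := expR (t / 2) * (f1 t - f t / 2).
have Hh u : has_deriv (fun x => f x / 2) u 1 (f1 u / 2).
  apply: HD_eq; first by apply: HD_mul; [exact: Hf | exact: HD_cst].
  by rewrite mulr0 add0r.
have HA u : has_deriv A u 1 0.
  apply: HD_eq; first exact: HD_mul (HD_exp (HD_opp (Hid u))) (HD_add (Hf1 u) (Hh u)).
  by rewrite /=; field.
have HB u : has_deriv B u 1 0.
  apply: HD_eq; first exact: HD_mul (HD_exp (Hid u)) (HD_sub (Hf1 u) (Hh u)).
  by rewrite /=; field.
have EA : A t = f1 0 + f 0 / 2.
  by rewrite (HD0_constant HA t 0) /A mul0r oppr0 expR0 mul1r.
have EB : B t = f1 0 - f 0 / 2.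
  by rewrite (HD0_constant HB t 0) /B mul0r expR0 mul1r.
have e : expR (t / 2) * expR (- (t / 2)) = 1 by exact: expRxMexpNx_1.
have -> : f1 0 = (A t + B t) / 2 by rewrite EA EB; lra.
have -> : f 0 = A t - B t by rewrite EA EB; lra.
rewrite /A /B /sh /ch; set x := expR (t / 2) in e *; set y := expR (- _) in e *.
transitivity (f t * (x * y)); first by rewrite e mulr1.
by field.
Qed.

End HalfArguments.

Section Geodesics.
Context {R : realType} {m : nat} (J : 'I_3 -> 'M[R]_m) (cJ : canonical_basis J).
Notation g := (an_metric J).
Notation br := (n_bracket J).

Lemma HD_derive1 (D : normedModType R) (c : R -> D) t :
  smooth c -> has_deriv c t 1 (derive1 c t).
Proof. by move=> sc; rewrite derive1E; exact: HD_smooth. Qed.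

Lemma smooth_derive1 (D : normedModType R) (c : R -> D) :
  smooth c -> smooth (derive1 c).
Proof.
move=> sc k; apply: (@Ck_ext _ _ _ _ _ (fun t => 'D_1 c t)).
  by move=> t; exact: derive1E.
exact: Ck_derive (sc k.+1) _.
Qed.

Lemma derive1_HD (D : normedModType R) (c : R -> D) t l :
  has_deriv c t 1 l -> derive1 c t = l.
Proof. by move=> [_ <-]; exact: derive1E. Qed.

Lemma an_metric0l p w : g p 0 w = 0.
Proof.
have := an_metric_linear J p 0 0 w 1; rewrite scaler0 addr0 mul1r => /eqP.
by rewrite -subr_eq0 opprD addrA subrr sub0r oppr_eq0 => /eqP.
Qed.

Lemma HD_zeta_curve (c v : R -> AN R m) t c' v' :
  has_deriv c t 1 c' -> has_deriv v t 1 v' ->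
  has_deriv (fun s => zeta J (c s) (v s)) t 1
    (zeta J (c t) v' - 2^-1 *: br c'.1.2 (v t).1.2).
Proof.
move=> Hc Hv; apply: HD_eq.
  apply: HD_sub; first exact: HD_X Hv.
  by apply: HD_scale; [exact: HD_cst | exact: HD_br (HD_U Hc) (HD_U Hv)].
by rewrite scale0r addr0 /zeta scalerDr opprD addrA addrAC.
Qed.

(** The hypothesis is the geodesic equation at [p], for the velocity [v] and the
   coordinate acceleration [a]; the components of [a] are found by testing it
   against vectors [w] of the three summands of the Lie algebra. *)
Lemma acceleration_zeta (p v a : AN R m) :
  (forall w, 0 = g p a w + christoffel g p v v w) ->
  zeta J p a = (2 * v.1.1) *: zeta J p v.
Proof.
move=> eqn; apply/eqP; rewrite -subr_eq0; apply/eqP/dot_eq0.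
set y := (X in dot _ X); have := eqn (0, 0, y).
rewrite an_metricE christoffelE//.
have -> : zeta J p (0, 0, y) = y by rewrite /zeta /= n_bracket0r scaler0 subr0.
have -> : (0, 0, y).1.1 = 0 :> R by [].
have -> : (0, 0, y).1.2 = 0 :> 'cV[R]_m by [].
rewrite !n_bracket0r !dot0r => H; have e0 := expR_gt0 (- p.1.1).
apply: (mulfI (x := expR (- p.1.1) ^+ 2)).
  by rewrite expf_neq0// gt_eqF.
by rewrite mulr0 [RHS]H {1}/y dotBl dotZl; ring.
Qed.

Lemma acceleration_horizontal (p v a : AN R m) :
  (forall w, 0 = g p a w + christoffel g p v v w) -> zeta J p v = 0 ->
  a.1.1 = - 2^-1 * expR (- p.1.1) * dot v.1.2 v.1.2 /\ a.1.2 = v.1.1 *: v.1.2.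
Proof.
move=> eqn z; split.
  have := eqn (1, 0, 0); rewrite an_metricE christoffelE// z.
  have -> : (1, 0, 0).1.1 = 1 :> R by [].
  have -> : (1, 0, 0).1.2 = 0 :> 'cV[R]_m by [].
  rewrite n_bracket0r (dot0r a.1.2) (dot0r v.1.2) (dot0l (zeta _ _ _)) !dot0l => H.
  have zB : zeta J p (1, 0, 0) = 0 by rewrite /zeta /= n_bracket0r scaler0 subr0.
  move: H; rewrite zB (dot0r (zeta _ _ _)) => H.
  by apply/eqP; rewrite -subr_eq0; apply/eqP; rewrite [RHS]H; field.
apply/eqP; rewrite -subr_eq0; apply/eqP/dot_eq0; set y := (X in dot _ X).
have := eqn (0, y, 2^-1 *: br p.1.2 y).
rewrite an_metricE christoffelE// z.
have -> : zeta J p (0, y, 2^-1 *: br p.1.2 y) = 0 by rewrite /zeta /= subrr.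
have -> : (0, y, 2^-1 *: br p.1.2 y).1.1 = 0 :> R by [].
have -> : (0, y, 2^-1 *: br p.1.2 y).1.2 = y by [].
rewrite !(dot0l, dot0r) => H; have e0 := expR_gt0 (- p.1.1).
apply: (mulfI (x := expR (- p.1.1))); first by rewrite gt_eqF.
by rewrite mulr0 [RHS]H {1}/y dotBl dotZl; field.
Qed.

Lemma horizontal_acceleration (p v a w : AN R m) :
  zeta J p v = 0 -> zeta J p a = 0 ->
  a.1.1 = - 2^-1 * expR (- p.1.1) * dot v.1.2 v.1.2 -> a.1.2 = v.1.1 *: v.1.2 ->
  0 = g p a w + christoffel g p v v w.
Proof.
move=> z z2 r2 U2; rewrite an_metricE christoffelE// z z2 r2 U2.
by rewrite !dot0l dotZl; field.
Qed.

Lemma geodesic_equations (c : R -> AN R m) : geodesic g c ->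
  exists c1 c2 : R -> AN R m,
  [/\ forall t, has_deriv c t 1 (c1 t), forall t, has_deriv c1 t 1 (c2 t),
      c1 0 = derive1 c 0 &
      forall t w, 0 = g (c t) (c2 t) w + christoffel g (c t) (c1 t) (c1 t) w].
Proof.
move=> [sc Hg]; exists (derive1 c), (derive1 (derive1 c)); split.
- by move=> t; exact: HD_derive1.
- by move=> t; apply: HD_derive1; exact: smooth_derive1.
- by [].
- by move=> t w; rewrite -(Hg t w) an_metric0l.
Qed.

(** Along a geodesic exp(-2r) zeta is conserved. So a geodesic that is once
   orthogonal to the centre remains so, and then the rest of its velocity obeys
   a simple system. *)
Lemma geodesic_horizontal (c : R -> AN R m) :
  geodesic g c -> zeta J (c 0) (derive1 c 0) = 0 ->
  exists c1 c2 : R -> AN R m,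
  [/\ forall t, has_deriv c t 1 (c1 t), forall t, has_deriv c1 t 1 (c2 t),
      c1 0 = derive1 c 0 &
  forall t, [/\ zeta J (c t) (c1 t) = 0,
    (c2 t).1.1 = - 2^-1 * expR (- (c t).1.1) * dot (c1 t).1.2 (c1 t).1.2 &
    (c2 t).1.2 = (c1 t).1.1 *: (c1 t).1.2]].
Proof.
move=> /geodesic_equations [c1 [c2 [Hc Hc1 c10 eqn]]]; rewrite -c10 => z0.
exists c1, c2; split=> //.
have Hzc t : has_deriv (fun s => zeta J (c s) (c1 s)) t 1
    ((2 * (c1 t).1.1) *: zeta J (c t) (c1 t)).
  apply: HD_eq; first exact: HD_zeta_curve (Hc t) (Hc1 t).
  by rewrite n_bracketxx// scaler0 subr0 (acceleration_zeta (eqn t)).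
have z t : zeta J (c t) (c1 t) = 0.
  apply/colP => i; rewrite [RHS]mxE.
  pose y : 'cV[R]_3 := delta_mx i 0.
  pose h t := expR (- (c t).1.1 * 2) * dot (zeta J (c t) (c1 t)) y.
  have Hh u : has_deriv h u 1 0.
    have Ha : has_deriv (fun s => - (c s).1.1 * 2) u 1 (- (c1 u).1.1 * 2).
      apply: HD_eq; first by apply: HD_mul; [exact: HD_opp (HD_A (Hc u)) | exact: HD_cst].
      by rewrite mulr0 add0r.
    apply: HD_eq; first exact: HD_mul (HD_exp Ha) (HD_dot (Hzc u) (HD_cst y u 1)).
    move: (zeta J (c u) (c1 u)) (c1 u).1.1 => zz r1.
    by rewrite (dot0r zz) addr0 dotZl; ring.
  have := HD0_constant Hh t 0; rewrite /h z0 (dot0l y) mulr0 /y dot_delta => /eqP.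
  by rewrite mulf_eq0 gt_eqF ?expR_gt0//= => /eqP.
by move=> t; have [? ?] := acceleration_horizontal (eqn t) (z t).
Qed.

Lemma horizontal_geodesic (c c1 c2 : R -> AN R m) : smooth c ->
  (forall t, has_deriv c t 1 (c1 t)) -> (forall t, has_deriv c1 t 1 (c2 t)) ->
  (forall t, [/\ zeta J (c t) (c1 t) = 0,
    (c2 t).1.1 = - 2^-1 * expR (- (c t).1.1) * dot (c1 t).1.2 (c1 t).1.2 &
    (c2 t).1.2 = (c1 t).1.1 *: (c1 t).1.2]) ->
  geodesic g c.
Proof.
move=> sc Hc Hc1 H; split=> // t w.
have c1E : derive1 c = c1 by apply/funext => s; exact: derive1_HD.
rewrite c1E (derive1_HD (Hc1 t)) an_metric0l.
have z2 : zeta J (c t) (c2 t) = 0.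
  have := HD_zeta_curve (Hc t) (Hc1 t).
  rewrite n_bracketxx// scaler0 subr0 => -[_ <-].
  have -> : (fun s => zeta J (c s) (c1 s)) = (fun _ => 0).
    by apply/funext => s; case: (H s).
  exact: derive_cst.
by have [z r2 U2] := H t; exact: horizontal_acceleration.
Qed.

End Geodesics.

(** * The subgroup [S_w] *)

Section OneParameter.
Context {R : realType} {m : nat} (J : 'I_3 -> 'M[R]_m) (cJ : canonical_basis J).
Notation br := (n_bracket J).

Lemma HD0_vec d (f : R -> 'cV[R]_d) :
  (forall t, has_deriv f t 1 0) -> forall s t, f s = f t.
Proof.
move=> Hf s t; apply/colP => i; rewrite -!dot_delta.
apply: (HD0_constant (f := fun t => dot (f t) (delta_mx i 0))) => u.
apply: HD_eq; first exact: HD_dot (Hf u) (HD_cst _ u 1).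
by rewrite (dot0l (delta_mx i 0)) (dot0r (f u)) addr0.
Qed.

Lemma one_parameter0 c : one_parameter_subgroup J c -> c 0 = 0.
Proof.
move=> [_ cM]; have := cM 0 0; rewrite addr0.
move=> /(congr1 (an_mul J (an_inv (c 0)))).
by rewrite an_mulA an_mulV// an_mul0.
Qed.

Lemma one_parameter_velocity c : one_parameter_subgroup J c ->
  forall t, has_deriv c t 1 (left_invariant J (derive1 c 0) (c t)).
Proof.
move=> oc t; have [sc cM] := oc; have c0 := one_parameter0 oc.
have Hc u : has_deriv c u 1 (derive1 c u) by exact: HD_derive1.
suff -> : left_invariant J (derive1 c 0) (c t) = derive1 c t by exact: Hc.
have H1 : has_deriv (fun s => c (t + s)) 0 1 (derive1 c t).
  apply: (@HD_comp _ _ _ _ (fun s => t + s) c 0 1 1); last by rewrite addr0; exact: Hc.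
  apply: HD_eq; first by apply: HD_add; [exact: HD_cst | exact: HD_id].
  by rewrite add0r.
have H2 : has_deriv (fun s => an_mul J (c t) (c s)) 0 1
    (left_invariant J (derive1 c 0) (c t)).
  apply: (HD_comp (Hc 0)); rewrite c0.
  split; first exact: (diff_an_mul J (c t) 0 0).1.
  by [].
case: H1 => _ <-; case: H2 => _ <-.
by rewrite (_ : (fun s => an_mul J (c t) (c s)) = (fun s => c (t + s)))//; apply/funext => s; rewrite cM.
Qed.

(** Each component of the velocity depends on the preceding components only, so
   the components agree one after the other. *)
Lemma one_parameter_unique c d :
  one_parameter_subgroup J c -> one_parameter_subgroup J d ->
  derive1 c 0 = derive1 d 0 -> c = d.
Proof.
move=> oc od cd; have Hc := one_parameter_velocity oc.
have Hd := one_parameter_velocity od; move: Hc Hd.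
rewrite -cd; move: (derive1 c 0) => a Hc Hd.
have c0 := one_parameter0 oc; have d0 := one_parameter0 od.
have rE t : (c t).1.1 = (d t).1.1.
  have H u : has_deriv (fun t => (c t).1.1 - (d t).1.1) u 1 0.
    apply: HD_eq; first exact: HD_sub (HD_A (Hc u)) (HD_A (Hd u)).
    by rewrite !left_invariantE /= subrr.
  have := HD0_constant H t 0; rewrite c0 d0 subrr => /eqP.
  by rewrite subr_eq0 => /eqP.
have UE t : (c t).1.2 = (d t).1.2.
  have H u : has_deriv (fun t => (c t).1.2 - (d t).1.2) u 1 0.
    apply: HD_eq; first exact: HD_sub (HD_U (Hc u)) (HD_U (Hd u)).
    by rewrite !left_invariantE /= rE subrr.
  have := HD0_vec H t 0; rewrite c0 d0 subrr => /eqP.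
  by rewrite subr_eq0 => /eqP.
have XE t : (c t).2 = (d t).2.
  have H u : has_deriv (fun t => (c t).2 - (d t).2) u 1 0.
    apply: HD_eq; first exact: HD_sub (HD_X (Hc u)) (HD_X (Hd u)).
    by rewrite !left_invariantE /= rE UE subrr.
  have := HD0_vec H t 0; rewrite c0 d0 subrr => /eqP.
  by rewrite subr_eq0 => /eqP.
apply/funext => t; rewrite [LHS]surjective_pairing [RHS]surjective_pairing.
by rewrite [(c t).1]surjective_pairing [(d t).1]surjective_pairing rE UE XE.
Qed.

Lemma one_parameter_exists a : exists c, one_parameter_subgroup J c /\ derive1 c 0 = a.
Proof.
case: a => [[al U] X].
have [->|al0] := eqVneq al 0.
  exists (fun t => (0, t *: U, t *: X)); split; first split.
  - move=> k; apply: Ck_pair; first apply: Ck_pair; first exact: Ck_cst.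
    + by apply: Ck_scale; [exact: Ck_id | exact: Ck_cst].
    + by apply: Ck_scale; [exact: Ck_id | exact: Ck_cst].
  - move=> s t; rewrite /an_mul /= mul0r expR0 !scale1r mulr1 addr0.
    rewrite n_bracketZl n_bracketZr n_bracketxx// !scaler0 addr0.
    by rewrite !scalerDl.
  - apply: derive1_HD; apply: HD_eq.
      apply: HD_pair; first apply: HD_pair; first exact: HD_cst.
      + by apply: HD_scale; [exact: HD_id | exact: HD_cst].
      + by apply: HD_scale; [exact: HD_id | exact: HD_cst].
    by rewrite !scaler0 !add0r !scale1r.
pose f (t : R) := (expR (t * al / 2) - 1) * (2 / al).
pose h (t : R) := (expR (t * al) - 1) * (1 / al).
exists (fun t => (t * al, f t *: U, h t *: X)); split; first split.
- move=> k; have ct : Ck k setT (fun t : R => t * al).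
    by apply: Ck_mul; [exact: Ck_id | exact: Ck_cst].
  apply: Ck_pair; first apply: Ck_pair => //.
  + apply: Ck_scale; last exact: Ck_cst.
    apply: Ck_mul; last exact: Ck_cst.
    apply: Ck_sub; last exact: Ck_cst.
    by apply: Ck_exp; apply: Ck_mul => //; exact: Ck_cst.
  + apply: Ck_scale; last exact: Ck_cst.
    apply: Ck_mul; last exact: Ck_cst.
    by apply: Ck_sub; [exact: Ck_exp | exact: Ck_cst].
- move=> s t; rewrite /an_mul /=.
  rewrite n_bracketZl n_bracketZr n_bracketxx// !scaler0 addr0 !scalerA -!scalerDl.
  have e1 : expR ((s + t) * al) = expR (s * al) * expR (t * al).
    by rewrite -expRD mulrDl.
  have e2 : expR ((s + t) * al / 2) = expR (s * al / 2) * expR (t * al / 2).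
    by rewrite -expRD; congr expR; field.
  congr (_, _ *: _, _ *: _).
    by rewrite /f e2; field.
  by rewrite /h e1; field.
- apply: derive1_HD.
  have Ht : has_deriv (fun t : R => t * al) 0 1 al.
    apply: HD_eq; first by apply: HD_mul; [exact: HD_id | exact: HD_cst].
    by rewrite mul0r add0r mul1r.
  have Ht2 : has_deriv (fun t : R => t * al / 2) 0 1 (al / 2).
    apply: HD_eq; first by apply: HD_mul; [exact: Ht | exact: HD_cst].
    by rewrite mulr0 add0r.
  apply: HD_eq.
    apply: HD_pair; first apply: HD_pair; first exact: Ht.
    + apply: HD_scale; last exact: HD_cst.
      apply: HD_mul; last exact: HD_cst.
      by apply: HD_sub; [exact: HD_exp Ht2 | exact: HD_cst].
    + apply: HD_scale; last exact: HD_cst.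
      apply: HD_mul; last exact: HD_cst.
      by apply: HD_sub; [exact: HD_exp Ht | exact: HD_cst].
  rewrite /= !mul0r expR0 !scaler0 !add0r !subr0 !mulr0 !add0r !mul1r.
  by congr (_, _, _); rewrite (_ : _ * _ = 1) ?scale1r//; field.
Qed.

End OneParameter.

Section LevelSets.
Context {R : realType} {m : nat} (J : 'I_3 -> 'M[R]_m) (cJ : canonical_basis J).
Context (Wp : {vspace 'cV[R]_m}) (P : 'M[R]_m).
(** The orthogonal projection to the complement of [w]. *)
Hypothesis Psym : forall x y, dot (P *m x) y = dot x (P *m y).
Hypothesis PP : forall x : 'cV[R]_m, P *m (P *m x) = P *m x.
Hypothesis PW : forall x, x \in Wp <-> P *m x = x.

Notation g := (an_metric J).
Notation br := (n_bracket J).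
Notation S := (S_w J Wp).

Lemma complementP x : orthogonal_complement Wp x <-> P *m x = 0.
Proof.
split=> [ox|Px y /PW <-]; last by rewrite -Psym Px dot0l.
apply: dot_eq0; rewrite Psym PP; apply: ox; apply/PW; exact: PP.
Qed.

Lemma P_linear : linear (mulmx P : 'cV[R]_m -> 'cV[R]_m).
Proof. by move=> a x y; rewrite mulmxDr scalemxAr. Qed.

Lemma HD_P (D : normedModType R) (f : D -> 'cV[R]_m) x v l :
  has_deriv f x v l -> has_deriv (fun y => P *m f y) x v (P *m l).
Proof. exact: (HD_lincomp (framed_cV m) P_linear). Qed.

(** [P U] is constant along the one-parameter subgroups with velocity in the Lie
   algebra. Conversely the point (r, U, X) is the product of
   the exponentials of (0, U, X) and (r, 0, 0). *)
Lemma S_wE : S = [set p | P *m p.1.2 = 0].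
Proof.
apply/seteqP; split.
  move=> p; apply; split; first split.
  - by rewrite /= mulmx0.
  - by move=> a b /= Ha Hb; rewrite mulmxDr -scalemxAr Ha Hb scaler0 addr0.
  - by move=> a /= Ha; rewrite mulmxN -scalemxAr Ha scaler0 oppr0.
  move=> _ [c [t [oc hc ->]]] /=; have c0 := one_parameter0 cJ oc.
  have H u : has_deriv (fun t => P *m (c t).1.2) u 1 0.
    apply: HD_eq; first exact: HD_P (HD_U (one_parameter_velocity cJ oc u)).
    by move/complementP: hc; move: (derive1 c 0) => a Pa; rewrite left_invariantE /= -scalemxAr Pa scaler0.
  by rewrite (HD0_vec H t 0) c0 mulmx0.
move=> p /= pP; move=> A [[A0 AM AV] hA].
have -> : p = an_mul J (0, p.1.2, p.2) (p.1.1, 0, 0).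
  case: p {pP} => [[r U] X]; rewrite /an_mul /= mul0r expR0 !scale1r n_bracket0r.
  by rewrite !scaler0 !addr0 add0r.
have mk (c : R -> AN R m) : one_parameter_subgroup J c ->
    P *m (derive1 c 0).1.2 = 0 -> A (c 1).
  move=> oc Pc; apply: hA; exists c, 1; split.
  - exact: oc.
  - exact: (complementP _).2 Pc.
  - exact: erefl.
apply: AM.
  pose c (t : R) : AN R m := (0, t *: p.1.2, t *: p.2).
  have Hc : has_deriv c 0 1 (0, p.1.2, p.2).
    apply: HD_eq.
      apply: HD_pair; first apply: HD_pair; first exact: HD_cst.
      + by apply: HD_scale; [exact: HD_id | exact: HD_cst].
      + by apply: HD_scale; [exact: HD_id | exact: HD_cst].
    by rewrite !scaler0 !add0r !scale1r.
  have -> : (0, p.1.2, p.2) = c 1 by rewrite /c !scale1r.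
  apply: mk; last by rewrite (derive1_HD Hc).
  split.
  - move=> k; apply: Ck_pair; first apply: Ck_pair; first exact: Ck_cst.
    + by apply: Ck_scale; [exact: Ck_id | exact: Ck_cst].
    + by apply: Ck_scale; [exact: Ck_id | exact: Ck_cst].
  - move=> s t; rewrite /c /an_mul /= mul0r expR0 !scale1r mulr1 addr0.
    rewrite n_bracketZl n_bracketZr n_bracketxx// !scaler0 addr0.
    by rewrite !scalerDl.
pose c (t : R) : AN R m := (t * p.1.1, 0, 0).
have Hc : has_deriv c 0 1 (p.1.1, 0, 0).
  apply: HD_eq.
    apply: HD_pair; last exact: HD_cst.
    apply: HD_pair; last exact: HD_cst.
    by apply: HD_mul; [exact: HD_id | exact: HD_cst].
  by rewrite mul0r add0r mul1r.
have -> : (p.1.1, 0, 0) = c 1 by rewrite /c mul1r.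
apply: mk; last by rewrite (derive1_HD Hc) /= mulmx0.
split.
- move=> k; apply: Ck_pair; last exact: Ck_cst.
  apply: Ck_pair; last exact: Ck_cst.
  by apply: Ck_mul; [exact: Ck_id | exact: Ck_cst].
- move=> s t; rewrite /c /an_mul /= n_bracket0r !scaler0 !addr0.
  by rewrite mulrDl.
Qed.

(** The simplest function invariant under [S] that vanishes on [S] only: the
   square of [sh] of the distance to [S]. *)
Definition height (p : AN R m) : R :=
  expR (- p.1.1) * dot (P *m p.1.2) (P *m p.1.2).

Definition level (r : R) : set (AN R m) := [set p | height p = sh r ^+ 2].

Lemma HD_height (D : normedModType R) (c : D -> AN R m) t v c' :
  has_deriv c t v c' ->
  has_deriv (fun t => height (c t)) t v (expR (- (c t).1.1) *
    (2 * dot (P *m (c t).1.2) c'.1.2 - c'.1.1 * dot (P *m (c t).1.2) (P *m (c t).1.2))).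
Proof.
move=> Hc; have HP := HD_P (HD_U Hc).
apply: HD_eq; first exact: HD_mul (HD_exp (HD_opp (HD_A Hc))) (HD_dot HP HP).
by rewrite [dot (P *m c'.1.2) _]dotC -[dot _ (P *m c'.1.2)]Psym PP; ring.
Qed.

Lemma smooth_height : smooth height.
Proof.
move=> k; have cid := @Ck_id R (AN R m) k.
have cP : Ck k setT (fun p : AN R m => P *m p.1.2).
  by apply: (Ck_linear (framed_cV m) P_linear); exact: Ck_U cid.
apply: Ck_mul; last exact: Ck_dot.
by apply: Ck_exp; apply: Ck_opp; exact: Ck_A cid.
Qed.

Lemma tangent_S p v : S p -> P *m v.1.2 = 0 -> tangent S p v.
Proof.
rewrite S_wE => /= Sp Pv; exists (fun t => p + t *: v); split.
- move=> k; apply: Ck_add; first exact: Ck_cst.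
  by apply: Ck_scale; [exact: Ck_id | exact: Ck_cst].
- by rewrite scale0r addr0.
- by apply: filterE => t /=; rewrite mulmxDr -scalemxAr Sp Pv scaler0 addr0.
- apply: derive1_HD; apply: HD_eq.
    apply: HD_add; first exact: HD_cst.
    by apply: HD_scale; [exact: HD_id | exact: HD_cst].
  by rewrite scaler0 !add0r scale1r.
Qed.

Lemma tangent_S_complement p v : tangent S p v -> P *m v.1.2 = 0.
Proof.
move=> [c [sc _ Sc <-]]; move: (derive1 c 0) (HD_derive1 0 sc) => w Hw.
have HPw := HD_P (HD_U Hw).
case: HPw => _ <-.
rewrite -(@derive_cst R R 'cV[R]_m 0 (0 : R) 1).
apply: near_eq_derive.
by move: Sc; apply: filterS => t; rewrite S_wE.
Qed.

(** In other words, vectors normal to [S] are left translates of vectors of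
   [w_perp]. Orthogonality is tested against the tangent vectors in the
   directions of B, of the centre and of w. *)
Lemma normal_S p x : S p -> Defs.normal_space g S p x <->
  [/\ x.1.1 = 0, zeta J p x = 0 & P *m x.1.2 = x.1.2].
Proof.
move=> Sp; split=> [nx|[x0 zx Px] v /tangent_S_complement Pv]; last first.
  rewrite an_metricE x0 zx (dot0l (zeta _ _ _)) -Px Psym Pv dot0r.
  by rewrite mul0r !mulr0 !addr0.
have nv v : P *m v.1.2 = 0 -> g p x v = 0.
  by move=> Pv; apply: nx; exact: tangent_S.
have e0 := expR_gt0 (- p.1.1).
have z1 : zeta J p (1, 0, 0) = 0 by rewrite /zeta /= n_bracket0r scaler0 subr0.
have x0 : x.1.1 = 0.
  have := nv (1, 0, 0); rewrite /= mulmx0 => /(_ erefl).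
  rewrite an_metricE z1 (dot0r (zeta _ _ _)).
  by rewrite /= (dot0r x.1.2) !mulr0 !addr0 mulr1.
have zx : zeta J p x = 0.
  apply: dot_eq0; set y := (X in dot _ X).
  have := nv (0, 0, y); rewrite /= mulmx0 => /(_ erefl).
  rewrite an_metricE x0 mul0r.
  have -> : zeta J p (0, 0, y) = y by rewrite /zeta /= n_bracket0r scaler0 subr0.
  rewrite /= (dot0r x.1.2) mulr0 !add0r => /eqP.
  by rewrite mulf_eq0 expf_eq0 /= gt_eqF//= => /eqP.
split=> //; apply/eqP; rewrite eq_sym -subr_eq0; apply/eqP/dot_eq0.
set y := (X in dot _ X).
have Py : P *m y = 0 by rewrite /y mulmxBr PP subrr.
have := nv (0, y, 2^-1 *: br p.1.2 y) Py.
have zy : zeta J p (0, y, 2^-1 *: br p.1.2 y) = 0 by rewrite /zeta /= subrr.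
rewrite an_metricE zy x0 zx (dot0l 0) mul0r mulr0 addr0 add0r /= => /eqP.
rewrite mulf_eq0 gt_eqF//= => /eqP xy.
by rewrite {1}/y dotBl Psym Py (dot0r x.1.2) subr0.
Qed.

End LevelSets.

(** * Tubes around [S_w] *)

Section Tubes.
Context {R : realType} {m : nat} (J : 'I_3 -> 'M[R]_m) (cJ : canonical_basis J).
Context (Wp : {vspace 'cV[R]_m}) (P : 'M[R]_m).
Hypothesis Psym : forall x y, dot (P *m x) y = dot x (P *m y).
Hypothesis PP : forall x : 'cV[R]_m, P *m (P *m x) = P *m x.
Hypothesis PW : forall x, x \in Wp <-> P *m x = x.

Notation g := (an_metric J).
Notation br := (n_bracket J).
Notation S := (S_w J Wp).
Notation height := (height P).
Notation level := (level P).

(** ** The geodesics normal to [S]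

  The geodesic through [(a, V, Y)] with direction [xi]; the parameter [t0]
  moves its origin. *)
Definition normal_geodesic (t0 a : R) (V xi : 'cV[R]_m) (Y : 'cV[R]_3) (t : R)
    : AN R m :=
  (a - 2 * ln (ch (t + t0) / 2),
   V + (expR (a / 2) * (2 * sh (t + t0) / ch (t + t0))) *: xi,
   Y + (expR (a / 2) * (sh (t + t0) / ch (t + t0))) *: br V xi).

Definition normal_velocity (t0 a : R) (V xi : 'cV[R]_m) (t : R) : AN R m :=
  (- (sh (t + t0) / ch (t + t0)),
   (expR (a / 2) * (4 / ch (t + t0) ^+ 2)) *: xi,
   (expR (a / 2) * (2 / ch (t + t0) ^+ 2)) *: br V xi).

Definition normal_acceleration (t0 a : R) (V xi : 'cV[R]_m) (t : R) : AN R m :=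
  (- (2 / ch (t + t0) ^+ 2),
   (expR (a / 2) * (- (4 * sh (t + t0)) / ch (t + t0) ^+ 3)) *: xi,
   (expR (a / 2) * (- (2 * sh (t + t0)) / ch (t + t0) ^+ 3)) *: br V xi).

Let chN0 (t : R) := ch_neq0 t.

Lemma HD_shift (t0 t : R) : has_deriv (fun t : R => t + t0) t 1 1.
Proof.
apply: HD_eq; first by apply: HD_add; [exact: HD_id | exact: HD_cst].
by rewrite addr0.
Qed.

Lemma HD_shift_sh (t0 t : R) : has_deriv (fun t => sh (t + t0)) t 1 (ch (t + t0) / 2).
Proof. by apply: HD_eq; [exact: HD_sh (HD_shift t0 t) | rewrite mulr1]. Qed.
Lemma HD_shift_ch (t0 t : R) : has_deriv (fun t => ch (t + t0)) t 1 (sh (t + t0) / 2).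
Proof. by apply: HD_eq; [exact: HD_ch (HD_shift t0 t) | rewrite mulr1]. Qed.

Lemma HD_th (t0 t : R) :
  has_deriv (fun t => sh (t + t0) / ch (t + t0)) t 1 (2 / ch (t + t0) ^+ 2).
Proof.
apply: HD_eq.
  apply: HD_mul; first exact: HD_shift_sh.
  exact: (@HD_inv _ _ (fun t => ch (t + t0)) _ _ _ (chN0 _) (HD_shift_ch t0 t)).
transitivity ((ch (t + t0) ^+ 2 - sh (t + t0) ^+ 2) / 2 / ch (t + t0) ^+ 2).
  by field; rewrite chN0.
have -> : ch (t + t0) ^+ 2 - sh (t + t0) ^+ 2 = 4 by rewrite chsh [_ + 4]addrC addrK.
by field; rewrite chN0.
Qed.

Lemma HD_inv_ch2 (t0 t : R) : has_deriv (fun t => (ch (t + t0) ^+ 2)^-1) t 1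
  (- sh (t + t0) / ch (t + t0) ^+ 3).
Proof.
have H2 : has_deriv (fun t => ch (t + t0) ^+ 2) t 1 (ch (t + t0) * sh (t + t0)).
  apply: HD_eq; first by apply: HD_mul; exact: HD_shift_ch.
  by rewrite /=; field.
apply: HD_eq.
  by apply: (@HD_inv _ _ (fun t => ch (t + t0) ^+ 2) _ _ _ _ H2); rewrite expf_neq0.
by rewrite /=; field; rewrite chN0.
Qed.

Lemma HD_cstl (D F : normedModType R) (b : R) (f : D -> R) (x : F) t v k :
  has_deriv f t v k -> has_deriv (fun s => (b * f s) *: x) t v ((b * k) *: x).
Proof.
move=> Hf; apply: HD_eq.
  apply: HD_scale; last exact: HD_cst.
  by apply: HD_mul; [exact: HD_cst | exact: Hf].
by rewrite scaler0 add0r mul0r addr0.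
Qed.

Lemma HD_normal_geodesic t0 a V xi Y t :
  has_deriv (normal_geodesic t0 a V xi Y) t 1 (normal_velocity t0 a V xi t).
Proof.
have c2 : 0 < ch (t + t0) / 2 by rewrite divr_gt0 ?ch_gt0.
have Hc2 : has_deriv (fun t => ch (t + t0) / 2) t 1 (sh (t + t0) / 4).
  apply: HD_eq; first by apply: HD_mul; [exact: HD_shift_ch | exact: HD_cst].
  by rewrite /=; field.
apply: HD_pair; first apply: HD_pair.
- apply: HD_eq.
    apply: HD_sub; first exact: HD_cst.
    by apply: HD_mul; [exact: HD_cst | exact: (@HD_ln _ _ (fun t => ch (t + t0) / 2) _ _ _ c2 Hc2)].
  by rewrite /=; field; rewrite chN0.
- apply: HD_eq.
    apply: HD_add; first exact: HD_cst.
    apply: HD_cstl; apply: (@HD_ext _ _ _ _ (fun t => 2 * (sh (t + t0) / ch (t + t0)))).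
      by move=> s; rewrite mulrA.
    by apply: HD_mul; [exact: HD_cst | exact: HD_th].
  by rewrite add0r; congr (_ *: _); field; rewrite chN0.
- apply: HD_eq.
    by apply: HD_add; [exact: HD_cst | apply: HD_cstl; exact: HD_th].
  by rewrite add0r.
Qed.

Lemma HD_normal_velocity t0 a V xi t :
  has_deriv (normal_velocity t0 a V xi) t 1 (normal_acceleration t0 a V xi t).
Proof.
apply: HD_pair; first apply: HD_pair.
- exact: HD_opp (HD_th t0 t).
- apply: HD_eq; first apply: HD_cstl.
    by apply: HD_mul; [exact: HD_cst | exact: HD_inv_ch2].
  by congr (_ *: _); field; rewrite chN0.
- apply: HD_eq; first apply: HD_cstl.
    by apply: HD_mul; [exact: HD_cst | exact: HD_inv_ch2].
  by congr (_ *: _); field; rewrite chN0.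
Qed.

Lemma smooth_normal_geodesic t0 a V xi Y : smooth (normal_geodesic t0 a V xi Y).
Proof.
move=> k; have ct : Ck k setT (fun t : R => t + t0).
  by apply: Ck_add; [exact: Ck_id | exact: Ck_cst].
have cs := Ck_sh ct; have cc := Ck_ch ct.
have ci : Ck k setT (fun t => (ch (t + t0))^-1) by apply: Ck_inv.
apply: Ck_pair; first apply: Ck_pair.
- apply: Ck_sub; first exact: Ck_cst.
  apply: Ck_mul; first exact: Ck_cst.
  apply: Ck_ln; first by move=> t; rewrite divr_gt0 ?ch_gt0.
  by apply: Ck_mul => //; exact: Ck_cst.
- apply: Ck_add; first exact: Ck_cst.
  apply: Ck_scale; last exact: Ck_cst.
  apply: Ck_mul; first exact: Ck_cst.
  by apply: Ck_mul => //; apply: Ck_mul => //; exact: Ck_cst.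
- apply: Ck_add; first exact: Ck_cst.
  apply: Ck_scale; last exact: Ck_cst.
  apply: Ck_mul; first exact: Ck_cst.
  exact: Ck_mul.
Qed.

Lemma zeta_normal t0 a V xi Y t :
  zeta J (normal_geodesic t0 a V xi Y t) (normal_velocity t0 a V xi t) = 0.
Proof.
rewrite /zeta /normal_geodesic /normal_velocity /= n_bracketZr n_bracketDl n_bracketZl.
by rewrite n_bracketxx// scaler0 addr0 scalerA -scalerBl (_ : _ - _ = 0) ?scale0r//; field; rewrite chN0.
Qed.

Lemma expR_normal (t0 a t : R) :
  expR (- (a - 2 * ln (ch (t + t0) / 2))) = expR (- a) * (ch (t + t0) ^+ 2 / 4).
Proof.
have c2 : 0 < ch (t + t0) / 2 by rewrite divr_gt0 ?ch_gt0.
rewrite opprB addrC expRD; congr (_ * _).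
by rewrite [2 * _]mulrC mulr_natr mulr2n expRD lnK ?posrE//; field.
Qed.

Lemma expR_halfN (a : R) : expR (- a) * (expR (a / 2) * expR (a / 2)) = 1.
Proof. by rewrite -expR_half expRNr. Qed.

Lemma normal_geodesic_geodesic t0 a V xi Y : dot xi xi = 1 ->
  geodesic g (normal_geodesic t0 a V xi Y).
Proof.
move=> x1; apply: (horizontal_geodesic cJ (@smooth_normal_geodesic t0 a V xi Y)
  (@HD_normal_geodesic t0 a V xi Y) (@HD_normal_velocity t0 a V xi)) => t.
split; first exact: zeta_normal.
- rewrite /normal_geodesic /normal_velocity /normal_acceleration /= expR_normal.
  rewrite dotZl dotZr x1 mulr1.
  transitivity (- (2 / ch (t + t0) ^+ 2) * (expR (- a) * (expR (a / 2) * expR (a / 2)))).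
    by rewrite expR_halfN mulr1.
  by field; rewrite chN0.
- rewrite /normal_geodesic /normal_velocity /normal_acceleration /=.
  by rewrite scalerA; congr (_ *: _); field; rewrite chN0.
Qed.

Lemma normal_geodesic_unit t0 a V xi Y t : dot xi xi = 1 ->
  let c := normal_geodesic t0 a V xi Y t in
  let v := normal_velocity t0 a V xi t in g c v v = 1.
Proof.
move=> x1 c v; rewrite an_metricE /c /v zeta_normal.
rewrite (dot0l 0) mulr0 addr0 /normal_geodesic /normal_velocity /= expR_normal.
rewrite dotZl dotZr x1 mulr1.
transitivity (sh (t + t0) ^+ 2 / ch (t + t0) ^+ 2 +
    4 / ch (t + t0) ^+ 2 * (expR (- a) * (expR (a / 2) * expR (a / 2)))).
  by field; rewrite chN0.
by rewrite expR_halfN mulr1 -mulrDl -chsh divff// expf_neq0.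
Qed.

Lemma height_normal t0 a V xi Y t : P *m V = 0 -> P *m xi = xi -> dot xi xi = 1 ->
  height (normal_geodesic t0 a V xi Y t) = sh (t + t0) ^+ 2.
Proof.
move=> PV Px x1; rewrite /height /normal_geodesic /= mulmxDr -scalemxAr PV Px add0r.
rewrite expR_normal dotZl dotZr x1 mulr1.
transitivity (sh (t + t0) ^+ 2 * (expR (- a) * (expR (a / 2) * expR (a / 2)))).
  by field; rewrite chN0.
by rewrite expR_halfN mulr1.
Qed.

(** The direction [xi] is that of [P U], and the other parameters are read off
   the coordinates of the point one after the other. *)
Lemma through_level r t0 q : 0 < r + t0 -> level (r + t0) q -> exists a V xi Y,
  [/\ P *m V = 0, P *m xi = xi, dot xi xi = 1 & q = normal_geodesic t0 a V xi Y r].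
Proof.
move=> r0 lq; case: q lq => [[b U] X] lq.
pose a := b + 2 * ln (ch (r + t0) / 2).
have c2 : 0 < ch (r + t0) / 2 by rewrite divr_gt0 ?ch_gt0.
have s0 := sh_gt0 r0.
pose k := expR (a / 2) * (2 * sh (r + t0) / ch (r + t0)).
have kE : k = expR (b / 2) * sh (r + t0).
  rewrite /k /a mulrDl mulrAC divff// mul1r expRD lnK ?posrE//.
  by field; rewrite chN0.
have k0 : 0 < k by rewrite kE mulr_gt0 ?expR_gt0.
have kk : dot (P *m U) (P *m U) = k ^+ 2.
  have : expR (- b) * dot (P *m U) (P *m U) = sh (r + t0) ^+ 2 by exact: lq.
  move=> H; rewrite kE exprMn -H -[LHS]mul1r -{1}(expR_halfN b); ring.
pose xi := k^-1 *: (P *m U).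
have kxi : k *: xi = P *m U by rewrite /xi scalerA mulfV ?scale1r// gt_eqF.
exists a, (U - P *m U), xi, (X - (expR (a / 2) * (sh (r + t0) / ch (r + t0))) *: br (U - P *m U) xi).
split.
- by rewrite mulmxBr PP subrr.
- by rewrite /xi -scalemxAr PP.
- by rewrite /xi dotZl dotZr kk; field; rewrite gt_eqF.
- rewrite /normal_geodesic -/k kxi !subrK; congr (_, _, _).
  by rewrite /a addrK.
Qed.

(** A geodesic with horizontal initial velocity, followed through the vector
   exp(-r/2) P U, which solves a linear equation with constant coefficients. *)
Lemma height_geodesic c : geodesic g c -> zeta J (c 0) (derive1 c 0) = 0 ->
  g (c 0) (derive1 c 0) (derive1 c 0) = 1 ->
  forall t, expR (- (c t).1.1 / 2) *: (P *m (c t).1.2) =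
    (sh t * expR (- (c 0).1.1 / 2)) *:
      (P *m (derive1 c 0).1.2 - ((derive1 c 0).1.1 / 2) *: (P *m (c 0).1.2)) +
    (ch t * expR (- (c 0).1.1 / 2) / 2) *: (P *m (c 0).1.2).
Proof.
move=> Gc z0; have [c1 [c2 [Hc Hc1 c10 eqn]]] := geodesic_horizontal cJ Gc z0.
rewrite -c10 => {z0} g1 t.
pose E t := (c1 t).1.1 * (c1 t).1.1 + expR (- (c t).1.1) * dot (c1 t).1.2 (c1 t).1.2.
have E1 s : E s = 1.
  have HE u : has_deriv E u 1 0.
    apply: HD_eq.
      apply: HD_add.
        exact: HD_mul (HD_A (Hc1 u)) (HD_A (Hc1 u)).
      exact: HD_mul (HD_exp (HD_opp (HD_A (Hc u)))) (HD_dot (HD_U (Hc1 u)) (HD_U (Hc1 u))).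
    have [_ -> ->] := eqn u; by rewrite dotZl dotZr; field.
  rewrite (HD0_constant HE s 0) -g1 an_metricE /E.
  by have [-> _ _] := eqn 0; rewrite (dot0l 0) mulr0 addr0.
apply/colP => i; rewrite -!dot_delta; set y := delta_mx i 0.
pose f t := expR (- (c t).1.1 / 2) * dot (P *m (c t).1.2) y.
pose f1 t := expR (- (c t).1.1 / 2) *
  (dot (P *m (c1 t).1.2) y - (c1 t).1.1 / 2 * dot (P *m (c t).1.2) y).
have Hh u : has_deriv (fun t => - (c t).1.1 / 2) u 1 (- (c1 u).1.1 / 2).
  apply: HD_eq; first by apply: HD_mul; [exact: HD_opp (HD_A (Hc u)) | exact: HD_cst].
  by rewrite mulr0 add0r.
have HU u : has_deriv (fun t => dot (P *m (c t).1.2) y) u 1 (dot (P *m (c1 u).1.2) y).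
  apply: HD_eq; first exact: HD_dot (HD_P P (HD_U (Hc u))) (HD_cst y u 1).
  by rewrite (dot0r (P *m _)) addr0.
have HU1 u : has_deriv (fun t => dot (P *m (c1 t).1.2) y) u 1 (dot (P *m (c2 u).1.2) y).
  apply: HD_eq; first exact: HD_dot (HD_P P (HD_U (Hc1 u))) (HD_cst y u 1).
  by rewrite (dot0r (P *m _)) addr0.
have Hf u : has_deriv f u 1 (f1 u).
  by apply: HD_eq; [exact: HD_mul (HD_exp (Hh u)) (HU u) | rewrite /f1; field].
have Hf1 u : has_deriv f1 u 1 (f u / 4).
  have Hr2 : has_deriv (fun t => (c1 t).1.1 / 2) u 1 ((c2 u).1.1 / 2).
    apply: HD_eq; first by apply: HD_mul; [exact: HD_A (Hc1 u) | exact: HD_cst].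
    by rewrite mulr0 add0r.
  apply: HD_eq.
    exact: HD_mul (HD_exp (Hh u)) (HD_sub (HU1 u) (HD_mul Hr2 (HU u))).
  have [_ -> ->] := eqn u; rewrite -scalemxAr dotZl /f.
  have := E1 u; rewrite /E => {}E1.
  set x := dot (P *m (c u).1.2) y; set x1 := dot (P *m (c1 u).1.2) y.
  transitivity (expR (- (c u).1.1 / 2) * x / 4 * ((c1 u).1.1 * (c1 u).1.1 + expR (- (c u).1.1) * dot (c1 u).1.2 (c1 u).1.2)); last by rewrite E1 mulr1.
  by field.
have := quarter_ode Hf Hf1 t; rewrite /f /f1 => H.
rewrite dotZl dotDl !dotZl dotBl dotZl H; ring.
Qed.

Lemma heightE (p : AN R m) : height p = dot (expR (- p.1.1 / 2) *: (P *m p.1.2))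
  (expR (- p.1.1 / 2) *: (P *m p.1.2)).
Proof. by rewrite /height dotZl dotZr mulrA -expR_half. Qed.

(** Along a geodesic leaving [S] orthogonally exp(-r/2) P U grows as [sh], so that
   [height] is [sh^2] of the distance travelled; and the explicit geodesics reach
   every point where [height] has this value. *)
Lemma tube_level r : 0 < r -> tube g S r = level r.
Proof.
move=> r0; apply/seteqP; split.
  move=> _ [c [Gc Sc nc g1 ->]].
  have [x0 zx Px] := (normal_S cJ Psym PP PW _ Sc).1 nc.
  have := height_geodesic Gc zx g1 r.
  move: Sc; rewrite (S_wE cJ Psym PP PW) /= => PU0.
  move: (derive1 c 0) x0 zx Px g1 => v x0 zx Px g1.
  rewrite PU0 !scaler0 subr0 addr0 => Hr.
  rewrite /level /= heightE Hr dotZl dotZr Px.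
  move: g1; rewrite an_metricE x0 zx (dot0l 0) mul0r add0r mulr0 addr0.
  rewrite (expR_half (- (c 0).1.1)) => g1.
  by rewrite -[RHS]mulr1 -[X in _ = _ * X]g1 /=; ring.
move=> q lq.
have r0' : 0 < r + 0 by rewrite addr0.
have lq' : level (r + 0) q by rewrite addr0.
have [a [V [xi [Y [PV Px x1 ->]]]]] := through_level r0' lq'.
have c10 : derive1 (normal_geodesic 0 a V xi Y) 0 = normal_velocity 0 a V xi 0.
  by apply: derive1_HD; exact: HD_normal_geodesic.
have S0 : S (normal_geodesic 0 a V xi Y 0).
  rewrite (S_wE cJ Psym PP PW) /normal_geodesic /= mulmxDr PV add0r addr0 sh0 mulr0 mul0r mulr0.
  by rewrite scale0r mulmx0.
exists (normal_geodesic 0 a V xi Y); split.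
- exact: normal_geodesic_geodesic.
- exact: S0.
- rewrite c10; apply/(normal_S cJ Psym PP PW) => //; split.
  + by rewrite /normal_velocity /= addr0 sh0 mul0r oppr0.
  + exact: zeta_normal.
  + by rewrite /normal_velocity /= -scalemxAr Px.
- by rewrite c10; exact: normal_geodesic_unit.
- by [].
Qed.

(** ** The unit normal field of the level sets

  It is the velocity of the normal geodesics, expressed through the point
  reached. *)

Definition normal_field (r : R) (p : AN R m) : AN R m :=
  (- (sh r / ch r), (2 / (sh r * ch r)) *: (P *m p.1.2),
   (sh r * ch r)^-1 *: br p.1.2 (P *m p.1.2)).

Lemma smooth_normal_field r : smooth (normal_field r).
Proof.
move=> k; have cid := @Ck_id R (AN R m) k.
have cP : Ck k setT (fun p : AN R m => P *m p.1.2).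
  by apply: (Ck_linear (framed_cV m) (P_linear P)); exact: Ck_U cid.
apply: Ck_pair; first apply: Ck_pair; first exact: Ck_cst.
- by apply: Ck_scale => //; exact: Ck_cst.
- by apply: Ck_scale; [exact: Ck_cst | apply: Ck_br => //; exact: Ck_U cid].
Qed.

Lemma normal_field_geodesic r t0 a V xi Y t : r = t + t0 -> sh r != 0 ->
  P *m V = 0 -> P *m xi = xi ->
  normal_field r (normal_geodesic t0 a V xi Y t) = normal_velocity t0 a V xi t.
Proof.
move=> -> s0 PV Px; rewrite /normal_field /normal_velocity /normal_geodesic /=.
rewrite mulmxDr -scalemxAr PV Px add0r; congr (_, _, _).
- by rewrite scalerA; congr (_ *: _); field; rewrite s0 chN0.
- rewrite n_bracketZr n_bracketDl n_bracketZl n_bracketxx// scaler0 addr0 scalerA.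
  by congr (_ *: _); field; rewrite s0 chN0.
Qed.

Lemma normal_field_zeta r p : zeta J p (normal_field r p) = 0.
Proof.
rewrite /zeta /= n_bracketZr scalerA -scalerBl (_ : _ - _ = 0) ?scale0r//.
by rewrite mulrA mulVf ?mul1r ?subrr.
Qed.

Lemma normal_field_unit r p : 0 < r -> level r p ->
  g p (normal_field r p) (normal_field r p) = 1.
Proof.
move=> r0; rewrite /level /= /height => lp; have s0 := sh_gt0 r0.
rewrite an_metricE normal_field_zeta (dot0l 0) mulr0 addr0 /= dotZl dotZr.
transitivity (sh r ^+ 2 / ch r ^+ 2 + (2 / (sh r * ch r)) ^+ 2 *
  (expR (- p.1.1) * dot (P *m p.1.2) (P *m p.1.2))).
  by field; rewrite chN0 gt_eqF.
rewrite lp; transitivity ((sh r ^+ 2 + 4) / ch r ^+ 2).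
  by field; rewrite chN0 gt_eqF.
by rewrite -chsh divff// expf_neq0.
Qed.

(** The kernel of the differential of [height]. *)
Definition level_tangent (p : AN R m) : set (AN R m) :=
  [set v | 2 * dot (P *m p.1.2) v.1.2 = v.1.1 * dot (P *m p.1.2) (P *m p.1.2)].

Lemma tangent_level_sub r p v : tangent (level r) p v -> level_tangent p v.
Proof.
move=> [c [sc c0 Lc <-]]; move: (derive1 c 0) (HD_derive1 0 sc) => w Hw.
have := HD_height Psym PP Hw; rewrite c0 => -[_ E0].
have : 'D_1 (fun t : R => height (c t)) 0 = 0.
  transitivity ('D_1 (cst (sh r ^+ 2) : R -> R) (0 : R)); last exact: derive_cst.
  by apply: near_eq_derive; move: Lc; apply: filterS.
rewrite E0 => /eqP; rewrite mulf_eq0 gt_eqF ?expR_gt0//= subr_eq0 => /eqP.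
by [].
Qed.

Lemma normal_field_normal r p v : level_tangent p v -> sh r != 0 -> level r p ->
  g p (normal_field r p) v = 0.
Proof.
rewrite /level_tangent /level /height /= => tv s0 lp.
rewrite an_metricE normal_field_zeta (dot0l (zeta J p v)) mulr0 addr0 /= dotZl.
transitivity (- (sh r / ch r) * v.1.1 + (sh r * ch r)^-1 * expR (- p.1.1) * (2 * dot (P *m p.1.2) v.1.2)).
  by field; rewrite chN0 s0.
rewrite tv; transitivity (- (sh r / ch r) * v.1.1 + (sh r * ch r)^-1 * v.1.1 *
   (expR (- p.1.1) * dot (P *m p.1.2) (P *m p.1.2))); first by ring.
by rewrite lp; field; rewrite chN0 s0.
Qed.

Lemma PU_neq0 r p : 0 < r -> level r p -> 0 < dot (P *m p.1.2) (P *m p.1.2).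
Proof.
move=> r0; rewrite /level /height /= => lp; have s0 := sh_gt0 r0.
have : 0 < expR (- p.1.1) * dot (P *m p.1.2) (P *m p.1.2) by rewrite lp exprn_gt0.
by rewrite pmulr_rgt0 ?expR_gt0.
Qed.

(** A tangent vector is the velocity of a curve along which [P U] keeps a
   nonzero component in its initial direction, so that the remaining
   coordinate can be solved for at all times. *)
Lemma tangent_level r p v : 0 < r -> level r p -> level_tangent p v ->
  tangent (level r) p v.
Proof.
move=> r0 lp tv; have s0 := sh_gt0 r0; have U0 := PU_neq0 r0 lp.
set A := dot (P *m p.1.2) (P *m p.1.2) in U0 tv.
pose al := v.1.1 / 2; pose W := P *m v.1.2 - al *: (P *m p.1.2).
have PWW : P *m W = W by rewrite /W mulmxBr -scalemxAr !PP.
have UW : dot (P *m p.1.2) W = 0.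
  rewrite /W dotBr dotZr -/A -Psym PP; move: tv; rewrite /level_tangent /= -/A /al.
  lra.
pose G (t : R) := expR (2 * al * t) * A + t * t * dot W W.
have G0 t : 0 < G t.
  by rewrite ltr_wpDr ?mulr_gt0 ?expR_gt0// mulr_ge0 ?dot_ge0// -expr2 sqr_ge0.
pose h (t : R) := expR (al * t) - 1 - al * t.
pose c t : AN R m := (ln (G t / sh r ^+ 2), p.1.2 + t *: v.1.2 + h t *: (P *m p.1.2), p.2 + t *: v.2).
have PUt t : P *m (c t).1.2 = expR (al * t) *: (P *m p.1.2) + t *: W.
  rewrite /c /= !mulmxDr -!scalemxAr PP /W /h.
  by apply/colP => i; rewrite !mxE; ring.
clearbody W.
have Lc t : level r (c t).
  have Gs : 0 < G t / sh r ^+ 2 by rewrite divr_gt0// exprn_gt0.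
  rewrite /level /= /height PUt /= expRN lnK ?posrE//.
  rewrite !(dotDl, dotDr, dotZl, dotZr) UW [dot W _]dotC UW -/A.
  have -> : expR (al * t) * (expR (al * t) * A + t * 0) +
      t * (expR (al * t) * 0 + t * dot W W) = G t.
    rewrite /G (_ : 2 * al * t = al * t + al * t); first by rewrite expRD; ring.
    by ring.
  by field; rewrite !gt_eqF.
have Hal (b t : R) : has_deriv (fun t : R => b * t) t 1 b.
  apply: HD_eq; first by apply: HD_mul; [exact: HD_cst | exact: HD_id].
  by rewrite mulr1 mul0r addr0.
have HG : has_deriv G 0 1 (2 * al * A).
  apply: HD_eq.
    apply: HD_add.
      by apply: HD_mul; [exact: HD_exp (Hal _ 0) | exact: HD_cst].
    apply: HD_mul; last exact: HD_cst.
    by apply: HD_mul; exact: HD_id.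
  by rewrite /= !mulr0 expR0; ring.
have G00 : G 0 = A by rewrite /G mulr0 expR0; ring.
have Gs0 : 0 < G 0 / sh r ^+ 2 by rewrite divr_gt0// exprn_gt0.
exists c; split.
- move=> k; have cid := @Ck_id R R k.
  have cl (b : R) : Ck k setT (fun t : R => b * t) by apply: Ck_mul => //; exact: Ck_cst.
  apply: Ck_pair; first apply: Ck_pair.
  + apply: Ck_ln; first by move=> t; rewrite divr_gt0// exprn_gt0.
    apply: Ck_mul; last exact: Ck_cst.
    apply: Ck_add.
      by apply: Ck_mul; [exact: Ck_exp (cl _) | exact: Ck_cst].
    by apply: Ck_mul; [exact: Ck_mul | exact: Ck_cst].
  + apply: Ck_add; first (apply: Ck_add; first exact: Ck_cst).
    * by apply: Ck_scale => //; exact: Ck_cst.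
    * apply: Ck_scale; last exact: Ck_cst.
      apply: Ck_sub => //; apply: Ck_sub; last exact: Ck_cst.
      exact: Ck_exp (cl _).
  + apply: Ck_add; first exact: Ck_cst.
    by apply: Ck_scale => //; exact: Ck_cst.
- rewrite /c G00 /h mulr0 expR0 !scale0r !addr0 subrr subr0 scale0r addr0.
  have -> : A / sh r ^+ 2 = expR p.1.1.
    move: lp; rewrite /level /= /height -/A => <-.
    rewrite expRN; field; rewrite !gt_eqF ?expR_gt0//.
  by rewrite expRK -!surjective_pairing.
- by apply: filterE => t; exact: Lc.
- apply: derive1_HD; apply: HD_eq.
    apply: HD_pair; first apply: HD_pair.
    + apply: HD_ln => //.
      by apply: HD_mul; [exact: HG | exact: HD_cst].
    + apply: HD_add; first apply: HD_add; first exact: HD_cst.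
        by apply: HD_scale; [exact: HD_id | exact: HD_cst].
      apply: HD_scale; last exact: HD_cst.
      apply: HD_sub; last exact: Hal.
      by apply: HD_sub; [exact: HD_exp (Hal _ 0) | exact: HD_cst].
    + apply: HD_add; first exact: HD_cst.
      by apply: HD_scale; [exact: HD_id | exact: HD_cst].
  rewrite /= G00 !mulr0 expR0 mul1r subr0 subrr !scale0r !scaler0 !add0r !scale1r.
  rewrite !addr0; rewrite [RHS](_ : v = (v.1.1, v.1.2, v.2)); last by rewrite -!surjective_pairing.
  congr (_, _, _); by rewrite /al; field; rewrite !gt_eqF.
Qed.

Lemma height_grad r p : 0 < r -> level r p ->
  'd (fun q => height q) p (1, 0, 0) = - sh r ^+ 2.
Proof.
move=> r0 lp; have := HD_height Psym PP (HD_id p (1, 0, 0)) => -[d].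
rewrite deriveE// => ->; rewrite /= (dot0r (P *m _)) mulr0 sub0r mul1r mulrN.
by move: lp; rewrite /level /= /height => ->.
Qed.

Lemma submanifold_level r : 0 < r -> submanifold 1 (level r).
Proof.
move=> r0 p lp.
pose f (q : AN R m) : 'rV[R]_1 := (height q - sh r ^+ 2) *: const_mx 1.
have cf k : Ck k setT f.
  apply: Ck_scale; last exact: Ck_cst.
  by apply: Ck_sub; [exact: smooth_height | exact: Ck_cst].
have f0 q : level r q <-> f q = 0.
  rewrite /level /= /f; split=> [->|]; first by rewrite subrr scale0r.
  by move=> /matrixP/(_ 0 0); rewrite !mxE mulr1 => /eqP; rewrite subr_eq0 => /eqP.
exists setT, f; split => //; first exact: openT.
move=> q _ lq y _; have s0 := sh_gt0 r0.
have Hf v : has_deriv f q v ('d (fun q => height q) q v *: const_mx 1).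
  have dh : differentiable (fun q => height q) q by exact: ((smooth_height P 1%N).1 q I).
  apply: HD_eq.
    apply: HD_scale; last exact: HD_cst.
    by apply: HD_sub; [exact: (conj dh erefl) | exact: HD_cst].
  by rewrite scaler0 add0r subr0 deriveE.
exists ((- y 0 0 / sh r ^+ 2) *: (1, 0, 0)) => //.
rewrite linearZ /=; case: (Hf (1, 0, 0)) => d; rewrite deriveE// => ->.
rewrite (height_grad r0 lq).
by apply/matrixP => i j; rewrite !mxE !ord1; field; rewrite gt_eqF.
Qed.

(** The geodesics in the direction of the normal field are those of
   [through_level] again; by [height_geodesic] and the addition formula
   for [sh], [height] is sh^2 (r + t) after time t. *)
Lemma parallel_level r t : 0 < r -> 0 < r + t ->
  parallel_hypersurface g (level r) (normal_field r) t = level (r + t).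
Proof.
move=> r0 rt; have s0 := sh_gt0 r0; apply/seteqP; split.
  move=> _ [c [Gc Lc c1 ->]].
  have z0 : zeta J (c 0) (derive1 c 0) = 0 by rewrite c1 normal_field_zeta.
  have g1 : g (c 0) (derive1 c 0) (derive1 c 0) = 1 by rewrite c1 normal_field_unit.
  have := height_geodesic Gc z0 g1 t; rewrite c1 /= -!scalemxAr PP => Hr.
  have cs := chsh r.
  have cst : sh (r + t) = sh r * (ch t / 2) + ch r / 2 * sh t.
    have e1 : expR ((r + t) / 2) = expR (r / 2) * expR (t / 2).
      by rewrite -expRD mulrDl.
    have e2 : expR (- ((r + t) / 2)) = expR (- (r / 2)) * expR (- (t / 2)).
      by rewrite -expRD mulrDl opprD.
    by rewrite /sh /ch e1 e2; field.
  have k : expR (- (c t).1.1 / 2) *: (P *m (c t).1.2) =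
      (sh (r + t) / sh r * expR (- (c 0).1.1 / 2)) *: (P *m (c 0).1.2).
    rewrite Hr -scalerBl scalerA -scalerDl; congr (_ *: _).
    rewrite cst.
    have ks : 2 / (sh r * ch r) - - (sh r / ch r) / 2 = ch r / (2 * sh r).
      transitivity ((sh r ^+ 2 + 4) / (2 * sh r * ch r)).
        by field; rewrite chN0 gt_eqF.
      by rewrite -cs; field; rewrite chN0 gt_eqF.
    by rewrite ks; field; rewrite gt_eqF.
  rewrite /level /= heightE k dotZl dotZr.
  move: Lc; rewrite /level /= /height expR_half => Lc.
  transitivity ((sh (r + t) / sh r) ^+ 2 * (expR (- (c 0).1.1 / 2) * expR (- (c 0).1.1 / 2) *
     dot (P *m (c 0).1.2) (P *m (c 0).1.2))); first by ring.
  by rewrite Lc; field; rewrite gt_eqF.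
move=> q lq; have tr : 0 < t + r by rewrite addrC.
have lq' : level (t + r) q by rewrite addrC.
have [a [V [xi [Y [PV Px x1 qE]]]]] := through_level tr lq'.
exists (normal_geodesic r a V xi Y); split.
- exact: normal_geodesic_geodesic.
- by rewrite /level /= height_normal// add0r.
- rewrite (normal_field_geodesic (r := r))//; last 2 first.
    by rewrite add0r.
    by rewrite gt_eqF.
  exact: derive1_HD (HD_normal_geodesic _ _ _ _ _ _).
- exact: qE.
Qed.

End Tubes.

(** * Diagonalization of symmetric forms *)

Section Spectral.
Context {R : realType} {V : lmodType R} {I : finType}.
Context (ip beta : V -> V -> R) (b : I -> V).
Hypothesis ipC : forall x y, ip x y = ip y x.
Hypothesis ipL : forall y, linear (ip^~ y : V -> R).
Hypothesis betaC : forall x y, beta x y = beta y x.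
Hypothesis betaL : forall y, linear (beta^~ y : V -> R).
Hypothesis bb : forall i j, ip (b i) (b j) = (i == j)%:R.
Hypothesis bE : forall x, x = \sum_i ip x (b i) *: b i.

Let form_DZ (f : V -> V -> R) (fL : forall y, linear (f^~ y : V -> R)) a x y z :
  f (a *: x + y) z = a * f x z + f y z.
Proof. exact: fL. Qed.

Let form0 (f : V -> V -> R) (fL : forall y, linear (f^~ y : V -> R)) z : f 0 z = 0.
Proof. by have := form_DZ fL (-1) 0 0 z; rewrite scaler0 addr0 mulN1r addNr. Qed.

Let formZ (f : V -> V -> R) (fL : forall y, linear (f^~ y : V -> R)) a x z :
  f (a *: x) z = a * f x z.
Proof. by have := form_DZ fL a x 0 z; rewrite addr0 form0// addr0. Qed.

Let form_sum (f : V -> V -> R) (fL : forall y, linear (f^~ y : V -> R))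
    (K : finType) (c : K -> R) (u : K -> V) z :
  f (\sum_i c i *: u i) z = \sum_i c i * f (u i) z.
Proof. exact: (linear_sumE (index_enum K) c u (fL z)). Qed.

Lemma form_coord x y : ip x y = \sum_i ip x (b i) * ip y (b i).
Proof.
by rewrite {1}(bE x) (form_sum ipL); apply: eq_bigr => i _; rewrite (ipC (b i)).
Qed.

Let ip_eq0 x : ip x x = 0 -> x = 0.
Proof.
rewrite form_coord => /eqP; rewrite psumr_eq0; last by move=> i _; rewrite -expr2 sqr_ge0.
move=> /allP x0; rewrite (bE x) big1// => i _.
by have /eqP := x0 i (mem_index_enum i); rewrite -expr2 => /eqP; rewrite expf_eq0 => /eqP ->; rewrite scale0r.
Qed.

Let ip_ge0 x : 0 <= ip x x.
Proof. by rewrite form_coord sumr_ge0// => i _; rewrite -expr2 sqr_ge0. Qed.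

(** In coordinates the vectors in question form a compact set. *)
Lemma rayleigh_max (k : nat) (u : 'I_k -> V) x1 :
  (forall i, ip x1 (u i) = 0) -> ip x1 x1 = 1 ->
  exists x0, [/\ forall i, ip x0 (u i) = 0, ip x0 x0 = 1 &
    forall x, (forall i, ip x (u i) = 0) -> ip x x = 1 -> beta x x <= beta x0 x0].
Proof.
move=> x1u x11; pose N := #|I|.
pose L (z : 'rV[R]_N) : V := \sum_i z 0 (enum_rank i) *: b i.
pose C x : 'rV[R]_N := \row_j ip x (b (enum_val j)).
have CK x : L (C x) = x.
  by rewrite {2}(bE x); apply: eq_bigr => i _; rewrite mxE enum_rankK.
have Lip z w : ip (L z) w = \sum_i z 0 (enum_rank i) * ip (b i) w by exact: (form_sum ipL).
have Lb z i : ip (L z) (b i) = z 0 (enum_rank i).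
  rewrite Lip (bigD1 i)//= bb eqxx mulr1 big1 ?addr0// => j ji.
  by rewrite bb (negbTE ji) mulr0.
have Lz z : ip (L z) (L z) = \sum_i z 0 (enum_rank i) * z 0 (enum_rank i).
  by rewrite form_coord; apply: eq_bigr => i _; rewrite !Lb.
have Lbeta z : beta (L z) (L z) = \sum_i z 0 (enum_rank i) *
    \sum_j z 0 (enum_rank j) * beta (b j) (b i).
  rewrite (form_sum betaL); apply: eq_bigr => i _; rewrite betaC.
  by rewrite (form_sum betaL).
have cc i : Ck 0 [set: 'rV[R]_N] (fun z => z 0 i).
  by move=> z _; exact: coord_continuous.
pose F (z : 'rV[R]_N) : R := (\sum_i z 0 (enum_rank i) * z 0 (enum_rank i) - 1) *
  (\sum_i z 0 (enum_rank i) * z 0 (enum_rank i) - 1) +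
  \sum_(i < k) (\sum_j z 0 (enum_rank j) * ip (b j) (u i)) *
               (\sum_j z 0 (enum_rank j) * ip (b j) (u i)).
have cF : Ck 0 setT F.
  have c1 : Ck 0 setT (fun z : 'rV[R]_N => \sum_i z 0 (enum_rank i) * z 0 (enum_rank i) - 1).
    apply: Ck_add; last exact: Ck_cst.
    by apply: Ck_sum => i; exact: Ck_mul (cc _) (cc _).
  apply: Ck_add; first exact: Ck_mul.
  apply: Ck_sum => i; have ci : Ck 0 setT (fun z : 'rV[R]_N => \sum_j z 0 (enum_rank j) * ip (b j) (u i)).
    by apply: Ck_sum => j; apply: Ck_mul (cc _) _; exact: Ck_cst.
  exact: Ck_mul.
have F0 z : F z = 0 <-> (forall i, ip (L z) (u i) = 0) /\ ip (L z) (L z) = 1.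
  rewrite /F -Lz; under eq_bigr do rewrite -Lip.
  split=> [/eqP|[Lu ->]]; last first.
    by rewrite subrr mulr0 add0r big1// => i _; rewrite Lu mulr0.
  rewrite paddr_eq0; last 2 first.
  - by rewrite -expr2 sqr_ge0.
  - by apply: sumr_ge0 => i _; rewrite -expr2 sqr_ge0.
  rewrite -expr2 expf_eq0 /= subr_eq0 => /andP[/eqP ->].
  rewrite psumr_eq0; last by move=> i _; rewrite -expr2 sqr_ge0.
  move=> /allP Lu; split => // i; have := Lu i (mem_index_enum i).
  by rewrite -expr2 expf_eq0 /= => /eqP.
have cK : compact [set z | F z = 0].
  apply: (@subclosed_compact _ _ [set z : 'rV[R]_N | forall i, z 0 i \in `[-1, 1]]).
  - apply: (@closed_comp _ _ F [set x : R | x = 0]); last exact: closed_eq.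
    by move=> z _; exact: cF.
  - apply: (@rV_compact _ _ (fun=> `[(-1 : R), 1]%classic)).
    by move=> _; exact: segment_compact.
  - move=> z /F0[_]; rewrite Lz => z1 j; rewrite in_itv /= -ler_norml.
    rewrite -(@ler_pXn2r _ 2)// ?nnegrE// expr1n real_normK ?num_real// -z1.
    rewrite (bigD1 (enum_val j))//= enum_valK expr2 lerDl.
    by apply: sumr_ge0 => i _; rewrite -expr2 sqr_ge0.
have cb : Ck 0 setT (fun z : 'rV[R]_N => beta (L z) (L z)).
  apply: (Ck_ext Lbeta); apply: Ck_sum => i; apply: Ck_mul => //.
  by apply: Ck_sum => j; apply: Ck_mul (cc _) _; exact: Ck_cst.
have [||z0 /set_mem/F0[z0u z01] zmax] := EVT_max_rV _ cK _ (f := fun z => beta (L z) (L z)).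
- by exists (C x1); apply/F0; rewrite CK.
- by apply: continuous_subspaceT => z; exact: cb.
exists (L z0); split => // x xu xx.
have /zmax : C x \in [set z | F z = 0] by apply/mem_set/F0; rewrite CK.
by rewrite CK.
Qed.

Lemma rayleigh_eigenvector (k : nat) (u : 'I_k -> V) x1 :
  (forall i, ip x1 (u i) = 0) -> x1 != 0 ->
  exists x0 l, [/\ forall i, ip x0 (u i) = 0, ip x0 x0 = 1 &
    forall y, (forall i, ip y (u i) = 0) -> beta x0 y = l * ip x0 y].
Proof.
move=> x1u x10.
have nz x : x != 0 -> 0 < ip x x.
  by move=> x0; rewrite lt_neqAle ip_ge0 andbT eq_sym; apply: contra x0 => /eqP/ip_eq0 ->.
have unit x : x != 0 -> let y := (Num.sqrt (ip x x))^-1 *: x in ip y y = 1.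
  move=> /nz x0 y; rewrite /y (formZ ipL) ipC (formZ ipL) mulrA -expr2 exprVn.
  by rewrite sqr_sqrtr ?ltW// mulVf// gt_eqF.
have [||x0 [x0u x01 xmax]] := @rayleigh_max k u ((Num.sqrt (ip x1 x1))^-1 *: x1).
- by move=> i; rewrite (formZ ipL) x1u mulr0.
- exact: unit.
have le x : (forall i, ip x (u i) = 0) -> beta x x <= beta x0 x0 * ip x x.
  move=> xu; have [->|xn0] := eqVneq x 0; first by rewrite (form0 ipL) (form0 betaL) mulr0.
  have := xmax _ _ (unit _ xn0); rewrite (formZ betaL) betaC (formZ betaL) mulrA -expr2 exprVn.
  rewrite sqr_sqrtr ?ip_ge0// mulrC ler_pdivrMr ?nz//; apply=> i.
  by rewrite (formZ ipL) xu mulr0.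
suff crit z : (forall i, ip z (u i) = 0) -> ip x0 z = 0 -> beta x0 z = 0.
  exists x0, (beta x0 x0); split=> // y yu.
  have : beta x0 ((- ip x0 y) *: x0 + y) = 0.
    apply: crit => [i|]; first by rewrite (form_DZ ipL) x0u yu mulr0 addr0.
    by rewrite ipC (form_DZ ipL) x01 mulr1 (ipC y) addNr.
  rewrite betaC (form_DZ betaL) (betaC y) => /eqP.
  by rewrite mulNr addrC subr_eq0 => /eqP ->; rewrite mulrC.
(* the first variation of the quotient at its maximum *)
move=> zu xz; set B := beta x0 z; pose D := beta z z - beta x0 x0 * ip z z.
have var t : 2 * t * B + t ^+ 2 * D <= 0.
  have := le (t *: z + x0); rewrite !(form_DZ betaL, form_DZ ipL).
  rewrite [beta z (_ + _)]betaC [beta x0 (_ + _)]betaC [ip z (_ + _)]ipC [ip x0 (_ + _)]ipC.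
  rewrite !(form_DZ betaL, form_DZ ipL) (ipC z x0) (betaC z x0) xz x01 -/B => H.
  rewrite -subr_ge0; have := H _; rewrite -subr_ge0 /D => {}H.
  apply: le_trans (H _) _; first by move=> i; rewrite (form_DZ ipL) x0u zu mulr0 addr0.
  by rewrite le_eqVlt; apply/orP; left; apply/eqP; ring.
have d0 : 0 < `|D| + 1 by rewrite ltr_wpDl.
have := var (B / (`|D| + 1)).
have -> : 2 * (B / (`|D| + 1)) * B + (B / (`|D| + 1)) ^+ 2 * D =
    B ^+ 2 * ((`|D| + 1) + ((`|D| + D) + 1)) / (`|D| + 1) ^+ 2 by field; rewrite gt_eqF.
rewrite pmulr_lle0 ?invr_gt0 ?exprn_gt0// pmulr_lle0; last first.
  have : 0 <= `|D| + D by rewrite -lerBlDr sub0r -normrN ler_norm.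
  by move=> ?; rewrite addr_gt0// ltr_wpDl.
by move=> ?; apply/eqP; rewrite -sqrf_eq0 eq_le sqr_ge0 andbT.
Qed.

(** Bessel's inequality for the vectors of the basis, summed over the basis. *)
Lemma orthonormal_le (k : nat) (e : 'I_k -> V) :
  (forall i j, ip (e i) (e j) = (i == j)%:R) -> (k <= #|I|)%N.
Proof.
move=> ee; have bessel x : \sum_i ip x (e i) ^+ 2 <= ip x x.
  pose s := \sum_i ip x (e i) *: e i.
  have se j : ip s (e j) = ip x (e j).
    rewrite (form_sum ipL) (bigD1 j)//= ee eqxx mulr1 big1 ?addr0// => i ij.
    by rewrite ee (negbTE ij) mulr0.
  have ss : ip s s = \sum_i ip x (e i) ^+ 2.
    by rewrite {1}/s (form_sum ipL); apply: eq_bigr => i _; rewrite (ipC (e i)) se expr2.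
  have xs : ip x s = \sum_i ip x (e i) ^+ 2.
    by rewrite ipC (form_sum ipL); apply: eq_bigr => i _; rewrite ipC expr2.
  have := ip_ge0 ((-1) *: s + x); rewrite (form_DZ ipL) [ip s _]ipC [ip x _]ipC !(form_DZ ipL).
  by rewrite [ip s x]ipC ss xs; lra.
rewrite -(ler_nat R).
have -> : k%:R = \sum_(i < k) ip (e i) (e i) :> R.
  by rewrite (eq_bigr (fun=> 1)) ?sumr_const ?card_ord// => i _; rewrite ee eqxx.
under eq_bigr do rewrite form_coord.
rewrite exchange_big /= -sum1_card natr_sum; apply: ler_sum => i _.
have := bessel (b i); rewrite bb eqxx; apply: le_trans.
by under [leRHS]eq_bigr do rewrite ipC expr2.
Qed.

(** Eigenvectors are found one at a time, orthogonal to [n] and to the preceding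
   ones. Orthonormal families being bounded in size, this comes to an end, which
   it can only do when the family spans the hyperplane orthogonal to [n]. *)
Lemma orthonormal_eigenbasis (n : V) : ip n n = 1 ->
  exists (d : nat) (e : 'I_d -> V) (l : 'I_d -> R),
  [/\ forall i, ip n (e i) = 0, forall i j, ip (e i) (e j) = (i == j)%:R,
      forall x, ip n x = 0 -> x = \sum_i ip x (e i) *: e i &
      forall i x, ip n x = 0 -> beta (e i) x = l i * ip (e i) x].
Proof.
move=> nn.
pose family k (e : 'I_k -> V) (l : 'I_k -> R) :=
  [/\ forall i, ip n (e i) = 0, forall i j, ip (e i) (e j) = (i == j)%:R &
      forall i x, ip n x = 0 -> beta (e i) x = l i * ip (e i) x].
have step k e l : @family k e l ->
    (forall x, ip n x = 0 -> x = \sum_i ip x (e i) *: e i) \/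
    exists e' l', @family k.+1 e' l'.
  move=> [ne ee be]; have [sp|] := pselect (forall x, ip n x = 0 -> x = \sum_i ip x (e i) *: e i).
    by left.
  move=> /existsNP[x /not_implyP[nx xs]]; right.
  pose rest z := z - \sum_i ip z (e i) *: e i.
  have rest_e z j : ip (rest z) (e j) = 0.
    rewrite /rest -scaleN1r addrC (form_DZ ipL) (form_sum ipL) (bigD1 j)//= ee eqxx mulr1.
    by rewrite big1 ?addr0 ?mulN1r ?addNr// => i ij; rewrite ee (negbTE ij) mulr0.
  have rest_n z : ip n z = 0 -> ip (rest z) n = 0.
    move=> nz; rewrite /rest -scaleN1r addrC (form_DZ ipL) (form_sum ipL) big1.
      by rewrite mulr0 add0r ipC.
    by move=> i _; rewrite (ipC (e i)) ne mulr0.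
  pose u (i : 'I_k.+1) := if unlift ord0 i is Some j then e j else n.
  have un z : ip z n = 0 -> (forall j, ip z (e j) = 0) -> forall i, ip z (u i) = 0.
    by move=> zn ze i; rewrite /u; case: (unlift ord0 i).
  have [||x0 [l0 [x0u x01 x0b]]] := @rayleigh_eigenvector _ u (rest x).
  - exact: un (rest_n _ nx) (rest_e x).
  - by rewrite subr_eq0; apply/eqP.
  have x0n : ip n x0 = 0 by have := x0u ord0; rewrite /u unlift_none ipC.
  have x0e j : ip x0 (e j) = 0 by have := x0u (lift ord0 j); rewrite /u liftK.
  pose ext T (t0 : T) (t : 'I_k -> T) (i : 'I_k.+1) := if unlift ord0 i is Some j then t j else t0.
  exists (ext _ x0 e), (ext _ l0 l); split.
  - by move=> i; rewrite /ext; case: (unlift ord0 i).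
  - move=> i j; rewrite /ext; case: (unliftP ord0 i) => [i'|] ->; case: (unliftP ord0 j) => [j'|] ->.
    + by rewrite ee (inj_eq lift_inj).
    + by rewrite ipC x0e eq_sym (negbTE (neq_lift _ _)).
    + by rewrite x0e (negbTE (neq_lift _ _)).
    + by rewrite x01 eqxx.
  - move=> i z nz; rewrite /ext; case: (unlift ord0 i) => [j|]; first exact: be.
    have -> : z = \sum_i ip z (e i) *: e i + rest z by rewrite addrC subrK.
    rewrite -[\sum_i _]scale1r betaC ipC (form_DZ betaL) (form_DZ ipL) !(form_sum betaL, form_sum ipL).
    rewrite !big1 ?mulr0 ?add0r; first 1 last.
    + by move=> i' _; rewrite (ipC (e i')) x0e mulr0.
    + by move=> i' _; rewrite be// (ipC (e i')) x0e !mulr0.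
    by rewrite betaC [in RHS]ipC x0b//; exact: un (rest_n _ nz) (rest_e z).
have main s k e l : @family k e l -> (#|I| - k < s)%N ->
    exists d e' l', @family d e' l' /\ (forall x, ip n x = 0 -> x = \sum_i ip x (e' i) *: e' i).
  elim: s k e l => // s IH k e l fam ks.
  have [sp|[e' [l' fam']]] := step _ _ _ fam; first by exists k, e, l.
  have [_ /orthonormal_le le _] := fam'; apply: IH fam' _.
  by rewrite -ltnS; apply: leq_trans ks; rewrite ltnS ltn_sub2l.
have fam0 : @family 0%N (fun _ => 0) (fun _ => 0) by split; case.
have [d [e [l [[ne ee be] sp]]]] := main _ _ _ _ fam0 (ltnSn _).
by exists d, e, l.
Qed.

End Spectral.

(** * The shape operator of the level sets *)

Section Shape.
Context {R : realType} {m : nat} (J : 'I_3 -> 'M[R]_m) (cJ : canonical_basis J).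
Context (P : 'M[R]_m).
Hypothesis Psym : forall x y, dot (P *m x) y = dot x (P *m y).
Hypothesis PP : forall x : 'cV[R]_m, P *m (P *m x) = P *m x.

Notation g := (an_metric J).
Notation br := (n_bracket J).
Notation height := (height P).
Notation level := (level P).
Notation normal_field := (normal_field J P).
Notation level_tangent := (level_tangent P).

(** The direction of the normal field at a point, up to its length [sh r],
   read at the identity. *)
Definition direction (p : AN R m) : 'cV[R]_m := expR (- p.1.1 / 2) *: (P *m p.1.2).

Let kap (r : R) := 2 / (sh r * ch r).
Let th (r : R) := sh r / ch r.

Definition body_normal (r : R) (eta : 'cV[R]_m) : AN R m := (- th r, kap r *: eta, 0).

(** The covariant derivative of the normal field along X, paired with W; all
   vectors are translated to the identity. *)
Definition shape_form (r : R) (eta : 'cV[R]_m) (X W : AN R m) : R :=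
  kap r * dot (P *m X.1.2) W.1.2 + th r / 2 * dot X.1.2 W.1.2 + th r * dot X.2 W.2
  - kap r / 2 * (dot (br eta X.1.2) W.2 + dot (br eta W.1.2) X.2)
  + kap r / 2 * (W.1.1 * dot eta X.1.2 - X.1.1 * dot eta W.1.2).

(** The part of [shape_form] that is symmetric; on tangent vectors the rest
   cancels. *)
Definition tangent_form (r : R) (eta : 'cV[R]_m) (X W : AN R m) : R :=
  kap r * dot (P *m X.1.2) W.1.2 + th r / 2 * dot X.1.2 W.1.2 + th r * dot X.2 W.2
  - kap r / 2 * (dot (br eta X.1.2) W.2 + dot (br eta W.1.2) X.2).

Lemma an_innerC (X W : AN R m) : an_inner X W = an_inner W X.
Proof. by rewrite /an_inner mulrC (dotC X.1.2) (dotC X.2). Qed.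

Lemma an_basis_orthonormal i j : an_inner (an_basis i : AN R m) (an_basis j) = (i == j)%:R.
Proof.
have dd d (k l : 'I_d) : dot (delta_mx k 0) (delta_mx l 0) = (k == l)%:R :> R.
  by rewrite dot_delta mxE eqxx andbT eq_sym.
case: i => [[[]|i]|i]; case: j => [[[]|j]|j]; rewrite /an_inner /= ?mulr0 ?mulr1 ?mul0r.
- by rewrite !dot0l !addr0.
- by rewrite !dot0l !addr0.
- by rewrite !dot0l !addr0.
- by rewrite !dot0r !addr0.
- by rewrite dd dot0l add0r addr0.
- by rewrite dot0r dot0l !addr0.
- by rewrite !dot0r !addr0.
- by rewrite dot0r dot0l !addr0.
- by rewrite dot0r dd !add0r.
Qed.

Lemma tangent_formC r eta X W : tangent_form r eta X W = tangent_form r eta W X.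
Proof.
rewrite /tangent_form Psym (dotC X.1.2 (P *m _)) (dotC X.1.2 W.1.2) (dotC X.2 W.2).
by rewrite [dot (br eta X.1.2) _ + _]addrC.
Qed.

Lemma tangent_form_linear r eta W : linear ((tangent_form r eta)^~ W : AN R m -> R).
Proof.
move=> a X Y; rewrite /tangent_form /= mulmxDr -scalemxAr n_bracketDr n_bracketZr.
rewrite (dotDl (a *: (P *m X.1.2))) (dotDl (a *: X.1.2)) (dotDl (a *: X.2)).
rewrite (dotDl (a *: br eta X.1.2)) (dotDr (a *: X.2)) !dotZl dotZr.
by rewrite /GRing.scale /=; ring.
Qed.

Lemma shape_form_linear r eta X : linear (shape_form r eta X : AN R m -> R).
Proof.
move=> a V W; rewrite /shape_form /= n_bracketDr n_bracketZr.
rewrite !(dotDr (a *: V.1.2)) !(dotDr (a *: V.2)) (dotDl (a *: br eta V.1.2)).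
by rewrite !dotZl !dotZr /GRing.scale /=; ring.
Qed.

Section OneDirection.
Context (r : R) (eta : 'cV[R]_m).
Hypotheses (r0 : 0 < r) (Pe : P *m eta = eta) (ee : dot eta eta = sh r ^+ 2).

Let s0 : sh r != 0. Proof. by rewrite gt_eqF// sh_gt0. Qed.
Let c0 : ch r != 0 := ch_neq0 r.

Lemma body_normal_unit : an_inner (body_normal r eta) (body_normal r eta) = 1.
Proof.
rewrite /an_inner /= dotZl dotZr ee (dot0l 0) addr0 /kap /th.
transitivity ((sh r ^+ 2 + 4) / ch r ^+ 2); first by field; rewrite s0 c0.
by rewrite -chsh divff// expf_neq0.
Qed.

Lemma body_normalE X : an_inner (body_normal r eta) X = 0 <->
  2 * dot eta X.1.2 = sh r ^+ 2 * X.1.1.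
Proof.
have -> : an_inner (body_normal r eta) X =
    (2 * dot eta X.1.2 - sh r ^+ 2 * X.1.1) / (sh r * ch r).
  by rewrite /an_inner /= dotZl (dot0l X.2) addr0 /kap /th; field; rewrite s0 c0.
split=> [/eqP|->]; last by rewrite subrr mul0r.
by rewrite mulf_eq0 invr_eq0 mulf_eq0 (negbTE s0) (negbTE c0) !orbF subr_eq0 => /eqP.
Qed.

Lemma shape_form_tangent X W : an_inner (body_normal r eta) X = 0 ->
  an_inner (body_normal r eta) W = 0 -> shape_form r eta X W = tangent_form r eta X W.
Proof.
move=> /body_normalE X0 /body_normalE W0; rewrite /shape_form -/(tangent_form r eta X W).
have -> : W.1.1 * dot eta X.1.2 - X.1.1 * dot eta W.1.2 =
    (W.1.1 * (2 * dot eta X.1.2) - X.1.1 * (2 * dot eta W.1.2)) / 2 by field.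
by rewrite X0 W0; field.
Qed.

Lemma shape_form_normal X : an_inner (body_normal r eta) X = 0 ->
  shape_form r eta X (body_normal r eta) = 0.
Proof.
move=> /body_normalE X0; rewrite /shape_form /body_normal /= n_bracketZr n_bracketxx//.
rewrite scaler0 (dot0l X.2) (dot0r X.2) (dot0r (br _ _)) !dotZr Psym Pe ee.
rewrite (dotC X.1.2 eta).
transitivity (kap r / 2 * kap r * (2 * dot eta X.1.2 - sh r ^+ 2 * X.1.1)); first by field.
by rewrite X0 subrr mulr0.
Qed.

(** An eigenvector among tangent vectors is one against every vector, as
   [shape_form] vanishes on the normal direction. *)
Lemma shape_form_eigen X l : an_inner (body_normal r eta) X = 0 ->
  (forall W, an_inner (body_normal r eta) W = 0 -> tangent_form r eta X W = l * an_inner X W) ->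
  forall W, shape_form r eta X W = l * an_inner X W.
Proof.
move=> X0 tX W; set n := body_normal r eta.
pose c := an_inner n W; pose W' := (- c) *: n + W.
have W0 : an_inner n W' = 0.
  by rewrite an_innerC (an_inner_linear n) /= body_normal_unit an_innerC /GRing.scale /= mulr1 addNr.
have -> : W = c *: n + W' by rewrite /W' addrA -scalerDl subrr scale0r add0r.
move: W' W0 => W' W0.
rewrite (shape_form_linear r eta X) shape_form_normal// scaler0 add0r.
rewrite shape_form_tangent// tX// [an_inner X (_ + _)]an_innerC (an_inner_linear X).
by rewrite X0 scaler0 add0r an_innerC.
Qed.

End OneDirection.

(** ** Dependence on the direction *)

Definition rot (A : 'M[R]_m) (p : AN R m) : AN R m := (p.1.1, A *m p.1.2, p.2).

Lemma Sp_dot A x y : Sp J A -> dot (A *m x) (A *m y) = dot x y.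
Proof.
by move=> [A1 _]; rewrite !dotE trmx_mul -mulmxA [A^T *m _]mulmxA A1 mul1mx.
Qed.

Lemma Sp_bracket A x y : Sp J A -> br (A *m x) (A *m y) = br x y.
Proof.
move=> SA; apply/colP => i; rewrite !mxE mulmxA -SA.2 -mulmxA; exact: Sp_dot.
Qed.

Lemma rot_inner A X Y : Sp J A -> an_inner (rot A X) (rot A Y) = an_inner X Y.
Proof. by move=> SA; rewrite /an_inner /= Sp_dot. Qed.

Lemma rot_linear A : linear (rot A).
Proof. by move=> a X Y; rewrite /rot /= mulmxDr -scalemxAr. Qed.

Lemma rot_mul A B p : rot A (rot B p) = rot (A *m B) p.
Proof. by rewrite /rot /= mulmxA. Qed.

Lemma rot1 p : rot 1%:M p = p.
Proof. by rewrite /rot mul1mx -!surjective_pairing. Qed.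

Lemma rot_normal r A eta : rot A (body_normal r eta) = body_normal r (A *m eta).
Proof. by rewrite /rot /= -scalemxAr. Qed.

Lemma rot_shape r A eta X W : Sp J A -> (forall x : 'cV[R]_m, P *m (A *m x) = A *m (P *m x)) ->
  shape_form r (A *m eta) (rot A X) (rot A W) = shape_form r eta X W.
Proof.
by move=> SA PA; rewrite /shape_form /= PA !Sp_dot// !Sp_bracket.
Qed.

(** [Sp] acts on [w_perp] by isometries preserving [shape_form], transitively
   on the directions; hence eigenvalues found in one direction serve all. *)
Definition direction_transitive :=
  forall x y : 'cV[R]_m, P *m x = x -> P *m y = y -> dot x x = 1 -> dot y y = 1 ->
  exists A, [/\ Sp J A, forall z : 'cV[R]_m, P *m (A *m z) = A *m (P *m z) & A *m x = y].

Lemma shape_eigenvalues r : 0 < r -> direction_transitive ->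
  (exists x, P *m x = x /\ dot x x = 1) ->
  exists (d : nat) (l : 'I_d -> R), forall eta, P *m eta = eta -> dot eta eta = sh r ^+ 2 ->
  exists e : 'I_d -> AN R m,
  [/\ forall i, an_inner (body_normal r eta) (e i) = 0,
      forall i j, an_inner (e i) (e j) = (i == j)%:R,
      forall X, an_inner (body_normal r eta) X = 0 -> X = \sum_i an_inner X (e i) *: e i &
      forall i W, shape_form r eta (e i) W = l i * an_inner (e i) W].
Proof.
move=> r0 tr [x1 [Px1 x11]]; have s0 := sh_gt0 r0.
pose eta1 := sh r *: x1.
have Pe1 : P *m eta1 = eta1 by rewrite /eta1 -scalemxAr Px1.
have ee1 : dot eta1 eta1 = sh r ^+ 2 by rewrite /eta1 dotZl dotZr x11 mulr1 expr2.
have [d [e [l [ne eo sp eig]]]] := orthonormal_eigenbasis an_innerC an_inner_linear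
  (tangent_formC r eta1) (tangent_form_linear r eta1)
  an_basis_orthonormal (@an_basisE R m) (body_normal_unit r0 ee1).
exists d, l => eta Pe ee.
have [A [SA PA Ax]] : exists A, [/\ Sp J A, forall z : 'cV[R]_m, P *m (A *m z) = A *m (P *m z) &
    A *m x1 = (sh r)^-1 *: eta].
  apply: tr => //; first by rewrite -scalemxAr Pe.
  by rewrite dotZl dotZr ee; field; rewrite gt_eqF.
have Ae : A *m eta1 = eta by rewrite /eta1 -scalemxAr Ax scalerA mulfV ?scale1r// gt_eqF.
have AA : A *m A^T = 1%:M by exact: mulmx1C SA.1.
have rotK X : rot A (rot A^T X) = X by rewrite rot_mul AA rot1.
exists (fun i => rot A (e i)); split.
- by move=> i; rewrite -Ae -rot_normal rot_inner.
- by move=> i j; rewrite rot_inner.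
- move=> X X0; rewrite -{1}(rotK X).
  rewrite {1}(sp (rot A^T X)); last by rewrite -(rot_inner _ _ SA) rotK rot_normal Ae.
  rewrite (linear_sumE _ _ _ (@rot_linear A)); apply: eq_bigr => i _.
  by rewrite -(rot_inner _ _ SA) rotK.
- move=> i W; rewrite -{1}Ae -{1}(rotK W) rot_shape// -[in RHS](rotK W) rot_inner//.
  by apply: (shape_form_eigen r0 Pe1 ee1 (ne i)) => V; exact: eig.
Qed.

(** ** The derivative of the normal field *)

Lemma direction_P p : P *m direction p = direction p.
Proof. by rewrite /direction -scalemxAr PP. Qed.

Lemma direction_norm r p : level r p -> dot (direction p) (direction p) = sh r ^+ 2.
Proof. by move=> <-; rewrite (heightE P p). Qed.

Lemma body_normal_field r p : body J p (normal_field r p) = body_normal r (direction p).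
Proof.
rewrite /body normal_field_zeta// scaler0 /body_normal /direction /=.
by congr (_, _, _); rewrite !scalerA -/(kap r); congr (_ *: _); rewrite mulrC.
Qed.

Lemma HD_normal_field r (c : R -> AN R m) t v : has_deriv c t 1 v ->
  has_deriv (fun t => normal_field r (c t)) t 1
    (0, kap r *: (P *m v.1.2), (sh r * ch r)^-1 *: (br v.1.2 (P *m (c t).1.2) + br (c t).1.2 (P *m v.1.2))).
Proof.
move=> Hc; have HP := HD_P P (HD_U Hc); apply: HD_pair; first apply: HD_pair.
- exact: HD_cst.
- apply: HD_eq; first by apply: HD_scale; [exact: HD_cst | exact: HP].
  by rewrite scale0r addr0.
- apply: HD_eq.
    by apply: HD_scale; [exact: HD_cst | exact: HD_br (HD_U Hc) HP].
  by rewrite scale0r addr0 addrC.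
Qed.

Lemma normal_derivative r p v w : 0 < r ->
  g p (0, kap r *: (P *m v.1.2), (sh r * ch r)^-1 *: (br v.1.2 (P *m p.1.2) + br p.1.2 (P *m v.1.2))) w
  + christoffel g p v (normal_field r p) w =
  shape_form r (direction p) (body J p v) (body J p w).
Proof.
move=> r0; have s0 := sh_gt0 r0; have c0 := ch_neq0 r.
set D := (X in g p X w).
have zD : zeta J p D = (kap r / 2) *: br v.1.2 (P *m p.1.2).
  rewrite /zeta /D /= n_bracketZr scalerA.
  have -> : 2^-1 * kap r = (sh r * ch r)^-1 by rewrite /kap; field; rewrite c0 gt_eqF.
  rewrite -scalerBr addrK; congr (_ *: _); rewrite /kap.
  by field; rewrite c0 gt_eqF.
rewrite an_metricE christoffelE// normal_field_zeta// zD.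
rewrite (dot0l (zeta J p w)) (dot0r (zeta J p v)) (dot0l (br v.1.2 w.1.2)).
rewrite /D /shape_form /body /direction /normal_field /= -/(kap r) -/(th r).
rewrite -!scalemxAr !(n_bracketZl, n_bracketZr) !(dotZl, dotZr).
rewrite (n_bracketC _ v.1.2)// (dotNl (br v.1.2 _)).
have e2 : expR (- p.1.1) = expR (- p.1.1 / 2) * expR (- p.1.1 / 2) by exact: expR_half.
rewrite (dotC (zeta J p v) (br _ _)) (dotC v.1.2 (P *m p.1.2)) e2.
by field.
Qed.

(** ** Principal curvatures *)

Lemma level_tangentE r p v : 0 < r -> level r p ->
  level_tangent p v <-> an_inner (body_normal r (direction p)) (body J p v) = 0.
Proof.
move=> r0 lp; rewrite -(body_normal_field r p) -an_metric_body; split=> [tv|].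
  by apply: (normal_field_normal J tv) => //; rewrite gt_eqF// sh_gt0.
rewrite an_metric_body body_normal_field => /(body_normalE _ r0).
have -> : dot (direction p) (body J p v).1.2 = expR (- p.1.1) * dot (P *m p.1.2) v.1.2.
  by rewrite /direction /body /= dotZl dotZr mulrA -expR_half.
rewrite -lp /height /=.
have e0 := expR_gt0 (- p.1.1).
move=> H; rewrite /level_tangent /=; apply: (mulfI (lt0r_neq0 e0)).
by rewrite [RHS]mulrCA [RHS]mulrC -H; ring.
Qed.

Lemma level_unit_normal r : 0 < r -> unit_normal_field g (level r) (normal_field r).
Proof.
move=> r0; split.
  move=> p lp; exists setT, (normal_field r); split => //; first exact: openT.
  exact: smooth_normal_field.
move=> p lp; split; last exact: normal_field_unit.
move=> v /(tangent_level_sub Psym PP) tv; apply: (normal_field_normal J tv) lp.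
by rewrite gt_eqF// sh_gt0.
Qed.

Lemma level_principal_curvatures r : 0 < r -> direction_transitive ->
  (exists x, P *m x = x /\ dot x x = 1) ->
  exists (d : nat) (k : 'I_d -> R), forall p, level r p ->
    principal_curvatures g (level r) (normal_field r) p k.
Proof.
move=> r0 tr ex; have [d [l eig]] := shape_eigenvalues r0 tr ex.
exists d, (fun i => - l i) => p lp.
have [e [ne eo sp eg]] := eig _ (direction_P p) (direction_norm lp).
have [f fb] : exists f, forall i, body J p (f i) = e i.
  by exists (fun i => left_invariant J (e i) p) => i; exact: body_left_invariant.
have tf i : tangent (level r) p (f i).
  by apply: (tangent_level Psym PP r0 lp); apply/(level_tangentE _ r0 lp); rewrite fb.
exists f; split.
  split=> //.
  - by move=> i j; rewrite (an_metric_body J p) !fb.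
  - move=> v /(tangent_level_sub Psym PP) /(level_tangentE _ r0 lp) nv.
    rewrite -{1}(left_invariant_body J p v) [X in left_invariant J X p](sp _ nv).
    rewrite (linear_sumE _ _ _ (left_invariant_linear J p)).
    by apply: eq_bigr => i _; rewrite (an_metric_body J p) fb -(fb i) left_invariant_body.
move=> i; have [c [sc cp Lc c1]] := tf i; exists c; split => // w.
have Hc := HD_derive1 0 sc; rewrite c1 in Hc.
rewrite (derive1_HD (HD_normal_field r Hc)) c1 [(normal_field r \o c) 0]/= cp.
have := an_metric_linear J p (f i) 0 w (l i); rewrite addr0 an_metric0l addr0 => El.
by rewrite normal_derivative// fb eg scaleNr opprK El (an_metric_body J p) fb.
Qed.

Lemma level_isoparametric r : 0 < r -> direction_transitive ->
  (exists x, P *m x = x /\ dot x x = 1) ->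
  isoparametric_hypersurface g (level r) /\ constant_principal_curvatures g (level r).
Proof.
move=> r0 tr ex.
have hyp s : 0 < s -> hypersurface (level s).
  move=> s0; split; last exact: submanifold_level.
  have [x [Px x1]] := ex; exists (0, sh s *: x, 0).
  by rewrite /level /= /height /= oppr0 expR0 mul1r -scalemxAr Px dotZl dotZr x1 mulr1 expr2.
have cmc s : 0 < s -> constant_mean_curvature g (level s).
  move=> s0; exists (normal_field s); split; first exact: level_unit_normal.
  have [d [k pk]] := level_principal_curvatures s0 tr ex.
  exists (\sum_i k i) => p lp; have [e [eb ke]] := pk p lp.
  exists d, e, (fun i => k i *: e i); split => //.
  apply: eq_bigr => i _; have [_ eo _] := eb.
  have := an_metric_linear J p (e i) 0 (e i) (k i).
  by rewrite addr0 an_metric0l eo eqxx => ->; rewrite addr0 [RHS]mulr1.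
split.
  split; [exact: hyp | exact: cmc |].
  exists (normal_field r); split; first exact: level_unit_normal.
  have : \forall t \near (0 : R), 0 < r + t.
    apply: filterS (nbhs0_lt r0) => t; rewrite ltr_norml => /andP[rt _].
    by rewrite -ltrBlDl sub0r.
  by apply: filterS => t rt; rewrite parallel_level//; split; [exact: hyp | exact: cmc].
exists (normal_field r); split; first exact: level_unit_normal.
exact: level_principal_curvatures.
Qed.

End Shape.

(** * The cohomogeneity one action *)

Section Action.
Context {R : realType} {m : nat} (J : 'I_3 -> 'M[R]_m) (cJ : canonical_basis J).
Context (Wp : {vspace 'cV[R]_m}) (P : 'M[R]_m).
Hypothesis Psym : forall x y, dot (P *m x) y = dot x (P *m y).
Hypothesis PP : forall x : 'cV[R]_m, P *m (P *m x) = P *m x.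
Hypothesis PW : forall x, x \in Wp <-> P *m x = x.

Notation g := (an_metric J).
Notation br := (n_bracket J).
Notation S := (S_w J Wp).
Notation height := (height P).
Notation level := (level P).
Notation direction := (direction P).

Let SE : S = [set p | P *m p.1.2 = 0] := S_wE cJ Psym PP PW.

Lemma height_ge0 p : 0 <= height p.
Proof. by rewrite mulr_ge0 ?dot_ge0// ltW ?expR_gt0. Qed.

Lemma height_eq0 p : height p = 0 <-> S p.
Proof.
rewrite SE /=; split=> [/eqP|E]; last by rewrite /height E (dot0l 0) mulr0.
by rewrite mulf_eq0 gt_eqF ?expR_gt0//= => /eqP; exact: dot_eq0.
Qed.

Lemma dot_unit_le (x y : 'cV[R]_m) : dot y y = 1 -> dot x y ^+ 2 <= dot x x.
Proof.
move=> yy; have := dot_ge0 (x - dot x y *: y).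
rewrite dotBl !dotBr !dotZl !dotZr yy (dotC y x) => H.
by rewrite -subr_ge0; apply: le_trans H _; rewrite le_eqVlt; apply/orP; left; apply/eqP; ring.
Qed.

(** ** Isometries preserving [S] preserve [height]

  The square root of [height] grows along unit speed curves at most as fast as
  [sh], the solution of y' = sqrt(1 + y^2/4), which it is along the geodesics
  normal to [S]. *)
Lemma sh_growth (f f' : R -> R) r : (forall t, has_deriv f t 1 (f' t)) ->
  (forall t, f' t ^+ 2 <= 1 + f t ^+ 2 / 4) -> f 0 = 0 -> 0 <= r -> f r <= sh r.
Proof.
move=> Hf bf f00 r0.
pose q t := Num.sqrt (1 + f t * f t / 4).
have a0 t : 0 < 1 + f t * f t / 4 by have := sqr_ge0 (f t); rewrite expr2; lra.
have q0 t : 0 < q t by rewrite sqrtr_gt0.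
have qq t : q t ^+ 2 = 1 + f t * f t / 4 by rewrite sqr_sqrtr// ltW.
have u0 t : 0 < f t / 2 + q t.
  rewrite -[f t / 2]opprK addrC subr_gt0.
  rewrite (le_lt_trans (ler_norm _))// -sqrtr_sqr ltr_sqrt// sqrrN.
  by rewrite -subr_gt0 (_ : _ - _ = 1)//; field.
have fq t : f' t <= q t.
  apply: le_trans (ler_norm _) _; rewrite -sqrtr_sqr ler_sqrt; last exact: ltW.
  by rewrite -(expr2 (f t)).
pose psi t := expR (- t / 2) * (f t / 2 + q t).
have Hpsi t : has_deriv psi t 1
    (expR (- t / 2) * ((f t / 2 + q t) / (2 * q t)) * (f' t - q t)).
  have He : has_deriv (fun t : R => expR (- t / 2)) t 1 (expR (- t / 2) * (- 2^-1)).
    apply: HD_exp; apply: HD_eq.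
      by apply: HD_mul; [exact: HD_opp (HD_id _ _) | exact: HD_cst].
    by rewrite mulr0 add0r mulN1r.
  have Ha : has_deriv (fun t => 1 + f t * f t / 4) t 1 (f t * f' t / 2).
    apply: HD_eq.
      apply: HD_add; first exact: HD_cst.
      by apply: HD_mul; [exact: HD_mul (Hf t) (Hf t) | exact: HD_cst].
    by rewrite /=; field.
  apply: HD_eq.
    apply: HD_mul; first exact: He.
    apply: HD_add.
      by apply: HD_mul; [exact: Hf | exact: HD_cst].
    exact: (@HD_sqrt _ _ (fun t => 1 + f t * f t / 4) _ _ _ (a0 t) Ha).
  by rewrite /= -/(q t); field; rewrite gt_eqF.
have dec : psi r <= psi 0.
  apply: (HD_nonincreasing Hpsi) => // t; rewrite mulr_ge0_le0 ?subr_le0//.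
  by rewrite mulr_ge0 ?ltW ?expR_gt0 ?divr_gt0// mulr_gt0.
have psi0 : psi 0 = 1.
  by rewrite /psi /q f00 oppr0 !mul0r expR0 addr0 sqrtr1 add0r mulr1.
move: dec; rewrite psi0 /psi mulNr => dec.
have EF : expR (r / 2) * expR (- (r / 2)) = 1 by rewrite expRxMexpNx_1.
have E0 := expR_gt0 (r / 2); have F0 := expR_gt0 (- (r / 2)).
rewrite /sh; move: dec EF E0 F0 (u0 r) (qq r) (q0 r).
set E := expR (r / 2); set F := expR (- (r / 2)).
move: (q r) (f r) => Q x dec EF E0 F0 u0r QQ Q0.
have uv : (x / 2 + Q) * (Q - x / 2) = 1.
  by transitivity (Q ^+ 2 - x * x / 4); [field | rewrite QQ addrK].
have v0 : 0 < Q - x / 2 by rewrite -(pmulr_rgt0 _ u0r) uv.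
have uE : x / 2 + Q <= E.
  by rewrite -(ler_pM2l F0) [F * E]mulrC EF.
have vF : F <= Q - x / 2.
  by rewrite -(ler_pM2l u0r) uv mulrC.
lra.
Qed.

(** Apply [sh_growth] to the image of the unit speed geodesic that joins [S] to
   [q] in time [r], where [sh r] is the square root of the height of [q]. *)
Lemma isometry_height_le k q : Defs.isometry g k -> (forall s, S s -> S (k s)) ->
  height (k q) <= height q.
Proof.
move=> Ik kS; have [bk sk gk] := Ik.
have [h0|hn] := eqVneq (height q) 0.
  by have /kS/height_eq0 -> : S q; [exact/height_eq0 | exact: height_ge0].
have hq : 0 < height q by rewrite lt_neqAle eq_sym hn height_ge0.
have [r [r0 sr]] : exists r, 0 < r /\ sh r = Num.sqrt (height q).
  by apply: sh_surj; rewrite sqrtr_gt0.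
have sr2 : sh r ^+ 2 = height q by rewrite sr sqr_sqrtr ?height_ge0.
have r0' : 0 < r + 0 by rewrite addr0.
have lq : level (r + 0) q by rewrite addr0 /level /= sr2.
have [a [V [xi [Y [PV Px x1 qE]]]]] := through_level J PP r0' lq.
pose c := normal_geodesic J 0 a V xi Y.
pose d t := k (c t); pose d' t := 'd k (c t) (normal_velocity J 0 a V xi t).
have Hd t : has_deriv d t 1 (d' t).
  have [dc Dc] := HD_normal_geodesic J 0 a V xi Y t.
  apply: (HD_comp (conj dc Dc)); split; first exact: (isometry_diff _ Ik).
  by rewrite deriveE//; exact: (isometry_diff _ Ik).
have d1 t : g (d t) (d' t) (d' t) = 1 by rewrite gk normal_geodesic_unit.
have Sd : P *m (d 0).1.2 = 0.
  have : S (d 0).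
    apply: kS; rewrite SE /= /normal_geodesic /= addr0 sh0 mulr0 mul0r mulr0 scale0r.
    by rewrite addr0.
  by rewrite SE.
have [h1|h1n] := eqVneq (height (k q)) 0; first by rewrite h1 height_ge0.
have hk : 0 < height (k q) by rewrite lt_neqAle eq_sym h1n height_ge0.
pose N := Num.sqrt (height (k q)).
have N0 : 0 < N by rewrite sqrtr_gt0.
have NN : N ^+ 2 = height (k q) by rewrite sqr_sqrtr ?height_ge0.
(* the direction in which the endpoint [k q] lies *)
pose eta := N^-1 *: direction (k q).
have Pe : P *m eta = eta by rewrite /eta -scalemxAr direction_P.
have ee : dot eta eta = 1.
  rewrite /eta dotZl dotZr -(heightE P (k q)) -NN; field; exact: lt0r_neq0.
pose f t := expR (- (d t).1.1 / 2) * dot (P *m (d t).1.2) eta.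
pose f' t := expR (- (d t).1.1 / 2) * dot (d' t).1.2 eta - (d' t).1.1 * (f t / 2).
have Hf t : has_deriv f t 1 (f' t).
  have He : has_deriv (fun t => expR (- (d t).1.1 / 2)) t 1
      (expR (- (d t).1.1 / 2) * (- (d' t).1.1 / 2)).
    apply: HD_exp; apply: HD_eq.
      by apply: HD_mul; [exact: HD_opp (HD_A (Hd t)) | exact: HD_cst].
    by rewrite mulr0 add0r.
  have Hu : has_deriv (fun t => dot (P *m (d t).1.2) eta) t 1 (dot (d' t).1.2 eta).
    apply: HD_eq; first exact: HD_dot (HD_P P (HD_U (Hd t))) (HD_cst eta t 1).
    by rewrite (dot0r (P *m _)) addr0 Psym Pe.
  by apply: HD_eq; [exact: HD_mul He Hu | rewrite /f' /f; field].
have bf t : f' t ^+ 2 <= 1 + f t ^+ 2 / 4.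
  have := d1 t; rewrite an_metricE.
  have := dot_unit_le (d' t).1.2 ee; have := dot_ge0 (zeta J (d t) (d' t)).
  rewrite /f'; set u := dot _ eta; set z := dot _ _; set w := dot _ _.
  set b := (d' t).1.1; move: (f t) => y z0 uw.
  rewrite {1}[expR (- _)]expR_half -mulNr; set e := expR _ => E1.
  have e2 : 0 <= expR (- (d t).1.1) ^+ 2 * z by rewrite mulr_ge0 ?sqr_ge0.
  have eu : (e * u) ^+ 2 <= e * e * w.
    by rewrite exprMn expr2 ler_wpM2l// -expr2 sqr_ge0.
  have bu : b ^+ 2 + (e * u) ^+ 2 <= 1 by rewrite expr2; lra.
  (* Cauchy-Schwarz, for (b, e u) and (- y/2, 1) *)
  apply: (@le_trans _ _ ((b ^+ 2 + (e * u) ^+ 2) * (1 + y ^+ 2 / 4))); last first.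
    by rewrite -[leRHS]mul1r ler_wpM2r// addr_ge0// divr_ge0// sqr_ge0.
  rewrite -subr_ge0; have := sqr_ge0 (e * u * (y / 2) + b).
  by move=> H; apply: le_trans H _; rewrite le_eqVlt; apply/orP; left; apply/eqP; field.
have f00 : f 0 = 0 by rewrite /f Sd (dot0l eta) mulr0.
have fr : f r = N.
  have -> : f r = dot (direction (k q)) eta by rewrite /f /d /c -qE /direction dotZl.
  rewrite /eta dotZr -(heightE P (k q)) -NN; field; exact: lt0r_neq0.
have := sh_growth Hf bf f00 (ltW r0); rewrite fr => NS.
by rewrite -NN -sr2 ler_pXn2r// nnegrE ?ltW// sh_gt0.
Qed.

(** ** The normalizer of [S] *)

Lemma G_group_group : transformation_group (G_group J).
Proof.
apply: identity_component_group; first exact: an_isometry_group.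
by move=> f; exact: isometry_continuous.
Qed.

Lemma G_isometry k : G_group J k -> Defs.isometry g k.
Proof. exact: identity_component_sub. Qed.

Lemma N_K_hom k s : N_K J S k -> S s ->
  S (k s) /\ forall p, k (an_mul J s p) = an_mul J (k s) (k p).
Proof.
move=> [[Gk k0] kS] Ss; have [s' [Ss' E]] := kS _ Ss.
have ks : k s = s'.
  by have := congr1 (fun f => f 0) E; rewrite /= k0 !an_mulp0.
by split=> [|p]; [rewrite ks | rewrite ks; exact: (congr1 (fun f => f p) E)].
Qed.

Lemma S_subgroup : an_subgroup J S.
Proof.
rewrite SE; split.
- by rewrite /= mulmx0.
- by move=> a b /= Ha Hb; rewrite mulmxDr -scalemxAr Ha Hb scaler0 addr0.
- by move=> a /= Ha; rewrite mulmxN -scalemxAr Ha scaler0 oppr0.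
Qed.

Lemma S_one_parameter c : one_parameter_subgroup J c -> (forall t, S (c t)) ->
  P *m (derive1 c 0).1.2 = 0.
Proof.
move=> [sc _] Sc; apply: (tangent_S_complement cJ Psym PP PW (p := c 0)).
by exists c; split => //; exact: filterE.
Qed.

Lemma one_parameter_S c : one_parameter_subgroup J c ->
  P *m (derive1 c 0).1.2 = 0 -> forall t, S (c t).
Proof.
move=> oc Pc t A [_ hA]; apply: hA; exists c, t; split => //.
exact: (complementP Psym PP PW _).2 Pc.
Qed.

(** The differential at 0 of an element of the normalizer is injective on the
   Lie algebra of [S], hence onto; so the image of [S] contains the
   one-parameter subgroups of [S] and is all of [S]. *)
Lemma N_K_onto k s : N_K J S k -> S s -> exists s', S s' /\ k s' = s.
Proof.
move=> Nk; have [[Gk k0] _] := Nk; have [bk sk gk] := G_isometry Gk.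
have kS s1 : S s1 -> S (k s1) by move=> /(N_K_hom Nk)[].
have dk : differentiable k 0 by exact: (isometry_diff _ (G_isometry Gk)).
have oneK c : one_parameter_subgroup J c -> (forall t, S (c t)) ->
    one_parameter_subgroup J (k \o c) /\ derive1 (k \o c) 0 = 'd k 0 (derive1 c 0).
  move=> oc Sc; have [sc cM] := oc; have c0 := one_parameter0 cJ oc.
  split; first split.
  - exact: (smooth_comp (framed_AN) sc sk).
  - by move=> t u; rewrite /= cM; have [_ ->] := N_K_hom Nk (Sc t).
  - apply: derive1_HD; move: (derive1 c 0) (HD_derive1 0 sc) => a Ha.
    apply: (HD_comp Ha); rewrite c0; split => //; by rewrite deriveE.
pose Q (x : AN R m) : AN R m := (x.1.1, x.1.2 - P *m x.1.2, x.2).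
have PQ x : P *m (Q x).1.2 = 0 by rewrite /Q /= mulmxBr PP subrr.
have Qid x : P *m x.1.2 = 0 -> Q x = x.
  by move=> Px; rewrite /Q Px subr0 -!surjective_pairing.
have lQ : linear Q.
  move=> a x y; rewrite /Q /= mulmxDr -scalemxAr; congr (_, _, _).
  by rewrite /= scalerBr opprD addrACA.
have dkS x : P *m x.1.2 = 0 -> P *m ('d k 0 x).1.2 = 0.
  move=> Px; have [c [oc cx]] := one_parameter_exists cJ x.
  have Sc t : S (c t) by apply: one_parameter_S; rewrite ?cx.
  have [okc kc] := oneK c oc Sc; rewrite -cx -kc.
  by apply: S_one_parameter => // t; exact: kS.
have dk0 x : 'd k 0 x = 0 -> x = 0.
  move=> dx; have := gk 0 x x; rewrite dx an_metric0l => /esym gx.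
  rewrite (an_frameE J 0 x) big1// => i _.
  have -> : x = 0; last by rewrite an_metric0l scale0r.
  move: gx; rewrite an_metric_body /an_inner => gx.
  have b0 := dot_ge0 (body J 0 x).1.2; have c0 := dot_ge0 (body J 0 x).2.
  have a0 := sqr_ge0 (body J 0 x).1.1; rewrite expr2 in a0.
  have bx : body J 0 x = 0.
    rewrite [LHS]surjective_pairing [(body J 0 x).1]surjective_pairing.
    congr (_, _, _).
    - by apply/eqP; rewrite -[_ == _]orbb -mulf_eq0; apply/eqP; lra.
    - by apply: dot_eq0; lra.
    - by apply: dot_eq0; lra.
  by rewrite -(left_invariant_body J 0 x) bx left_invariantE /= n_bracket0r !scaler0 addr0.
(* extended by the identity of [w_perp], so as to be an endomorphism of AN *)
pose M x := 'd k 0 (Q x) + (x - Q x).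
have lM : linear M.
  move=> a x y.
  have ld u v : 'd k 0 (a *: u + v) = a *: 'd k 0 u + 'd k 0 v by exact: linearP.
  rewrite /M lQ ld scalerDr [RHS]addrACA; congr (_ + _).
  by rewrite opprD addrACA -scalerBr.
have PM x : P *m (M x).1.2 = P *m x.1.2.
  rewrite /M /= mulmxDr dkS// add0r opprB addrCA subrr addr0.
  by rewrite PP.
have iM x : M x = 0 -> x = 0.
  move=> Mx; have Px : P *m x.1.2 = 0 by rewrite -PM Mx mulmx0.
  by apply: dk0; move: Mx; rewrite /M (Qid x Px) subrr addr0.
have [A [_ _ MA]] := framed_surjective (framed_AN) lM iM.
move=> Ss.
suff : [set s | exists s', S s' /\ k s' = s] s by [].
apply: Ss; split; first split.
- by exists 0; split => //; case: S_subgroup.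
- move=> _ _ [a [Sa <-]] [b [Sb <-]]; exists (an_mul J a b); split.
    by have [_ SM _] := S_subgroup; exact: SM.
  by have [_ ->] := N_K_hom Nk Sa.
- move=> _ [a [Sa <-]]; exists (an_inv a); split.
    by have [_ _ SV] := S_subgroup; exact: SV.
  have [Ska] := N_K_hom Nk Sa; move=> /(_ (an_inv a)); rewrite an_mulV'// k0.
  move=> /(congr1 (an_mul J (an_inv (k a)))).
  by rewrite an_mulA an_mulV// an_mul0 an_mulp0 => ->.
- move=> _ [c [t [oc hc ->]]].
  have Pv : P *m (derive1 c 0).1.2 = 0 by exact: (complementP Psym PP PW _).1 hc.
  have PA : P *m (A (derive1 c 0)).1.2 = 0 by rewrite -PM MA.
  have [b [ob bx]] := one_parameter_exists cJ (A (derive1 c 0)).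
  have Sb u : S (b u) by apply: one_parameter_S; rewrite ?bx.
  have [okb kb] := oneK b ob Sb.
  have -> : c = k \o b.
    apply: (one_parameter_unique cJ oc okb); rewrite kb bx.
    move: PA (MA (derive1 c 0)); move: (A _) => y Py <-.
    by rewrite /M (Qid y Py) subrr addr0.
  by exists (b t).
Qed.

Lemma N_K_group : transformation_group (N_K J S).
Proof.
have [G1 GM GV] := G_group_group.
split.
- by split=> [|s Ss]; [split | exists s; split].
- move=> k h [[Gk k0] kS] [[Gh h0] hS]; split; first by split; [exact: GM | rewrite /= h0].
  move=> s Ss; have [s1 [Ss1 E1]] := hS _ Ss; have [s2 [Ss2 E2]] := kS _ Ss1.
  exists s2; split => //; apply/funext => p.
  have /= -> := congr1 (fun f => f p) E1.
  exact: (congr1 (fun f => f (h p)) E2).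
- move=> k Nk; have [[Gk k0] kS] := Nk.
  have [h [Gh kh hk]] := GV _ Gk; exists h; split => //; split.
    by split => //; rewrite -{1}k0 kh.
  move=> s /(N_K_onto Nk)[s' [Ss' ks]]; exists s'; split => //; apply/funext => p /=.
  have [_ M] := N_K_hom Nk Ss'.
  by rewrite -(kh (an_mul J s' (h p))) M hk ks.
Qed.

Lemma N_K0_group : transformation_group (N_K0 J S).
Proof.
apply: identity_component_group; first exact: N_K_group.
by move=> f [[Gf _] _]; exact: isometry_continuous (G_isometry Gf).
Qed.

Lemma N_K0_N_K k : N_K0 J S k -> N_K J S k.
Proof. exact: identity_component_sub. Qed.

(** Contract [s] to the identity along rays. *)
Lemma translation_G s : G_group J (an_mul J s).
Proof.
pose ga (t : R) : AN R m := (t * s.1.1, t *: s.1.2, t *: s.2).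
have -> : s = ga 1 by rewrite /ga mul1r !scale1r -!surjective_pairing.
apply: (@path_identity_component R (AN R m) (Defs.isometry g) (fun t => an_mul J (ga t))).
- have c1 : Ck 0 setT (fun z : R * AN R m => z.1).
    apply: Ck_lin; [by [] | by move=> z; exact: cvg_fst].
  have c2 : Ck 0 setT (fun z : R * AN R m => z.2).
    apply: Ck_lin; [by [] | by move=> z; exact: cvg_snd].
  have c : Ck 0 setT (fun z : R * AN R m => an_mul J (ga z.1) z.2).
    have ca : Ck 0 setT (fun z : R * AN R m => z.1 * s.1.1).
      by apply: Ck_mul; [exact: c1 | exact: Ck_cst].
    have cu : Ck 0 setT (fun z : R * AN R m => z.1 *: s.1.2).
      by apply: Ck_scale; [exact: c1 | exact: Ck_cst].
    have ch : Ck 0 setT (fun z : R * AN R m => expR (z.1 * s.1.1 / 2)).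
      by apply: Ck_exp; apply: Ck_mul; [exact: ca | exact: Ck_cst].
    apply: Ck_pair; first apply: Ck_pair.
    + by apply: Ck_add; [exact: ca | exact: Ck_A c2].
    + by apply: Ck_add; [exact: cu | apply: Ck_scale; [exact: ch | exact: Ck_U c2]].
    + apply: Ck_add; first apply: Ck_add.
      * by apply: Ck_scale; [exact: c1 | exact: Ck_cst].
      * by apply: Ck_scale; [exact: Ck_exp ca | exact: Ck_X c2].
      * apply: Ck_scale; first by apply: Ck_mul; [exact: Ck_cst | exact: ch].
        by apply: Ck_br; [exact: cu | exact: Ck_U c2].
  have -> : uncurry (fun t => an_mul J (ga t)) = (fun z => an_mul J (ga z.1) z.2).
    by apply/funext => -[].
  by move=> z; exact: (c z I).
- by move=> t; exact: an_mul_isometry.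
- by apply/funext => p; rewrite /ga mul0r !scale0r an_mul0.
Qed.

Lemma rot_an_mul A s p : Sp J A ->
  rot A (an_mul J s p) = an_mul J (rot A s) (rot A p).
Proof.
by move=> SA; rewrite /rot /an_mul /= Sp_bracket// mulmxDr -scalemxAr.
Qed.

Lemma HD_rot A p v : has_deriv (rot A : AN R m -> AN R m) p v (rot A v).
Proof.
have Hid := HD_id p v.
apply: HD_pair; first apply: HD_pair; [exact: HD_A Hid | | exact: HD_X Hid].
exact: (@HD_P R m A _ (fun q : AN R m => q.1.2) _ _ _ (HD_U Hid)).
Qed.

Lemma rot_isometry A : Sp J A -> Defs.isometry g (rot A).
Proof.
move=> SA; have [_ _ SAT] := Sp_tr cJ SA.
split.
- exists (rot A^T) => p; rewrite rot_mul ?SA.1 ?rot1//.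
  by rewrite (mulmx1C SA.1) rot1.
- move=> k; have cid := @Ck_id R (AN R m) k.
  apply: Ck_pair; first apply: Ck_pair; [exact: Ck_A cid | | exact: Ck_X cid].
  by apply: (Ck_linear (framed_cV m) (P_linear A)); exact: Ck_U cid.
- move=> p u v; have [d E] := HD_rot A p u; have [_ E'] := HD_rot A p v.
  rewrite -!deriveE// E E' !an_metricE /zeta /=.
  by rewrite !(Sp_bracket _ _ SA) (Sp_dot _ _ SA).
Qed.

(** Two steps: the path lies in the isometry group, so in [G_group]; therefore it
   lies in the normalizer, so in its identity component. *)
Lemma rot_N_K0 (F : R -> 'M[R]_m) :
  continuous (fun tx : R * 'cV[R]_m => F tx.1 *m tx.2) -> F 0 = 1%:M ->
  (forall t, Sp J (F t)) -> (forall t (x : 'cV[R]_m), P *m (F t *m x) = F t *m (P *m x)) ->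
  forall t, N_K0 J S (rot (F t)).
Proof.
move=> cF F0 SF PF.
have cr : continuous (uncurry (fun t => rot (F t) : AN R m -> AN R m)).
  have c1 : Ck 0 setT (fun z : R * AN R m => z.1).
    apply: Ck_lin; [by [] | by move=> z; exact: cvg_fst].
  have c2 : Ck 0 setT (fun z : R * AN R m => z.2).
    apply: Ck_lin; [by [] | by move=> z; exact: cvg_snd].
  have c : Ck 0 setT (fun z : R * AN R m => rot (F z.1) z.2).
    apply: Ck_pair; first apply: Ck_pair; [exact: Ck_A c2 | | exact: Ck_X c2].
    move=> z _.
    have c12 : Ck 0 setT (fun z : R * AN R m => (z.1, z.2.1.2)).
      by apply: Ck_pair; [exact: c1 | exact: Ck_U c2].
    by apply: (@continuous_comp _ _ _ (fun z : R * AN R m => (z.1, z.2.1.2))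
      (fun tx : R * 'cV[R]_m => F tx.1 *m tx.2)); [exact: c12 | exact: cF].
  have -> : uncurry (fun t => rot (F t) : AN R m -> AN R m) = (fun z => rot (F z.1) z.2).
    by apply/funext => -[].
  by move=> z; exact: (c z I).
have r0 : rot (F 0) = idfun :> (AN R m -> AN R m).
  by apply/funext => p; rewrite F0 rot1.
apply: path_identity_component => // t; split; first split.
- by move: t; apply: path_identity_component => // t; exact: rot_isometry.
- by rewrite /rot /= mulmx0.
- move=> s; rewrite SE /= => Ps; exists (rot (F t) s); split.
    by rewrite /= PF Ps mulmx0.
  by apply/funext => p; exact: rot_an_mul.
Qed.

(** ** The orbits *)

Notation H := (N_K0_S J S).

Lemma H_mem k s : N_K0 J S k -> S s -> H (k \o an_mul J s).
Proof. by move=> Nk Ss; exists k => //; exists s. Qed.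

Lemma H_N_K0 k : N_K0 J S k -> H k.
Proof.
move=> Nk; have -> : k = k \o an_mul J 0 by apply/funext => p /=; rewrite an_mul0.
by apply: H_mem => //; case: S_subgroup.
Qed.

Lemma H_S s : S s -> H (an_mul J s).
Proof. by move=> Ss; have [N1 _ _] := N_K0_group; exact: H_mem N1 Ss. Qed.

(** Elements of the normalizer and of [S] can be exchanged, which makes the
   products [k \o an_mul J s] a group. *)
Lemma N_K0_commute k s : N_K0 J S k -> S s ->
  exists2 s', S s' & an_mul J s \o k = k \o an_mul J s'.
Proof.
move=> Nk Ss; have [s' [Ss' ks]] := N_K_onto (N_K0_N_K Nk) Ss.
exists s' => //; apply/funext => p /=.
by have [_ ->] := N_K_hom (N_K0_N_K Nk) Ss'; rewrite ks.
Qed.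

Lemma H_group : transformation_group H.
Proof.
have [N1 NM NV] := N_K0_group; have [S0 SM SV] := S_subgroup.
split; first exact: H_N_K0.
- move=> _ _ [k Nk [s Ss <-]] [h Nh [t St <-]].
  have [s' Ss' E] := N_K0_commute Nh Ss.
  have -> : (k \o an_mul J s) \o (h \o an_mul J t) = (k \o h) \o an_mul J (an_mul J s' t).
    apply/funext => p /=; rewrite -an_mulA; congr (k _).
    exact: (congr1 (fun f => f (an_mul J t p)) E).
  by apply: H_mem; [exact: NM | exact: SM].
- move=> _ [k Nk [s Ss <-]]; have [h [Nh kh hk]] := NV _ Nk.
  have [s' Ss' E] := N_K0_commute Nh (SV _ Ss).
  exists (h \o an_mul J s'); split; first exact: H_mem.
  + move=> p; rewrite -E /= kh an_mulA an_mulV// an_mul0//.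
  + move=> p; have /= <- := congr1 (fun f => f p) E.
    by rewrite an_mulA an_mulV'// an_mul0 hk.
Qed.

Lemma H_G : H `<=` G_group J.
Proof.
move=> _ [k /N_K0_N_K[[Gk _] _] [s Ss <-]].
by have [_ GM _] := G_group_group; apply: GM => //; exact: translation_G.
Qed.

Lemma N_K0_height k p : N_K0 J S k -> height (k p) = height p.
Proof.
have le h q : N_K0 J S h -> height (h q) <= height q.
  move=> /N_K0_N_K Nh; apply: isometry_height_le; first by apply: G_isometry; case: Nh => -[].
  by move=> s /(N_K_hom Nh)[].
move=> Nk; apply/eqP; rewrite eq_le le//=.
have [_ _ NV] := N_K0_group; have [h [Nh kh _]] := NV _ Nk.
by rewrite -{1}(kh p) le.
Qed.

Lemma H_height h p : H h -> height (h p) = height p.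
Proof.
move=> [k Nk [s Ss <-]]; rewrite /= N_K0_height//.
move: Ss; rewrite SE /= => Ps; rewrite /height /= mulmxDr -scalemxAr Ps add0r dotZl dotZr.
have -> : expR (- (s.1.1 + p.1.1)) = expR (- s.1.1) * expR (- p.1.1).
  by rewrite -expRD opprD.
have := expR_halfN s.1.1; set e := expR (s.1.1 / 2) => ee.
transitivity (expR (- s.1.1) * (e * e) * (expR (- p.1.1) * dot (P *m p.1.2) (P *m p.1.2))).
  by ring.
by rewrite ee mul1r.
Qed.

Lemma orbit_eq p q : orbit_of H p q -> orbit_of H q = orbit_of H p.
Proof.
have [H1 HM HV] := H_group.
move=> [h Hh <-]; have [h' [Hh' hh' _]] := HV _ Hh.
apply/seteqP; split=> [_ [f Hf <-]|_ [f Hf <-]].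
  by exists (f \o h) => //; exact: HM.
by exists (f \o h') => //=; [exact: HM | rewrite hh'].
Qed.

Lemma orbit_S p : S p -> orbit_of H p = S.
Proof.
have [S0 SM SV] := S_subgroup.
have o0 : orbit_of H 0 = S.
  apply/seteqP; split=> [_ [h Hh <-]|s Ss].
    by apply/height_eq0; rewrite (H_height _ Hh); apply/height_eq0.
  by exists (an_mul J s); [exact: H_S | exact: an_mulp0].
by move=> Sp; rewrite -[RHS]o0; apply: orbit_eq; rewrite o0.
Qed.

(** Transitivity through paths starting at the identity, since the action is that
   of an identity component. *)
Definition path_transitive := exists x0 : 'cV[R]_m,
  [/\ P *m x0 = x0, dot x0 x0 = 1 & forall y, P *m y = y -> dot y y = 1 ->
  exists F : R -> 'M[R]_m, [/\ continuous (fun tx : R * 'cV[R]_m => F tx.1 *m tx.2),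
    F 0 = 1%:M, forall t, Sp J (F t),
    forall t (x : 'cV[R]_m), P *m (F t *m x) = F t *m (P *m x) & F 1 *m x0 = y]].

(** A point of the level is [s] applied to a point on a geodesic leaving [S] at
   the identity, and [Sp] rotates those into each other; conversely the action
   preserves [height]. *)
Lemma orbit_level : path_transitive -> forall r p, 0 < r -> level r p ->
  orbit_of H p = level r.
Proof.
move=> [x0 [Px0 x00 tr]] r p r0 lp.
pose n (x : 'cV[R]_m) : AN R m := (- (2 * ln (ch (r + 0) / 2)), (2 * sh (r + 0) / ch (r + 0)) *: x, 0).
pose b := n x0.
have r0' : 0 < r + 0 by rewrite addr0.
have ob q : level r q -> orbit_of H b q.
  move=> lq; have lq' : level (r + 0) q by rewrite addr0.
  have [a [V [xi [Y [PV Px x1 ->]]]]] := through_level J PP r0' lq'.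
  have [F [cF F0 SF PF F1]] := tr _ Px x1.
  have [_ HM _] := H_group.
  exists (an_mul J (a, V, Y) \o rot (F 1)).
    apply: HM; last by apply: H_N_K0; exact: rot_N_K0.
    by apply: H_S; rewrite SE.
  have -> : (an_mul J (a, V, Y) \o rot (F 1)) b = an_mul J (a, V, Y) (n xi).
    by rewrite /b /n /rot /= -scalemxAr F1.
  rewrite /normal_geodesic /n /an_mul /= scaler0 addr0 scalerA n_bracketZr scalerA.
  rewrite !addr0 (_ : 2^-1 * _ * _ = expR (a / 2) * (sh r / ch r))//.
  by field; exact: ch_neq0.
apply/seteqP; split=> [_ [h Hh <-]|q lq].
  by rewrite /level /= (H_height _ Hh).
by rewrite (orbit_eq (ob p lp)); exact: ob.
Qed.

Lemma orbit_tube : path_transitive -> forall p, ~ S p ->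
  exists r, 0 < r /\ orbit_of H p = level r.
Proof.
move=> tr p Sp; have hp : 0 < height p.
  by rewrite lt_neqAle height_ge0 andbT eq_sym; apply/eqP => /height_eq0.
have [r [r0 sr]] : exists r, 0 < r /\ sh r = Num.sqrt (height p).
  by apply: sh_surj; rewrite sqrtr_gt0.
exists r; split => //; apply: orbit_level => //.
by rewrite /level /= sr sqr_sqrtr// height_ge0.
Qed.

(** [S] is the zero set of the coordinates of [U] along the [xi k]. *)
Lemma submanifold_S d (xi : 'I_d -> 'cV[R]_m) :
  (forall k l, dot (xi k) (xi l) = (k == l)%:R) ->
  (forall x, P *m x = \sum_k dot x (xi k) *: xi k) -> submanifold d S.
Proof.
move=> xo Px p Sp; pose L (q : AN R m) : 'rV[R]_d := \row_k dot q.1.2 (xi k).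
have LE q : L q = \sum_k dot q.1.2 (xi k) *: delta_mx 0 k.
  rewrite {1}(row_sum_delta (L q)); apply: eq_bigr => k _; by rewrite mxE.
have HL q v : has_deriv L q v (L v).
  have -> : L = fun q => \sum_k dot q.1.2 (xi k) *: delta_mx 0 k by apply/funext.
  have sum (s : seq 'I_d) : has_deriv
      (fun q : AN R m => \sum_(k <- s) dot q.1.2 (xi k) *: (delta_mx 0 k : 'rV[R]_d)) q v
      (\sum_(k <- s) dot v.1.2 (xi k) *: delta_mx 0 k).
    elim: s => [|k s IH].
      rewrite big_nil; apply: (@HD_ext _ _ _ _ (fun=> 0)); last exact: HD_cst.
      by move=> z; rewrite big_nil.
    rewrite big_cons; apply: (@HD_ext _ _ _ _ (fun q : AN R m =>
      dot q.1.2 (xi k) *: (delta_mx 0 k : 'rV[R]_d) +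
      \sum_(k <- s) dot q.1.2 (xi k) *: (delta_mx 0 k : 'rV[R]_d))).
      by move=> z; rewrite big_cons.
    apply: HD_add IH; apply: HD_eq.
      apply: HD_scale; last exact: HD_cst.
      exact: HD_dot (HD_U (HD_id q v)) (HD_cst (xi k) q v).
    by rewrite scaler0 add0r (dot0r q.1.2) addr0.
  exact: sum.
exists setT, L; split => //; first exact: openT.
- move=> k; apply: (Ck_ext LE); apply: Ck_sum => i.
  apply: Ck_scale; last exact: Ck_cst.
  by apply: Ck_dot; [exact: Ck_U (@Ck_id R (AN R m) k) | exact: Ck_cst].
- move=> q _; rewrite SE /= Px; split=> [E|Lq].
    apply/rowP => k; rewrite !mxE.
    have := congr1 (fun x => dot x (xi k)) E; rewrite (dot0l (xi k)) => <-.
    have sum (s : seq 'I_d) (c : 'I_d -> R) :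
        dot (\sum_(k <- s) c k *: xi k) (xi k) = \sum_(l <- s) c l * dot (xi l) (xi k).
      exact: (linear_sumE _ _ _ (dot_linearl (xi k))).
    rewrite sum (bigD1 k)//= xo eqxx mulr1 big1 ?addr0// => l lk.
    by rewrite xo (negbTE lk) mulr0.
  rewrite big1// => k _; have := congr1 (fun z : 'rV[R]_d => z 0 k) Lq.
  by rewrite !mxE => ->; rewrite scale0r.
- move=> q _ _ y _; exists (0, \sum_k y 0 k *: xi k, 0) => //.
  have [dL] := HL q (0, \sum_k y 0 k *: xi k, 0); rewrite deriveE// => ->.
  apply/rowP => k; rewrite mxE /=.
  have -> : dot (\sum_k y 0 k *: xi k) (xi k) = \sum_l y 0 l * dot (xi l) (xi k).
    exact: (linear_sumE _ _ _ (dot_linearl (xi k))).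
  rewrite (bigD1 k)//= xo eqxx mulr1 big1 ?addr0// => l lk.
  by rewrite xo (negbTE lk) mulr0.
Qed.

Lemma action_cohomogeneity_one d : path_transitive -> (1 < d)%N -> submanifold d S ->
  cohomogeneity_one H /\ singular_orbit H S.
Proof.
move=> tr d1 subS.
have sub1 p : ~ S p -> submanifold 1 (orbit_of H p).
  move=> /(orbit_tube tr)[r [r0 ->]]; exact: submanifold_level.
split; split.
- move=> p; have [Sp|Sp] := pselect (S p).
    by exists d; rewrite orbit_S//; split => //; exact: ltnW.
  by exists 1%N; split => //; exact: sub1.
- have [x0 [Px0 x00 _]] := tr; exists (0, x0, 0); apply: sub1; rewrite SE /= Px0.
  by move=> x0E; move: x00; rewrite x0E (dot0l 0) => /esym/eqP; rewrite oner_eq0.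
- exists 0; rewrite orbit_S//; by case: S_subgroup.
- by exists d.
Qed.

End Action.

(** * The subspace [w_perp] *)

Section Assembly.
Context {R : realType} {m : nat} (J : 'I_3 -> 'M[R]_m) (cJ : canonical_basis J).
Context (phi : 'I_3 -> R).
Hypotheses (phi0 : 0 < phi 0) (phi01 : phi 0 <= phi 1) (phi12 : phi 1 <= phi 2)
  (phi2 : phi 2 <= pi / 2) (phi_sum : cos (phi 0) + cos (phi 1) < 1 + cos (phi 2)).
Context (e : 'I_4 -> 'cV[R]_m) (adm : admissible_vectors J phi e).

Notation Wp := (wperp J phi e).
Notation xi := (xi J (e 0) (gvec phi e)).
Let xo := xi_ortho cJ phi0 phi01 phi12 phi2 adm.

Definition wperp_proj : 'M[R]_m := \sum_k xi k *m (xi k)^T.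
Notation P := wperp_proj.

Lemma wperp_projE (x : 'cV[R]_m) : P *m x = \sum_k dot x (xi k) *: xi k.
Proof.
rewrite /P mulmx_suml; apply: eq_bigr => k _; rewrite -mulmxA.
have -> : (xi k)^T *m x = (dot x (xi k))%:M.
  by rewrite dotC dotE {1}(mx11_scalar ((xi k)^T *m x)).
by rewrite mul_mx_scalar.
Qed.

Lemma wperp_proj_sym x y : dot (P *m x) y = dot x (P *m y).
Proof.
rewrite !wperp_projE (linear_sumE _ _ _ (dot_linearl y)).
rewrite (linear_sumE _ _ _ (@dot_linearr _ _ x)); apply: eq_bigr => k _.
by rewrite (dotC y) [LHS]mulrC.
Qed.

Lemma wperp_projP x : x \in Wp <-> P *m x = x.
Proof.
split=> [/mem_wperp[a ->]|<-].
  by rewrite wperp_projE; apply: eq_bigr => k _; rewrite (span_coord cJ phi0 phi01 phi12 phi2 adm).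
by rewrite wperp_projE; apply/mem_wperp; exists (fun k => dot x (xi k)).
Qed.

Lemma wperp_proj_idem (x : 'cV[R]_m) : P *m (P *m x) = P *m x.
Proof.
by apply/wperp_projP; rewrite wperp_projE; apply/mem_wperp; exists (fun k => dot x (xi k)).
Qed.

Lemma stabilizer_proj A (x : 'cV[R]_m) : stabilizer J phi e A ->
  P *m (A *m x) = A *m (P *m x).
Proof.
move=> sA; have [SA WA] := sA; have [_ WT] := stabilizer_tr cJ phi0 phi01 phi12 phi2 adm sA.
have Wx z : P *m z \in Wp by apply/wperp_projP; exact: wperp_proj_idem.
have -> : A *m x = A *m (P *m x) + A *m (x - P *m x) by rewrite mulmxBr addrC subrK.
rewrite mulmxDr (_ : P *m (A *m (x - _)) = 0); last first.
  apply: dot_eq0; rewrite wperp_proj_sym wperp_proj_idem.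
  have /WT Wy := Wx (A *m (x - P *m x)); move: Wy; set y := P *m (A *m _) => Wy.
  have -> : dot (A *m (x - P *m x)) y = dot (x - P *m x) (A^T *m y).
    by rewrite !dotE trmx_mul mulmxA.
  move/wperp_projP: Wy => <-.
  by rewrite -wperp_proj_sym mulmxBr wperp_proj_idem subrr dot0l.
by rewrite addr0; apply/wperp_projP/WA/Wx.
Qed.

Lemma wperp_unit x : P *m x = x -> dot x x = 1 -> unit_sphere Wp x.
Proof. by move=> /wperp_projP. Qed.

Lemma wperp_direction_transitive : direction_transitive J P.
Proof.
move=> x y Px Py x1 y1.
have [_ tr] := stabilizer_transitive cJ phi0 phi01 phi12 phi2 phi_sum adm.
have [A [sA Ax]] := tr _ _ (wperp_unit Px x1) (wperp_unit Py y1).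
by exists A; split => //; [case: sA | move=> z; exact: stabilizer_proj].
Qed.

Lemma wperp_path_transitive : path_transitive J P.
Proof.
exists (xi 0); split.
- by apply/wperp_projP; exact: xi_mem.
- by rewrite xo eqxx.
move=> y Py y1.
have [q [q1 ->]] := (wperp_sphereP cJ phi0 phi01 phi12 phi2 adm y).1 (wperp_unit Py y1).
have [F [cF F0 SF F1]] := wperp_path cJ phi0 phi01 phi12 phi2 phi_sum adm q1.
exists F; split => //; first by move=> t; case: (SF t).
by move=> t x; exact: stabilizer_proj (SF t).
Qed.

End Assembly.

Unset Implicit Arguments.

Theorem theorem5p2 (R : realType) (n : nat) (J : 'I_3 -> 'M[R]_(4 * n.-1))
    (phi : 'I_3 -> R) :
  (5 <= n)%N ->
  canonical_basis J ->
  0 < phi 0 -> phi 0 <= phi 1 -> phi 1 <= phi 2 -> phi 2 <= pi / 2 ->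
  cos (phi 0) + cos (phi 1) < 1 + cos (phi 2) ->
  (exists e : 'I_4 -> 'cV[R]_(4 * n.-1), admissible_vectors J phi e) /\
  (forall e : 'I_4 -> 'cV[R]_(4 * n.-1), admissible_vectors J phi e ->
    let Wp := wperp J phi e in
    let S := S_w J Wp in
    let g := an_metric J in
    let H := N_K0_S J S in
    [/\ constant_kahler_angle J Wp phi,
        (* (a) *)
        (forall r : R, 0 < r ->
          isoparametric_hypersurface g (tube g S r) /\
          constant_principal_curvatures g (tube g S r)),
        (* (b) *)
        (exists L : set 'M[R]_(4 * n.-1),
          [/\ matrix_group L, L `<=` SpSp1 J &
              acts_transitively L (unit_sphere Wp)]) &
        (* (c) *)
        [/\ transformation_group H, H `<=` G_group J, cohomogeneity_one H,
            singular_orbit H S &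
            forall p, ~ S p -> exists r : R, 0 < r /\ orbit_of H p = tube g S r]]).
Proof.
move=> n5 cJ phi0 phi01 phi12 phi2 phi_sum; split.
  apply: admissible_exists => //.
  by rewrite (leq_mul2l 4 4 n.-1); case: n n5 {J cJ}.
move=> e adm Wp S g H.
have Psym := @wperp_proj_sym R _ J phi e.
have PP := wperp_proj_idem cJ phi0 phi01 phi12 phi2 adm.
have PW := wperp_projP cJ phi0 phi01 phi12 phi2 adm.
have dtr := wperp_direction_transitive cJ phi0 phi01 phi12 phi2 phi_sum adm.
have ptr := wperp_path_transitive cJ phi0 phi01 phi12 phi2 phi_sum adm.
have unit : exists x, wperp_proj J phi e *m x = x /\ dot x x = 1.
  by have [x0 [? ? _]] := ptr; exists x0.
split.
- exact: kahler_wperp.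
- move=> r r0; rewrite /g /S (tube_level cJ Psym PP PW r0).
  exact: level_isoparametric.
- exists (stabilizer J phi e); split.
  + exact: (stabilizer_group cJ phi0 phi01 phi12 phi2 adm).
  + exact: stabilizer_SpSp1.
  + exact: (stabilizer_transitive cJ phi0 phi01 phi12 phi2 phi_sum adm).
- have subS : submanifold 4 S.
    apply: (submanifold_S cJ Psym PP PW (xi_ortho cJ phi0 phi01 phi12 phi2 adm)).
    exact: wperp_projE.
  have [co so] := action_cohomogeneity_one cJ Psym PP PW ptr (isT : (1 < 4)%N) subS.
  split=> //.
  + exact: (H_group cJ Psym PP PW).
  + exact: H_G.
  + move=> p Sp; have [r [r0 ->]] := orbit_tube cJ Psym PP PW ptr Sp.
    by exists r; rewrite (tube_level cJ Psym PP PW r0).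
Qed.
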